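(* Let $\Omega\subset\mathbb{R}^n$ be an open convex set that does not contain affine lines. Then $$\int_{\Omega}\frac{|\hat f(x)|^2}{\omega_\Omega(x)}\,dx\;\le\;\frac{2^n(2n)!\,\Gamma(n/2+1)^2}{(n!)^3}\,\|f\|_{L^1}^2\qquad\text{for all } f\in \mathrm{PW}^1(\Omega).$$
   Context: The Fourier transform is $\hat f(x)=\int_{\mathbb{R}^n}f(y)e^{-2\pi i\langle x,y\rangle}\,dy$. $m$ is Lebesgue measure on $\mathbb{R}^n$, and $\omega_\Omega(x)=m(\Omega\cap(2x-\Omega))$, where $2x-\Omega=\{2x-y:y\in\Omega\}$. $\mathrm{PW}^1(\Omega)=\{f\in L^1(\mathbb{R}^n):\operatorname{supp}\hat f\subset\Omega\}$ with the $L^1$ norm; the condition $\operatorname{supp}\hat f\subset\Omega$ means that $\hat f$ vanishes almost everywhere outside $\Omega$. $\Gamma$ is the Gamma function. *)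

(* Defs.v *)
From HB Require Import structures.
From mathcomp Require Import all_boot all_order all_algebra.
From mathcomp Require Import all_classical all_reals all_analysis measurable_realfun.
From mathcomp Require Import complex.
Set Implicit Arguments.
Unset Strict Implicit.
Unset Printing Implicit Defensive.
Import Order.TTheory GRing.Theory Num.Theory.
Import numFieldNormedType.Exports.
Local Open Scope classical_set_scope.
Local Open Scope ring_scope.

(* R^n is the normed space 'rV[R]_n. Its norm is the sup norm, which is used
   here only through the topology. Its sigma-algebra is generated by the
   coordinates, as the library does for n.-tuple; [open_measurable_rV] below
   shows that it contains the open sets, so it is the Borel one. *)

Definition rV_display : measure_display.
Proof. exact: default_measure_display. Qed.

Section measurable_rV.
Variables (R : realType) (n : nat).

Let coord (i : 'I_n) (x : 'rV[R]_n) : measurableTypeR R := x ord0 i.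

Let rV_set0 : g_sigma_preimage coord set0.
Proof. exact: sigma_algebra0. Qed.

Let rV_setC A : g_sigma_preimage coord A -> g_sigma_preimage coord (~` A).
Proof. exact: sigma_algebraC. Qed.

Let rV_bigcup (F : (set 'rV[R]_n)^nat) :
  (forall i, g_sigma_preimage coord (F i)) ->
  g_sigma_preimage coord (\bigcup_i (F i)).
Proof. exact: sigma_algebra_bigcup. Qed.

HB.instance Definition _ := @isMeasurable.Build rV_display
  'rV[R]_n (g_sigma_preimage coord) rV_set0 rV_setC rV_bigcup.

Lemma measurable_coord_rV (i : 'I_n) :
  measurable_fun setT (fun x : 'rV[R]_n => x ord0 i : measurableTypeR R).
Proof.
move=> _ Y mY; rewrite setTI; apply: sub_sigma_algebra => /=.
rewrite -bigcup_seq/=; exists i => /=; first by rewrite mem_index_enum.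
by exists Y => //; rewrite setTI.
Qed.

Lemma measurable_fun_rVP d (T : measurableType d) (f : T -> 'rV[R]_n) :
  measurable_fun setT f <->
  forall i, measurable_fun setT (fun t => f t ord0 i : measurableTypeR R).
Proof.
split=> [mf i|mf].
  exact: (measurableT_comp (measurable_coord_rV i) mf).
have : g_sigma_preimage (fun i => coord i \o f) `<=` @measurable d T.
  apply: smallest_sub; first exact: sigma_algebra_measurable.
  by rewrite -bigcup_seq => A [i _ [B mB <-]]; exact: mf.
by rewrite g_sigma_preimage_comp => s _ A mA; apply: s; exists A.
Qed.

End measurable_rV.

(* The library proves this, but canonical inference does not find its instance:
   it is hidden by the one for subprobabilities. *)
Lemma sigma_finite_prod d1 d2 (T1 : measurableType d1) (T2 : measurableType d2)
  (R : realType) (m1 : {sigma_finite_measure set T1 -> \bar R})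
  (m2 : {sigma_finite_measure set T2 -> \bar R}) :
  sigma_finite setT (m1 \x m2)%E.
Proof.
have /sigma_finiteP[F [TF ndF Foo]] := sigma_finiteT m1.
have /sigma_finiteP[G [TG ndG Goo]] := sigma_finiteT m2.
exists (fun n => F n `*` G n).
  rewrite -setXTT TF TG predeqE => -[x y]; split.
    move=> [/= [n _ Fnx] [k _ Gky]]; exists (maxn n k) => //; split.
    - by move: x Fnx; exact/subsetPset/ndF/leq_maxl.
    - by move: y Gky; exact/subsetPset/ndG/leq_maxr.
  by move=> [n _ []/= ? ?]; split; exists n.
move=> k; have [? ?] := Foo k; have [? ?] := Goo k.
split; first exact: measurableX.
by rewrite product_measure1E// lte_mul_pinfty// ge0_fin_numE.
Qed.

Section lebesgue_rV.
Variable R : realType.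

Definition rV_cons n (p : measurableTypeR R * 'rV[R]_n) : 'rV[R]_n.+1 :=
  \row_i oapp (p.2 ord0) p.1 (unlift ord0 i).

Definition rV_uncons n (x : 'rV[R]_n.+1) : measurableTypeR R * 'rV[R]_n :=
  (x ord0 ord0, \row_i x ord0 (lift ord0 i)).

Lemma rV_consK n : cancel (@rV_cons n) (@rV_uncons n).
Proof.
move=> [t v]; rewrite /rV_uncons/= mxE unlift_none/=; congr pair.
by apply/rowP => i; rewrite !mxE liftK.
Qed.

Lemma measurable_rV_cons n : measurable_fun setT (@rV_cons n).
Proof.
apply/measurable_fun_rVP => i.
under eq_fun do rewrite mxE.
case: (unlift ord0 i) => [j|] /=; last exact: measurable_fst.
exact: (measurableT_comp (measurable_coord_rV j) measurable_snd).
Qed.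

Lemma measurable_rV_uncons n : measurable_fun setT (@rV_uncons n).
Proof.
apply: measurable_fun_pair => /=; first exact: measurable_coord_rV.
apply/measurable_fun_rVP => i; under eq_fun do rewrite mxE.
exact: measurable_coord_rV.
Qed.

Section lebesgue_rVS.
Variables (n : nat) (mu : {sigma_finite_measure set 'rV[R]_n -> \bar R}).
Local Open Scope ereal_scope.

Definition lebesgue_rVS : set 'rV[R]_n.+1 -> \bar R :=
  pushforward (lebesgue_measure \x mu) (@rV_cons n).

Let mcons := @measurable_rV_cons n.

Let lebesgue_rVS0 : lebesgue_rVS set0 = 0.
Proof. by rewrite /lebesgue_rVS /pushforward preimage_set0 measure0. Qed.

Let lebesgue_rVS_ge0 A : 0 <= lebesgue_rVS A.
Proof. exact: measure_ge0. Qed.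

Let lebesgue_rVS_sigma_additive : semi_sigma_additive lebesgue_rVS.
Proof. exact: measure_semi_sigma_additive. Qed.

HB.instance Definition _ := isMeasure.Build _ _ _ lebesgue_rVS
  lebesgue_rVS0 lebesgue_rVS_ge0 lebesgue_rVS_sigma_additive.

Let lebesgue_rVS_sigma_finite : sigma_finite setT lebesgue_rVS.
Proof.
have [F FT Foo] := sigma_finite_prod lebesgue_measure mu.
exists (fun k => @rV_uncons n @^-1` F k).
  by rewrite -preimage_bigcup -FT preimage_setT.
move=> k; have [mF mFoo] := Foo k; split.
  by rewrite -[X in measurable X]setTI; exact: measurable_rV_uncons.
rewrite /lebesgue_rVS /pushforward -comp_preimage.
by rewrite (_ : _ \o _ = id) ?preimage_id//; apply/funext/rV_consK.
Qed.

HB.instance Definition _ := Measure_isSigmaFinite.Build _ _ _ lebesgue_rVS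
  lebesgue_rVS_sigma_finite.

End lebesgue_rVS.

(* Lebesgue measure on R^n as an iterated product; [lebesgue_rV_box] gives its
   value on boxes, which determines it on the Borel sets. *)
Fixpoint lebesgue_rV n : {sigma_finite_measure set 'rV[R]_n -> \bar R} :=
  if n isn't m.+1 then \d_(0 : 'rV[R]_0) else lebesgue_rVS (lebesgue_rV m).

Lemma lebesgue_rV_box n (A : 'I_n -> set (measurableTypeR R)) :
  (forall i, measurable (A i)) ->
  lebesgue_rV n [set x | forall i, A i (x ord0 i)] =
    (\prod_(i < n) lebesgue_measure (A i))%E.
Proof.
elim: n A => [|n IH] A mA /=.
  by rewrite big_ord0 diracE mem_set// => -[].
rewrite big_ord_recl -IH//.
have mB : measurable [set x : 'rV[R]_n | forall i, A (lift ord0 i) (x ord0 i)].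
  rewrite (_ : mkset _ = \big[setI/setT]_(i < n)
      ((fun x : 'rV[R]_n => x ord0 i) @^-1` A (lift ord0 i))); last first.
    rewrite -bigcap_seq; apply/seteqP; split => x /= Ax i; first by move=> _; exact: Ax.
    by apply: Ax => /=; rewrite mem_index_enum.
  apply: bigsetI_measurable => i _; rewrite -[X in measurable X]setTI.
  exact: measurable_coord_rV.
rewrite -product_measure1E// /lebesgue_rVS /pushforward.
congr product_measure1; apply/seteqP; split => [[t v] /= Atv|[t v] [/= At Av] i].
  split => /= [|i]; first by have := Atv ord0; rewrite mxE unlift_none.
  by have := Atv (lift ord0 i); rewrite mxE liftK.
by rewrite mxE; case: unliftP => [j|] ->/=.
Qed.

End lebesgue_rV.

Lemma open_measurable_rV (R : realType) n (U : set 'rV[R]_n) :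
  open U -> measurable U.
Proof.
move=> oU.
pose B (p : 'rV[rat]_n * nat) : set 'rV[R]_n :=
  [set y | forall i, `|ratr (p.1 ord0 i) - y ord0 i| < p.2.+1%:R^-1].
have mB p : measurable (B p).
  rewrite (_ : B p = \big[setI/setT]_(i < n) ((fun x : 'rV[R]_n => x ord0 i) @^-1`
      ball (ratr (p.1 ord0 i) : R) p.2.+1%:R^-1)); last first.
    rewrite -bigcap_seq; apply/seteqP; split => x /= Ax i; first by move=> _; exact: Ax.
    by apply: Ax => /=; rewrite mem_index_enum.
  apply: bigsetI_measurable => i _; rewrite -[X in measurable X]setTI.
  by apply: measurable_coord_rV => //; exact: measurable_ball.
rewrite (_ : U = \bigcup_p (if `[< B p `<=` U >] then B p else set0)).
  by apply: countable_bigcupT_measurable => // p; case: ifP.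
apply/seteqP; split => [x Ux|x [p _]]; last by case: ifPn => // /asboolP; exact.
have /nbhs_ballP[e /= e0 exU] := open_nbhs_nbhs (conj oU Ux).
have [k ke] : exists k, k.+1%:R^-1 < e / 2.
  by have [k _ /(_ k (leqnn k))] := near_infty_natSinv_lt (PosNum (divr_gt0 e0 (@ltr0Sn R 1))); exists k.
have k0 : 0 < k.+1%:R^-1 :> R by [].
have /choice[q qx] i : exists q, `|ratr q - x ord0 i| < k.+1%:R^-1.
  have /rat_in_itvoo[q] : x ord0 i - k.+1%:R^-1 < x ord0 i + k.+1%:R^-1.
    by rewrite ltrBlDr -addrA ltrDl addr_gt0.
  by rewrite in_itv/= => xq; exists q; rewrite ltr_distl.
exists (\row_i q i, k) => //; rewrite asboolT => [i /=|y /= By]; first by rewrite mxE.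
apply: exU; split => // a i; rewrite (ord1 a) /ball/=.
have := By i; rewrite mxE => yq.
rewrite -(subrKA (ratr (q i))) (le_lt_trans (ler_normD _ _))// [ltRHS]splitr ltrD//.
  by rewrite distrC (lt_trans (qx i)).
exact: lt_trans yq ke.
Qed.

Section fourier.
Variable R : realType.

Definition Gamma (s : R) : R :=
  \int[lebesgue_measure]_(t in `]0, +oo[) (t `^ (s - 1) * expR (- t)).

Section complex_integral.
Context d (T : measurableType d) (mu : {measure set T -> \bar R}).

Definition cintegrable (f : T -> R[i]) : Prop :=
  mu.-integrable setT (fun x => (complex.Re (f x))%:E) /\
  mu.-integrable setT (fun x => (complex.Im (f x))%:E).

Definition cintegral (f : T -> R[i]) : R[i] :=
  ((\int[mu]_x complex.Re (f x)) +i* (\int[mu]_x complex.Im (f x)))%C.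

End complex_integral.

Definition expi (t : R) : R[i] := (cos t +i* sin t)%C.

Variable n : nat.
Implicit Types (f : 'rV[R]_n -> R[i]) (Omega : set 'rV[R]_n).

Definition dotrV (x y : 'rV[R]_n) : R := \sum_(i < n) x ord0 i * y ord0 i.

Definition fourier f (x : 'rV[R]_n) : R[i] :=
  cintegral (lebesgue_rV R n)
    (fun y => f y * expi (- (2 * pi * dotrV x y))).

Definition L1norm f : \bar R :=
  (\int[lebesgue_rV R n]_x (Normc.normc (f x))%:E)%E.

(* As for any L^1 space over the Borel sigma-algebra, f ranges over Borel
   functions; every Lebesgue measurable function agrees a.e. with one. *)
Definition PW1 Omega : set ('rV[R]_n -> R[i]) :=
  [set f | cintegrable (lebesgue_rV R n) f /\
    {ae lebesgue_rV R n, forall x, ~ Omega x -> fourier f x = 0}].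

(* Extended-real, since Omega may have infinite measure. *)
Definition omega Omega (x : 'rV[R]_n) : \bar R :=
  lebesgue_rV R n (Omega `&` [set 2 *: x - y | y in Omega]).

Definition contains_affine_line Omega : Prop :=
  exists p v : 'rV[R]_n, v != 0 /\ forall t : R, Omega (p + t *: v).

End fourier.

(* Main.v *)
Require Import Defs.
From HB Require Import structures.
From mathcomp Require Import all_boot all_order all_algebra.
From mathcomp Require Import all_classical all_reals all_analysis measurable_realfun.
From mathcomp Require Import complex ring lra.
Set Implicit Arguments.
Unset Strict Implicit.
Unset Printing Implicit Defensive.
Import Order.TTheory GRing.Theory Num.Theory.
Import numFieldNormedType.Exports.
Local Open Scope classical_set_scope.
Local Open Scope ring_scope.

(* Put K = Omega - xi and let h be the support function of K, so that omega_Omega(xi) = |K \cap -K|.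
   Two estimates are combined.

   Energy: int_Omega |f^(xi)|^2 (int exp(-2 pi (h_Omega(y) - <xi, y>)) dy) dxi <= ||f||_1^2.  The
   kernel k(s) = exp(-2 pi (eps - i) lam h(s)), lam > 1, is bounded by 1, so |f^|^2 integrated against
   k^ is at most ||f||_1^2 (autocorrelation, regularised by a Gaussian), while rotating the contour
   s -> i s turns k^(xi) into i^n int exp(-2 pi (lam h - <xi, s>)) up to an error vanishing with eps.

   Mahler type inequality: |K \cap -K| int exp(-h) >= pi^n n!^3 / ((2n)! Gamma(n/2+1)^2).  By the
   Rogers-Shephard convolution argument, 2^n int exp(-h) bounds int exp(-g) for g the support
   function of K \cap -K.  For polytopes |K \cap -K| |{g < 1}| is then bounded below in the manner
   of Kuperberg: the graph of the subdifferential of g^2/2, thickened by eps, is a strongly monotone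
   cone U covered by finitely many n-dimensional subspaces of R^2n, every w in R^2n splits uniquely
   as u + v* with u, v in U and (x, e)* = (x, -e), and the maps r u + s v* scale Lebesgue measure
   by (r s)^n.  A second contour rotation compares int exp(i <x, e> - k |w|^2) with
   int exp(-(q(u) + q(v))), q(x, e) = <x, e>, and homogeneity turns the latter into the measure of
   {sqrt q(u) + sqrt q(v) < 1}, which lies in a slight dilate of (K \cap -K) x {g < 1}. *)

(** * Measures scaled by a map *)

(** Neither contour rotation uses complex analysis: real dilations leave an integral unchanged, and
    the Cauchy-Riemann equations carry this over to imaginary ones. The obstacle is a majorant
    uniform in the angle. For the kernel it comes from [lam > 1] and [eps > 0], which make the two
    exponents [eps lam h] and [lam h - <xi, s>] comparable where [h] is finite. For the splitting it
    comes from the thickening: the graph itself is only monotone, whereas on [U] one has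
    [q(u) >= const |u|^2], and the splitting is unique and Lipschitz. Constants: with [C] the
    measure of [{q(u) < 1, q(v) < 1}], the integral of [e^(-(q(u) + q(v)))] is [C Gamma(n/2+1)^2],
    while that of [e^(-(sqrt q(u) + sqrt q(v)))] is both [C n!^2] and [(2n)!] times the measure of
    the diamond. A third [n!] turns [|{g < 1}|] into the integral of [e^(-g)]. Substituting
    [y / (2 pi)] in the energy cancels the powers of pi. [K] is symmetrised because the second part
    enters [e = e1 - e2] with a minus sign, so that [g] has to be even. *)

Section measure_tools.
Context d (T : measurableType d) (R : realType).

Lemma scaled_measure_integral (mu : {measure set T -> \bar R}) (phi : T -> T)
    (c : R) : measurable_fun setT phi -> 0 <= c ->
    (forall A, measurable A -> mu (phi @^-1` A) = c%:E * mu A)%E ->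
  forall f : T -> \bar R, measurable_fun setT f -> (forall x, 0 <= f x)%E ->
  (\int[mu]_x f (phi x) = c%:E * \int[mu]_x f x)%E.
Proof.
move=> mphi c0 H f mf f0.
rewrite -(ge0_integral_mscale mu measurableT (NngNum c0))//.
transitivity (\int[pushforward mu phi]_x f x)%E.
  by rewrite ge0_integral_pushforward.
by apply: eq_measure_integral => A mA _; exact: H.
Qed.

Lemma scaled_measure_integrable (mu : {measure set T -> \bar R}) (phi : T -> T)
    (c : R) : measurable_fun setT phi -> 0 <= c ->
    (forall A, measurable A -> mu (phi @^-1` A) = c%:E * mu A)%E ->
  forall f : T -> R, mu.-integrable setT (EFin \o f) ->
  mu.-integrable setT (EFin \o (f \o phi)).
Proof.
move=> mphi c0 H f /integrableP[mf fi]; apply/integrableP; split.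
  exact: (measurableT_comp mf mphi).
rewrite /= (@scaled_measure_integral mu phi c mphi c0 H (fun x => `|(f x)%:E|%E))//.
  by rewrite lte_mul_pinfty//.
exact: measurableT_comp.
Qed.

Lemma scaled_measure_Rintegral (mu : {measure set T -> \bar R}) (phi : T -> T)
    (c : R) : measurable_fun setT phi -> 0 <= c ->
    (forall A, measurable A -> mu (phi @^-1` A) = c%:E * mu A)%E ->
  forall f : T -> R, mu.-integrable setT (EFin \o f) ->
  (\int[mu]_x f (phi x) = c * \int[mu]_x f x)%R.
Proof.
move=> mphi c0 H f fi; have fi' := @scaled_measure_integrable mu phi c mphi c0 H f fi.
rewrite -RintegralZl//; congr fine.
have /integrableP[mf _] := fi.
transitivity (\int[pushforward mu phi]_x (f x)%:E)%E.
  by rewrite (@integral_pushforward _ _ _ _ _ phi mphi mu setT (EFin \o f)).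
transitivity (\int[mscale (NngNum c0) mu]_x (f x)%:E)%E.
  by apply: eq_measure_integral => A mA _; exact: H.
rewrite [LHS]integralE ge0_integral_mscale ?ge0_integral_mscale//=; last 2 first.
- exact: measurable_funeneg.
- exact: measurable_funepos.
rewrite -muleBr//; last first.
  by rewrite fin_num_adde_defl// fin_numN; exact: integrable_neg_fin_num.
rewrite -integralE -integralZl//.
Qed.

End measure_tools.

Section invariant_measure_unique.
Context d (T : measurableType d) (R : realType) (add : T -> T -> T) (opp : T -> T).
Variables mu nu : {sigma_finite_measure set T -> \bar R}.
Hypotheses (madd : measurable_fun setT (fun p : T * T => add p.1 p.2))
  (mopp : measurable_fun setT opp).
Hypothesis subKadd : forall x y, add x (opp (add y x)) = opp y.
Hypothesis mu_inv : forall c A, measurable A -> mu (add^~ c @^-1` A) = mu A.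
Hypothesis mu_invl : forall c A, measurable A -> mu (add c @^-1` A) = mu A.
Hypothesis nu_inv : forall c A, measurable A -> nu (add^~ c @^-1` A) = nu A.
Local Open Scope ereal_scope.

Let mshift c : measurable_fun setT (add^~ c).
Proof.
rewrite (_ : add^~ c = (fun p : T * T => add p.1 p.2) \o (fun x => (x, c)))//.
by apply: (measurableT_comp madd); exact: measurable_fun_pair.
Qed.

Let mshiftl c : measurable_fun setT (add c).
Proof.
rewrite (_ : add c = (fun p : T * T => add p.1 p.2) \o (fun x => (c, x)))//.
by apply: (measurableT_comp madd); exact: measurable_fun_pair.
Qed.

Let mind (A : set T) : measurable A -> measurable_fun setT (fun x => (\1_A x)%:E : \bar R).
Proof. by move=> mA; apply/measurable_EFinP. Qed.

Let inv1 (m : {measure set T -> \bar R}) phi : measurable_fun setT phi ->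
   (forall A, measurable A -> m (phi @^-1` A) = m A) ->
  forall f : T -> \bar R, measurable_fun setT f -> (forall x, 0 <= f x) ->
   \int[m]_x f (phi x) = \int[m]_x f x.
Proof.
move=> mphi H f mf f0.
rewrite (@scaled_measure_integral _ T R m phi 1 mphi)// ?mul1e//.
by move=> A mA; rewrite mul1e H.
Qed.

(** Uniqueness of Haar measure: the double integral of [1_A(x - y) 1_B(y)] is evaluated by Tonelli
    in both orders, once directly and once after the shift of [y] by [x], which turns the integrand
    into [1_A(- y) 1_B(y + x)]. *)
Lemma invariant_measure_unique A B : measurable A -> measurable B ->
  nu B * mu A = nu (opp @^-1` A) * mu B.
Proof.
move=> mA mB.
have msub : measurable_fun setT (fun p : T * T => add p.1 (opp p.2)).
  rewrite (_ : (fun p => _) = (fun p : T * T => add p.1 p.2) \o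
    (fun p => (p.1, opp p.2)))//.
  apply: (measurableT_comp madd); apply: measurable_fun_pair => //.
  exact: (measurableT_comp mopp).
have mf : measurable_fun setT (fun p : T * T =>
    (\1_A (add p.1 (opp p.2)))%:E * (\1_B p.2)%:E : \bar R).
  apply: emeasurable_funM.
    exact: (measurableT_comp (mind mA) msub).
  exact: (measurableT_comp (mind mB) measurable_snd).
have mg : measurable_fun setT (fun p : T * T =>
    (\1_A (opp p.2))%:E * (\1_B (add p.2 p.1))%:E : \bar R).
  apply: emeasurable_funM.
    exact: (measurableT_comp (mind mA) (measurableT_comp mopp measurable_snd)).
  apply: (measurableT_comp (mind mB)).
  rewrite (_ : (fun p => _) = (fun p : T * T => add p.1 p.2) \o
    (fun p => (p.2, p.1)))//.
  by apply: (measurableT_comp madd); exact: measurable_fun_pair.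
have i0 (C : set T) x : 0 <= (\1_C x)%:E :> \bar R by rewrite lee_fin.
transitivity (\int[mu]_x \int[nu]_y ((\1_A (add x (opp y)))%:E * (\1_B y)%:E)).
  rewrite (fubini_tonelli (fun p : T * T =>
    (\1_A (add p.1 (opp p.2)))%:E * (\1_B p.2)%:E))//=.
  under eq_integral => y _.
    rewrite ge0_integralZr//; last first.
      exact: (measurableT_comp (mind mA) (mshift _)).
    rewrite (@inv1 mu (add^~ (opp y)) (mshift _) (mu_inv _) (fun x => (\1_A x)%:E))//; last exact: mind.
    rewrite integral_indic// setIT.
    over.
  rewrite ge0_integralZl//; last exact: mind.
  by rewrite integral_indic// setIT muleC.
transitivity (\int[mu]_x \int[nu]_y ((\1_A (opp y))%:E * (\1_B (add y x))%:E)).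
  apply: eq_integral => x _.
  rewrite -(@inv1 nu (add^~ x) (mshift _) (nu_inv _) (fun y => (\1_A (add x (opp y)))%:E * (\1_B y)%:E))//.
  - by apply: eq_integral => y _; rewrite subKadd.
  - apply: emeasurable_funM; last exact: mind.
    by apply: (measurableT_comp (mind mA)); apply: (measurableT_comp (mshiftl _)).
rewrite (fubini_tonelli (fun p : T * T =>
    (\1_A (opp p.2))%:E * (\1_B (add p.2 p.1))%:E))//=.
under eq_integral => y _.
  rewrite ge0_integralZl//; last exact: (measurableT_comp (mind mB) (mshiftl _)).
  rewrite (@inv1 mu (add y) (mshiftl _) (mu_invl _) (fun x => (\1_B x)%:E))//; last exact: mind.
  rewrite integral_indic// setIT.
  over.
rewrite ge0_integralZr//; last exact: (measurableT_comp (mind mA) mopp).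
congr (_ * _).
rewrite (_ : (fun x => _) = (fun x => (\1_(opp @^-1` A) x)%:E))//.
rewrite integral_indic// ?setIT//.
by rewrite -[X in measurable X]setTI; exact: mopp.
Qed.

End invariant_measure_unique.

(** * Lebesgue measure on R^n under linear maps *)

Section scaling_maps.
Local Open Scope ereal_scope.

(** Stated with preimages, so for an invertible linear [phi] the factor [c] is the inverse of the
    absolute determinant. *)
Definition scales d (T : measurableType d) (R : realType)
    (mu : set T -> \bar R) (phi : T -> T) (c : R) :=
  measurable_fun setT phi /\
  forall A, measurable A -> mu (phi @^-1` A) = c%:E * mu A.

Lemma scales_prod d1 d2 (T1 : measurableType d1) (T2 : measurableType d2)
    (R : realType) (m1 : {sigma_finite_measure set T1 -> \bar R})
    (m2 : {sigma_finite_measure set T2 -> \bar R}) phi1 phi2 (c1 c2 : R) :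
  (0 < c1)%R -> (0 < c2)%R -> scales m1 phi1 c1 -> scales m2 phi2 c2 ->
  scales (m1 \x m2) (fun p => (phi1 p.1, phi2 p.2)) (c1 * c2).
Proof.
move=> c10 c20 [mphi1 H1] [mphi2 H2].
have mphi : measurable_fun setT (fun p : T1 * T2 => (phi1 p.1, phi2 p.2)).
  apply: measurable_fun_pair.
    exact: (measurableT_comp mphi1 measurable_fst).
  exact: (measurableT_comp mphi2 measurable_snd).
split => // A mA.
have k0 : (0 <= (c1 * c2)^-1)%R by rewrite invr_ge0 mulr_ge0// ltW.
pose m' : {measure set (T1 * T2) -> \bar R} :=
  mscale (NngNum k0) (pushforward (m1 \x m2) (fun p => (phi1 p.1, phi2 p.2))).
rewrite (@product_measure_unique _ _ _ _ _ m1 m2 (m' mphi) _ A mA).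
  rewrite /m'/= /mscale/= /pushforward muleA -EFinM mulfV ?mul1e//.
  by rewrite mulf_neq0// gt_eqF.
move=> B C mB mC; rewrite /m'/= /mscale/= /pushforward.
rewrite (_ : _ @^-1` _ = (phi1 @^-1` B) `*` (phi2 @^-1` C))//.
rewrite product_measure1E//; last 2 first.
- by rewrite -[X in measurable X]setTI; exact: mphi1.
- by rewrite -[X in measurable X]setTI; exact: mphi2.
have K (x y : \bar R) : ((c1 * c2)^-1)%:E * ((c1%:E * x) * (c2%:E * y)) = x * y.
  rewrite (muleACA c1%:E) -EFinM (muleA _ (c1 * c2)%:E) -EFinM mulVf ?mul1e//.
  by rewrite mulf_neq0// gt_eqF.
by rewrite -[RHS]K; congr (_ * (_ * _)); [exact: H1|exact: H2].
Qed.

Lemma scales_comp d (T : measurableType d) (R : realType)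
    (mu : set T -> \bar R) phi psi c c' :
  scales mu phi c -> scales mu psi c' -> scales mu (phi \o psi) (c * c').
Proof.
move=> [mphi H1] [mpsi H2]; split; first exact: measurableT_comp.
move=> A mA; rewrite comp_preimage/= H2 ?H1//; first by rewrite muleA -EFinM mulrC.
by rewrite -[X in measurable X]setTI; exact: mphi.
Qed.

End scaling_maps.

Section lebesgue1.
Variable R : realType.
Local Open Scope ereal_scope.
Notation leb := (@lebesgue_measure R).

Lemma scales_lebesgue_shift (c : R) : scales leb (fun x : measurableTypeR R => (x + c)%R : measurableTypeR R) 1.
Proof.
have mf : measurable_fun setT (fun x : measurableTypeR R => (x + c)%R : measurableTypeR R).
  by apply: measurable_funD.
split => // A mA; rewrite mul1e; apply/esym.
apply: (@lebesgue_measure_unique _ (pushforward leb (fun x : measurableTypeR R => (x + c)%R : measurableTypeR R))) => // _ [[a b]] _ <-.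
transitivity (leb `](a - c)%R, (b - c)%R]%classic); last first.
  congr (leb _); apply/seteqP; split => x /=; rewrite !in_itv/= ?ltrBlDr ?lerBrDr//.
by rewrite /= !lebesgue_measure_itv/= !lte_fin ltrD2r -!EFinB opprB addrA subrK.
Qed.

Lemma scales_lebesgue_scale (r : R) : (0 < r)%R ->
  scales leb (fun x : measurableTypeR R => (r * x)%R : measurableTypeR R) r^-1.
Proof.
move=> r0.
have mf : measurable_fun setT (fun x : measurableTypeR R => (r * x)%R : measurableTypeR R).
  by apply: measurable_funM.
split => // A mA.
have r0' : (0 <= r)%R by exact: ltW.
rewrite -[LHS]mul1e -(mulVf (lt0r_neq0 r0)) EFinM -muleA; congr (_ * _); apply/esym.
apply: (@lebesgue_measure_unique _ (mscale (NngNum r0')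
   (pushforward leb (fun x : measurableTypeR R => (r * x)%R : measurableTypeR R)))) => // _ [[a b]] _ <-.
transitivity (r%:E * leb `](a / r)%R, (b / r)%R]%classic); last first.
  congr (_ * leb _); apply/seteqP; split => x /=;
    by rewrite !in_itv/= ltr_pdivrMr// ler_pdivlMr// (mulrC x).
rewrite !lebesgue_measure_itv/= !lte_fin ltr_pM2r ?invr_gt0//.
case: ifPn => _; last by rewrite mule0.
by rewrite -!EFinB -EFinM -mulrBl mulrC divfK// gt_eqF.
Qed.

Lemma scales_lebesgue_opp :
  scales leb (fun x : measurableTypeR R => (- x)%R : measurableTypeR R) 1.
Proof.
split => [|A mA]; first exact: oppr_measurable.
by rewrite mul1e; exact: lebesgue_measureN.
Qed.

End lebesgue1.

Section rV_measurability.
Variables (R : realType).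

Lemma measurable_rV_add n d (T : measurableType d) (f g : T -> 'rV[R]_n) :
  measurable_fun setT f -> measurable_fun setT g ->
  measurable_fun setT (fun x => f x + g x).
Proof.
move=> /measurable_fun_rVP mf /measurable_fun_rVP mg; apply/measurable_fun_rVP => i.
under eq_fun do rewrite mxE.
by apply: measurable_funD; [exact: mf|exact: mg].
Qed.

Lemma measurable_rV_opp n d (T : measurableType d) (f : T -> 'rV[R]_n) :
  measurable_fun setT f -> measurable_fun setT (fun x => - f x).
Proof.
move=> /measurable_fun_rVP mf; apply/measurable_fun_rVP => i.
under eq_fun do rewrite mxE.
exact: (measurableT_comp (@oppr_measurable R setT) (mf i)).
Qed.

Lemma measurable_rV_scale n d (T : measurableType d) (h : T -> measurableTypeR R)
    (f : T -> 'rV[R]_n) :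
  measurable_fun setT h -> measurable_fun setT f ->
  measurable_fun setT (fun x => (h x : R) *: f x).
Proof.
move=> mh /measurable_fun_rVP mf; apply/measurable_fun_rVP => i.
under eq_fun do rewrite mxE.
by apply: measurable_funM; [exact: mh|exact: mf].
Qed.

Lemma measurable_rV_mulmx n m d (T : measurableType d) (f : T -> 'rV[R]_n) (B : 'M[R]_(n, m)) :
  measurable_fun setT f -> measurable_fun setT (fun x => f x *m B).
Proof.
move=> /measurable_fun_rVP mf; apply/measurable_fun_rVP => i.
under eq_fun do rewrite mxE.
apply: measurable_sum => j; apply: measurable_funM; first exact: mf.
exact: measurable_cst.
Qed.

Lemma measurable_dotrV n d (T : measurableType d) (f g : T -> 'rV[R]_n) :
  measurable_fun setT f -> measurable_fun setT g ->
  measurable_fun setT (fun x => dotrV (f x) (g x) : measurableTypeR R).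
Proof.
move=> /measurable_fun_rVP mf /measurable_fun_rVP mg.
rewrite /dotrV; apply: measurable_sum => j.
by apply: measurable_funM; [exact: mf|exact: mg].
Qed.

End rV_measurability.

Section lebesgue_rV_maps.
Variable R : realType.

(** Induction on the dimension for maps acting coordinatewise. The vector [x] carries the parameters
    of the coordinate maps, which translations need; all coordinates share the factor [c]. *)
Lemma scales_rV_rec (phi0 : R -> measurableTypeR R -> measurableTypeR R)
    (phi : forall n, 'rV[R]_n -> 'rV[R]_n -> 'rV[R]_n) (c : R) :
  0 < c -> (forall x, scales (@lebesgue_measure R) (phi0 x) c) ->
  (forall n x v i, phi n x v ord0 i = phi0 (x ord0 i) (v ord0 i)) ->
  forall n x, scales (lebesgue_rV R n) (phi n x) (c ^+ n).
Proof.
move=> c0 H0 H; elim => [x|n IH x].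
  have -> : phi 0%N x = id by apply/funext => v; apply/rowP => -[].
  by split => // A mA; rewrite preimage_id expr0 mul1e.
have mphi : measurable_fun setT (phi n.+1 x).
  apply/measurable_fun_rVP => i; under eq_fun do rewrite H.
  have [m0 _] := H0 (x ord0 i).
  exact: (measurableT_comp m0 (measurable_coord_rV i)).
split => // A mA.
have [m2 H2] := scales_prod c0 (exprn_gt0 n c0) (H0 (x ord0 ord0))
  (IH (\row_i x ord0 (lift ord0 i))).
rewrite /= /lebesgue_rVS /pushforward exprS -H2; last first.
  by rewrite -[X in measurable X]setTI; exact: measurable_rV_cons.
congr (product_measure1 _ _ _); apply/seteqP; split => -[t v] /=.
  set y := (phi _ _ _); set z := rV_cons _; have -> // : y = z.
  apply/rowP => i; rewrite H !mxE; case: unliftP => [j ->|->]/=; last by [].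
  by rewrite H mxE.
set z := rV_cons _; set y := (phi _ _ _); have -> // : y = z.
apply/rowP => i; rewrite H !mxE; case: unliftP => [j ->|->]/=; last by [].
by rewrite H mxE.
Qed.

Variable n : nat.
Notation mu := (lebesgue_rV R n).

Lemma scales_rV_shift (c : 'rV[R]_n) : scales mu (fun x => x + c) 1.
Proof.
have -> : 1 = 1 ^+ n :> R by rewrite expr1n.
apply: (@scales_rV_rec (fun c x => x + c) (fun n c x => x + c)) => //.
  exact: scales_lebesgue_shift.
by move=> m x v i; rewrite mxE.
Qed.

Lemma scales_rV_scale (r : R) : 0 < r -> scales mu (fun x => r *: x) (r^-1 ^+ n).
Proof.
move=> r0; apply: (@scales_rV_rec (fun c x => r * x) (fun n c x => r *: x)) => //.
- by rewrite invr_gt0.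
- by move=> _; exact: scales_lebesgue_scale.
- by move=> m x v i; rewrite mxE.
- exact: 0.
Qed.

Lemma scales_rV_opp : scales mu (fun x => - x) 1.
Proof.
have -> : 1 = 1 ^+ n :> R by rewrite expr1n.
apply: (@scales_rV_rec (fun c x => - x) (fun n c x => - x)) => //.
- by move=> _; exact: scales_lebesgue_opp.
- by move=> m x v i; rewrite mxE.
- exact: 0.
Qed.

End lebesgue_rV_maps.

Section pushforward_iso.
Context d (T : measurableType d) (R : realType).
Variables (mu : {sigma_finite_measure set T -> \bar R}) (L L' : T -> T).
Hypotheses (mL : measurable_fun setT L) (mL' : measurable_fun setT L').
Hypotheses (LK : cancel L L').

(** The proofs are arguments so that the measure and sigma-finite structures, which depend on them,
    attach to this head symbol. *)
Definition push_iso of measurable_fun setT L & measurable_fun setT L' & cancel L L' :=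
  pushforward mu L.

Local Notation nu := (push_iso mL mL' LK).

Let nu0 : nu set0 = 0%E.
Proof. by rewrite /push_iso /pushforward preimage_set0 measure0. Qed.

Let nu_ge0 A : (0 <= nu A)%E. Proof. exact: measure_ge0. Qed.

Let nu_additive : semi_sigma_additive nu.
Proof. exact: (@measure_semi_sigma_additive _ _ _ (pushforward mu L)). Qed.

HB.instance Definition _ := isMeasure.Build _ _ _ nu nu0 nu_ge0 nu_additive.

Let sf : sigma_finite setT (push_iso mL mL' LK).
Proof.
have [F FT Foo] := sigma_finiteT mu.
exists (fun k => L' @^-1` F k).
  by rewrite -preimage_bigcup -FT preimage_setT.
move=> k; have [mF mFoo] := Foo k; split.
  by rewrite -[X in measurable X]setTI; exact: mL'.
rewrite /push_iso /pushforward -comp_preimage.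
by rewrite (_ : _ \o _ = id) ?preimage_id//; apply/funext/LK.
Qed.

HB.instance Definition _ := Measure_isSigmaFinite.Build _ _ _ (push_iso mL mL' LK) sf.

End pushforward_iso.

Section linear_scales.
Context d (T : measurableType d) (R : realType) (add : T -> T -> T) (opp : T -> T).
Variables (mu : {sigma_finite_measure set T -> \bar R}) (L L' : T -> T).
Hypotheses (madd : measurable_fun setT (fun p : T * T => add p.1 p.2))
  (mopp : measurable_fun setT opp).
Hypotheses (oppK : involutive opp) (addC : commutative add).
Hypothesis subKadd : forall x y, add x (opp (add y x)) = opp y.
Hypothesis mu_inv : forall c A, measurable A -> mu (add^~ c @^-1` A) = mu A.
Hypothesis muT : mu setT != 0%E.
Hypotheses (mL : measurable_fun setT L) (mL' : measurable_fun setT L').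
Hypotheses (LK : cancel L L') (L'K : cancel L' L).
Hypothesis Ladd : forall x y, L (add x y) = add (L x) (L y).
Local Open Scope ereal_scope.

(** The image of [mu] under an additive bijection is again translation invariant, hence proportional
    to [mu]. This gives a factor without computing a determinant. *)
Lemma linear_scales : exists c : R, [/\ (0 < c)%R, scales mu L c & scales mu L' c^-1].
Proof.
pose nu : {sigma_finite_measure set T -> \bar R} := push_iso mu mL mL' LK.
have nuE A : nu A = mu (L @^-1` A) by [].
have mpre (phi : T -> T) A : measurable_fun setT phi -> measurable A -> measurable (phi @^-1` A).
  by move=> mphi mA; rewrite -[X in measurable X]setTI; exact: mphi.
have mshift c : measurable_fun setT (add^~ c).
  rewrite (_ : add^~ c = (fun p : T * T => add p.1 p.2) \o (fun x => (x, c)))//.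
  by apply: (measurableT_comp madd); exact: measurable_fun_pair.
have U : forall A B, measurable A -> measurable B -> nu B * mu A = nu (opp @^-1` A) * mu B.
  apply: (invariant_measure_unique madd mopp subKadd mu_inv).
    by move=> c A mA; rewrite (_ : add c = add^~ c) ?mu_inv//; apply/funext => x.
  move=> c A mA; rewrite !nuE -(@mu_inv (L' c) (L @^-1` A)); last exact: mpre.
  by congr (mu _); apply/seteqP; split => x /=; rewrite Ladd L'K.
(* The factor will be [nu (- A) / mu A], so one set must be finite for both measures and not null
   for [mu]: the sets [F k], cut down to the reflections of the sets [G k], exhaust the space. *)
have [A [mA A0 Afin nuAfin]] : exists A, [/\ measurable A, mu A != 0, mu A < +oo & nu (opp @^-1` A) < +oo].
  have /sigma_finiteP[F [FT Fnd Foo]] := sigma_finiteT mu.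
  have /sigma_finiteP[G [GT Gnd Goo]] := sigma_finiteT nu.
  pose A k := F k `&` opp @^-1` (G k).
  have mA k : measurable (A k).
    by apply: measurableI; [exact: (Foo k).1|apply: mpre => //; exact: (Goo k).1].
  have [k Ak] : exists k, mu (A k) != 0.
    apply: contrapT => /forallNP H.
    have : mu (\bigcup_k A k) = 0.
      apply: measure_negligible; first exact: bigcupT_measurable.
      apply: negligible_bigcup => k; apply/negligibleP => //.
      by apply/eqP/negPn/negP; exact: H.
    suff -> : \bigcup_k A k = setT by move/eqP; rewrite (negbTE muT).
    apply/seteqP; split => // x _.
    have [i _ Fi] : (\bigcup_k F k) x by rewrite -FT.
    have [j _ Gj] : (\bigcup_k G k) (opp x) by rewrite -GT.
    exists (maxn i j) => //; split.
      by move: x Fi {Gj}; exact/subsetPset/Fnd/leq_maxl.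
    by rewrite /=; move: (opp x) Gj {Fi}; exact/subsetPset/Gnd/leq_maxr.
  exists (A k); split => //.
    rewrite (le_lt_trans _ (Foo k).2)// le_measure// ?inE//; first exact: (Foo k).1.
    by move=> x [].
  rewrite (le_lt_trans _ (Goo k).2)// le_measure// ?inE//.
  - exact: mpre.
  - exact: (Goo k).1.
  - by move=> x [_] /=; rewrite oppK.
pose c := (fine (nu (opp @^-1` A)) / fine (mu A))%R.
have A0' : (0 < fine (mu A))%R by rewrite fine_gt0// lt0e A0 measure_ge0.
have cE B : measurable B -> nu B = c%:E * mu B.
  move=> mB; have := U A B mA mB.
  rewrite -[X in X * mu B]fineK ?ge0_fin_numE// -[X in nu B * X]fineK ?ge0_fin_numE// => E.
  rewrite /c [X in X%:E * _]mulrC EFinM -muleA -E muleC -muleA -EFinM mulfV ?mule1//.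
  by rewrite gt_eqF.
have c0 : (0 < c)%R.
  rewrite lt_neqAle (divr_ge0 _ (ltW A0')) ?fine_ge0// andbT.
  apply: contra_notN (elimN eqP muT) => /eqP c0.
  by have := cE setT measurableT; rewrite -c0 mul0e nuE preimage_setT.
exists c; split => //; split => // B mB.
rewrite -[LHS]mul1e -(mulVf (lt0r_neq0 c0)) EFinM -muleA; congr (_ * _).
rewrite -cE; last exact: mpre.
by rewrite nuE -comp_preimage (_ : _ \o _ = id) ?preimage_id//; apply/funext/LK.
Qed.

End linear_scales.

(** * Lebesgue measure on pairs and linear maps of R^2n *)

Section lebesgue_pair.
Variables (R : realType) (n : nat).
Notation V := 'rV[R]_n.
Notation mu := (lebesgue_rV R n).
Local Open Scope ereal_scope.

Definition lebesgue_pair : set (V * V)%type -> \bar R := (mu \x mu).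

HB.instance Definition _ := Measure.on lebesgue_pair.

HB.instance Definition _ := Measure_isSigmaFinite.Build _ _ _ lebesgue_pair
  (sigma_finite_prod mu mu).

Definition lebE : {sigma_finite_measure set (V * V)%type -> \bar R} := lebesgue_pair.

Lemma lebEE A : lebE A = (mu \x mu) A. Proof. by []. Qed.

Lemma scales_lebE (phi1 phi2 : V -> V) (c1 c2 : R) :
  (0 < c1)%R -> (0 < c2)%R -> scales mu phi1 c1 -> scales mu phi2 c2 ->
  scales lebE (fun p => (phi1 p.1, phi2 p.2)) (c1 * c2).
Proof. by move=> ? ? ? ?; exact: scales_prod. Qed.

Lemma scales_lebE_shift (c : V * V) : scales lebE (fun p => (p.1 + c.1, p.2 + c.2)%R) 1.
Proof.
rewrite -[X in scales _ _ X]mulr1.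
by apply: (@scales_lebE (fun x => x + c.1)%R (fun x => x + c.2)%R) => //; exact: scales_rV_shift.
Qed.

Lemma scales_lebE_opp : scales lebE (fun p => (- p.1, - p.2)%R) 1.
Proof.
rewrite -[X in scales _ _ X]mulr1.
by apply: (@scales_lebE (fun x => - x)%R (fun x => - x)%R) => //; exact: scales_rV_opp.
Qed.

Lemma scales_lebE_scale (r s : R) : (0 < r)%R -> (0 < s)%R ->
  scales lebE (fun p => (r *: p.1, s *: p.2)%R) (r^-1 ^+ n * s^-1 ^+ n).
Proof.
move=> r0 s0; apply: (@scales_lebE (fun x => r *: x)%R (fun x => s *: x)%R) => //.
- by rewrite exprn_gt0// invr_gt0.
- by rewrite exprn_gt0// invr_gt0.
- exact: scales_rV_scale.
- exact: scales_rV_scale.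
Qed.

Lemma lebesgue_rV_unit_box : mu [set x | forall i, `[0%R, 1%R]%classic (x ord0 i)] = 1.
Proof.
rewrite (lebesgue_rV_box (A := fun=> `[0%R, 1%R]%classic))//.
rewrite big1// => i _; by rewrite lebesgue_measure_itv/= lte_fin ltr01 oppr0 adde0.
Qed.

Lemma measurable_box (A : 'I_n -> set (measurableTypeR R)) : (forall i, measurable (A i)) ->
  measurable [set x : V | forall i, A i (x ord0 i)].
Proof.
move=> mA.
rewrite (_ : mkset _ = \big[setI/setT]_(i < n) ((fun x : V => x ord0 i) @^-1` A i)).
  apply: bigsetI_measurable => i _; rewrite -[X in measurable X]setTI.
  exact: measurable_coord_rV.
rewrite -bigcap_seq; apply/seteqP; split => x /= Ax i; first by move=> _; exact: Ax.
by apply: Ax => /=; rewrite mem_index_enum.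
Qed.

Lemma lebesgue_rV_setT_neq0 : mu setT != 0.
Proof.
apply/eqP => h.
have : mu [set x | forall i, `[0%R, 1%R]%classic (x ord0 i)] <= mu setT.
  by apply: le_measure => //; rewrite inE//; apply: (@measurable_box (fun=> `[0%R, 1%R]%classic)).
by rewrite lebesgue_rV_unit_box h leNgt lte_fin ltr01.
Qed.

Lemma lebE_setT_neq0 : lebE setT != 0.
Proof.
by rewrite lebEE -setXTT product_measure1E// mule_eq0 negb_or lebesgue_rV_setT_neq0.
Qed.

Definition pair_mul (M : 'M[R]_(n + n)) (w : V * V) : V * V :=
  (lsubmx (row_mx w.1 w.2 *m M), rsubmx (row_mx w.1 w.2 *m M)).

Lemma pair_mul_comp M N w : pair_mul N (pair_mul M w) = pair_mul (M *m N)%R w.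
Proof. by rewrite /pair_mul/= hsubmxK mulmxA. Qed.

Lemma pair_mul_add M w w' : pair_mul M (w.1 + w'.1, w.2 + w'.2)%R =
  ((pair_mul M w).1 + (pair_mul M w').1, (pair_mul M w).2 + (pair_mul M w').2)%R.
Proof. by rewrite /pair_mul/= -add_row_mx mulmxDl !raddfD. Qed.

Lemma measurable_row_mx : measurable_fun setT (fun w : V * V => row_mx w.1 w.2).
Proof.
apply/measurable_fun_rVP => i; under eq_fun do rewrite mxE.
case: (fintype.split i) => j.
  exact: (measurableT_comp (measurable_coord_rV j) measurable_fst).
exact: (measurableT_comp (measurable_coord_rV j) measurable_snd).
Qed.

Lemma measurable_pair_mul M : measurable_fun setT (pair_mul M).
Proof.
apply: measurable_fun_pair; apply/measurable_fun_rVP => i /=.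
  under eq_fun do rewrite mxE.
  apply: (measurableT_comp (measurable_coord_rV _)).
  apply: measurable_rV_mulmx; exact: measurable_row_mx.
under eq_fun do rewrite mxE.
apply: (measurableT_comp (measurable_coord_rV _)).
apply: measurable_rV_mulmx; exact: measurable_row_mx.
Qed.

Lemma scales_pair_mul M : M \in unitmx ->
  exists c : R, [/\ (0 < c)%R, scales lebE (pair_mul M) c & scales lebE (pair_mul (invmx M)) c^-1].
Proof.
move=> uM.
pose add (x y : V * V) := (x.1 + y.1, x.2 + y.2)%R.
pose opp (x : V * V) := (- x.1, - x.2)%R.
apply: (@linear_scales _ _ _ add opp) => //.
- apply: measurable_fun_pair => /=; apply: measurable_rV_add.
  + exact: (measurableT_comp measurable_fst measurable_fst).
  + exact: (measurableT_comp measurable_fst measurable_snd).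
  + exact: (measurableT_comp measurable_snd measurable_fst).
  + exact: (measurableT_comp measurable_snd measurable_snd).
- by have [] := scales_lebE_opp.
- by move=> [x y]; rewrite /opp/= !opprK.
- by move=> x y; congr pair; rewrite addrC.
- by move=> x y; congr pair; rewrite /= opprD addrCA subrr addr0.
- by move=> c A mA; have [_ ->] := scales_lebE_shift c; rewrite ?mul1e.
- exact: lebE_setT_neq0.
- exact: measurable_pair_mul.
- exact: measurable_pair_mul.
- by move=> w; rewrite pair_mul_comp mulmxV// /pair_mul mulmx1 row_mxKl row_mxKr -surjective_pairing.
- by move=> w; rewrite pair_mul_comp mulVmx// /pair_mul mulmx1 row_mxKl row_mxKr -surjective_pairing.
- by move=> x y; rewrite /add pair_mul_add.
Qed.

(** Every line in direction [e] meets the zero set in exactly one point. By Tonelli the measure of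
    the zero set, integrated over all translations [t *: e], is 0, and the line has infinite
    length. *)
Lemma lebE_hyperplane (l : V * V -> measurableTypeR R) (e : V * V) :
  measurable_fun setT l -> l e != 0%R ->
  (forall w (t : R), l (w.1 + t *: e.1, w.2 + t *: e.2)%R = (l w + t * l e)%R) ->
  lebE (l @^-1` [set 0%R]) = 0.
Proof.
move=> ml le0 lD; set H := _ @^-1` _.
have mH : measurable H by rewrite /H -[X in measurable X]setTI; exact: ml.
pose F (p : (V * V) * measurableTypeR R) : \bar R :=
  (\1_H ((p.1.1 + p.2 *: e.1, p.1.2 + p.2 *: e.2)%R))%:E.
have mF : measurable_fun setT F.
  apply/measurable_EFinP; apply: (measurableT_comp (measurable_indic mH)).
  apply: measurable_fun_pair => /=; apply: measurable_rV_add.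
  + exact: (measurableT_comp measurable_fst measurable_fst).
  + by apply: measurable_rV_scale => //; exact: measurable_snd.
  + exact: (measurableT_comp measurable_snd measurable_fst).
  + by apply: measurable_rV_scale => //; exact: measurable_snd.
have := @fubini_tonelli _ _ _ _ R lebE lebesgue_measure F mF (fun _ => ler0n _ _).
rewrite integral0_eq; last first.
  move=> w _; rewrite /F/=.
  rewrite (_ : (fun y => _) = EFin \o \1_[set (- (l w / l e))%R]).
    by rewrite integral_indic// setIT; exact: lebesgue_measure_set1.
  apply/funext => t /=; rewrite !indicE; congr ((nat_of_bool _)%:R)%:E.
  apply/idP/idP; rewrite !inE /H/= lD => h.
    by apply/eqP; rewrite -(inj_eq (mulIf le0)) mulNr divfK//; apply/eqP; lra.
  by rewrite h mulNr divfK// subrr.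
have H1 (t : R) : \int[lebE]_w F (w, t) = lebE H.
  transitivity (\int[lebE]_w (\1_H w)%:E); last by rewrite integral_indic// setIT.
  have [ms Hs] := scales_lebE_shift (t *: e.1, t *: e.2)%R.
  rewrite -[RHS]mul1e.
  by rewrite -(@scaled_measure_integral _ _ _ lebE _ 1 ms ler01 Hs)//; apply/measurable_EFinP.
under eq_integral do rewrite H1.
rewrite integral_cst// => /esym/eqP; rewrite mule_eq0 => /orP[/eqP//|].
have := lebesgue_measure_itv (`]-oo, +oo[ : interval R).
by rewrite set_itvNyy => h1 /eqP h2; have := etrans (esym h2) h1.
Qed.

(** A nonzero [v] with [M *m v^T = 0] puts the range into the hyperplane orthogonal to [v]; the
    direction transversal to it is [v] itself. *)
Lemma lebE_singular M : M \notin unitmx ->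
  exists N, [/\ measurable N, lebE N = 0 & forall w, N (pair_mul M w)].
Proof.
rewrite unitmxE unitfE negbK -det_tr => /det0P[v v0 vM].
pose l (w : V * V) : measurableTypeR R := (row_mx w.1 w.2 *m v^T)%R ord0 ord0.
have ml : measurable_fun setT l.
  apply: (measurableT_comp (measurable_coord_rV _)).
  apply: measurable_rV_mulmx; exact: measurable_row_mx.
exists (l @^-1` [set 0%R]); split.
- by rewrite -[X in measurable X]setTI; exact: ml.
- have [i vi] : exists i, v ord0 i != 0%R.
    apply: contrapT => /forallNP h; move/eqP: v0; apply; apply/rowP => i.
    by rewrite mxE; apply/eqP/negPn/negP/h.
  apply: (@lebE_hyperplane l (lsubmx v, rsubmx v)) => //.
    rewrite /l/= hsubmxK mxE psumr_eq0; last by move=> j _; rewrite mxE -expr2 sqr_ge0.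
    apply/negP => /allP/(_ i); rewrite mem_index_enum => /(_ isT)/=.
    by rewrite mxE -expr2 sqrf_eq0 (negbTE vi).
  move=> w t; rewrite /l/= hsubmxK.
  rewrite (_ : row_mx _ _ = (row_mx w.1 w.2 + t *: v)%R); last first.
    by rewrite -[in RHS](hsubmxK v) scale_row_mx add_row_mx.
  by rewrite mulmxDl -scalemxAl !mxE.
- move=> w; rewrite /= /l/= /pair_mul/= hsubmxK -mulmxA.
  by rewrite (_ : (M *m v^T)%R = 0%R) ?mulmx0 ?mxE// -[M]trmxK -trmx_mul vM trmx0.
Qed.

End lebesgue_pair.

(** * Invariance of integrals along complex flows *)

Section flow.
Context d (T : measurableType d) (R : realType) (mu : {measure set T -> \bar R}).
Variables (Th : R) (P : R -> T -> R) (Q p : R -> R -> T -> R) (G : T -> R).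
Hypothesis Th0 : 0 <= Th.
Let I (th : R) := 0 <= th <= Th.
Let J (s : R) := -1 < s < 1.
Hypothesis dP : forall th w, I th ->
  is_derive th (1 : R) (fun t => P t w) (- p th 0 w).
Hypothesis dQ : forall th s w, I th -> J s ->
  is_derive s (1 : R) (fun t => Q th t w) (p th s w).
Hypothesis pG : forall th s w, I th -> J s -> `|p th s w| <= G w.
Hypothesis mp : forall th, I th -> measurable_fun setT (p th 0).
Hypothesis iG : mu.-integrable setT (EFin \o G).
Hypothesis iP : forall th, I th -> mu.-integrable setT (EFin \o P th).
Hypothesis iQ : forall th s, I th -> J s -> mu.-integrable setT (EFin \o Q th s).
Hypothesis Qinv : forall th s, I th -> J s ->
  \int[mu]_w Q th s w = \int[mu]_w Q th 0 w.

Let J0 : J 0. Proof. by rewrite /J; lra. Qed.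
Let JI s : `]-1, 1[%classic s -> J s. Proof. by rewrite /= in_itv. Qed.
Let I0 : I 0. Proof. by rewrite /I lexx. Qed.

Let G0 w : 0 <= G w.
Proof. exact: le_trans (normr_ge0 _) (pG w I0 J0). Qed.

(** The integral of [Q th s] is constant in [s]; differentiating under the integral sign at [s = 0]
    gives the integral of [p th 0]. *)
Let intp0 th : I th -> \int[mu]_w p th 0 w = 0.
Proof.
move=> Ith.
have D (x : R) (y : T) : `]-1, 1[%classic x -> setT y -> derivable (Q th ^~ y) x 1.
  by move=> /JI Jx _; have [] := dQ y Ith Jx.
have E (x : R) (y : T) : `]-1, 1[%classic x -> derive1 (Q th ^~ y) x = p th x y.
  by move=> /JI Jx; rewrite derive1E; have [_ ->] := dQ y Ith Jx.
have I1 : `]-1, 1[%classic (0 : R) by rewrite /= in_itv.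
have := @differentiation_under_integral R _ T mu (Q th) setT measurableT 0 (-1) 1 I1
  (fun x Ix => iQ Ith (JI Ix)) D G G0 iG.
move=> /(_ _)/wrap[].
  by move=> x y Ix _; rewrite /partial1of2 E//; exact: pG (JI Ix).
rewrite derive1E => H.
rewrite (_ : \int[mu]_w _ = \int[mu]_(y in setT) partial1of2 (Q th) 0 y); last first.
  by apply: eq_Rintegral => y _; rewrite /partial1of2 E.
rewrite -H (@near_eq_derive _ _ _ _ (cst (\int[mu]_w Q th 0 w))) ?derive_cst//.
have : \forall x \near (0 : R), `]-1, 1[%classic x.
  by apply: near_in_itvoo; rewrite in_itv/=; lra.
by apply: filterS => x /JI Jx; exact: Qinv.
Qed.

(* The derivative of the integral of [P] in [theta] is, up to sign, the derivative in [s] of the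
   integral of [Q], which does not depend on [s]. *)
Lemma flow_integral : \int[mu]_w P Th w = \int[mu]_w P 0 w.
Proof.
(* This runs through [[0, Th]] while [t] runs through the whole line, so that one-sided derivatives
   at the ends of the interval are avoided. *)
pose th t := Th * (sin t) ^+ 2.
have Ith : forall t, I (th t).
  move=> t; rewrite /I mulr_ge0 ?sqr_ge0//= -[leRHS]mulr1 ler_wpM2l//.
have dth t : is_derive t (1 : R) th (Th * (2 * sin t * cos t)).
  by apply: is_derive_eq; rewrite /GRing.scale/=; ring.
have dC t y : is_derive t (1 : R) (fun t => P (th t) y)
     (- p (th t) 0 y * (Th * (2 * sin t * cos t))).
  by apply: (@is_derive1_comp _ (fun t => P t y) th); exact: dP.
have C t : is_derive t (1 : R) (fun t => \int[mu]_w P (th t) w) 0.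
  pose G' w := G w * (Th * 2).
  have iG' : mu.-integrable setT (EFin \o G').
    rewrite (_ : _ \o _ = (fun x => (G x)%:E * (Th * 2)%:E)%E); last exact/funext.
    exact: integrableZr.
  have G'0 w : 0 <= G' w by rewrite !mulr_ge0.
  have I1 : `]t - 1, t + 1[%classic t by rewrite /= in_itv/=; lra.
  have E (x : R) (y : T) : partial1of2 (fun t y => P (th t) y) x y =
     - p (th x) 0 y * (Th * (2 * sin x * cos x)).
    by rewrite /partial1of2 derive1E; have [_ ->] := dC x y.
  have B x y : `]t - 1, t + 1[%classic x -> setT y ->
      `|partial1of2 (fun t y => P (th t) y) x y| <= G' y.
    move=> _ _; rewrite E normrM normrN ler_pM// ?pG//.
    rewrite normrM ger0_norm// ler_wpM2l// 2!normrM ger0_norm// -mulrA ler_piMr//.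
    by rewrite mulr_ile1// ler_norml ?sin_le1 ?cos_le1 ?sin_geN1 ?cos_geN1.
  have D x y : `]t - 1, t + 1[%classic x -> setT y -> derivable (fun t => P (th t) y) x 1.
    by move=> _ _; have [] := dC x y.
  have i x : `]t - 1, t + 1[%classic x -> mu.-integrable setT (EFin \o P (th x)).
    by move=> _; exact: iP.
  split.
    exact: (@derivable_under_integral R _ T mu (fun t y => P (th t) y) setT measurableT _ _ _ I1 i D G').
  rewrite -derive1E (@differentiation_under_integral R _ T mu (fun t y => P (th t) y) setT measurableT _ _ _ I1 i D G' G'0 iG' B).
  under eq_Rintegral => y _ do rewrite -/(partial1of2 _ _ _) E mulNr -mulrN.
  rewrite RintegralZr//= ?intp0 ?mul0r//.
  apply: (le_integrable measurableT _ _ iG).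
    by apply/measurable_EFinP; exact: mp.
  move=> y _ /=; rewrite lee_fin (ger0_norm (G0 y)); exact: pG.
have := is_derive_0_is_cst (pi / 2) 0 C.
by rewrite /th sin_pihalf sin0 expr1n mulr1 expr0n mulr0.
Qed.

End flow.

(** * Gaussian integrals *)

Section measurable_combinators.
Context d (T : measurableType d) (R : realType).
Implicit Types f g : T -> R.

Lemma measurable_cst' (c : R) : measurable_fun setT (fun _ : T => c).
Proof. exact: measurable_cst. Qed.

Lemma measurable_exp f : measurable_fun setT f -> measurable_fun setT (fun x => expR (f x)).
Proof. exact: (measurableT_comp (@measurable_expR R)). Qed.

Lemma measurable_cosf f : measurable_fun setT f -> measurable_fun setT (fun x => cos (f x)).
Proof. by apply: measurableT_comp; exact: (continuous_measurable_fun (@continuous_cos R)). Qed.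

Lemma measurable_sinf f : measurable_fun setT f -> measurable_fun setT (fun x => sin (f x)).
Proof. by apply: measurableT_comp; exact: (continuous_measurable_fun (@continuous_sin R)). Qed.

Lemma measurable_oppf f : measurable_fun setT f -> measurable_fun setT (fun x => - f x).
Proof. exact: (measurableT_comp (@oppr_measurable R setT)). Qed.

Lemma measurable_normf f : measurable_fun setT f -> measurable_fun setT (fun x => `|f x|).
Proof. exact: (measurableT_comp (@normr_measurable R setT)). Qed.

Lemma measurable_addf f g : measurable_fun setT f -> measurable_fun setT g ->
  measurable_fun setT (fun x => f x + g x).
Proof. exact: measurable_funD. Qed.

Lemma measurable_mulf f g : measurable_fun setT f -> measurable_fun setT g ->
  measurable_fun setT (fun x => f x * g x).
Proof. exact: measurable_funM. Qed.

Lemma measurable_expf f n : measurable_fun setT f -> measurable_fun setT (fun x => f x ^+ n).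
Proof. exact: measurable_funX. Qed.

Lemma measurable_dotf n (f g : T -> 'rV[R]_n) : measurable_fun setT f -> measurable_fun setT g ->
  measurable_fun setT (fun x => dotrV (f x) (g x)).
Proof. exact: measurable_dotrV. Qed.

Lemma measurable_scalef n (h : T -> R) (f : T -> 'rV[R]_n) :
  measurable_fun setT h -> measurable_fun setT f ->
  measurable_fun setT (fun x => h x *: f x).
Proof. exact: measurable_rV_scale. Qed.

Lemma measurable_fstf d1 d2 (T1 : measurableType d1) (T2 : measurableType d2) (f : T -> T1 * T2) :
  measurable_fun setT f -> measurable_fun setT (fun x => (f x).1).
Proof. exact: (measurableT_comp measurable_fst). Qed.

Lemma measurable_sndf d1 d2 (T1 : measurableType d1) (T2 : measurableType d2) (f : T -> T1 * T2) :
  measurable_fun setT f -> measurable_fun setT (fun x => (f x).2).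
Proof. exact: (measurableT_comp measurable_snd). Qed.

Lemma measurable_EFinf f : measurable_fun setT f -> measurable_fun setT (fun x => (f x)%:E).
Proof. by move=> mf; apply/measurable_EFinP. Qed.

End measurable_combinators.

(* Dispatches on the head operation first: trying the combinators in turn is slow, as a wrong
   one fails only after unfolding. *)
Ltac measurability_step := match goal with
  | |- measurable_fun _ (fun _ => ?c) => first [apply: measurable_cst' | apply: measurable_cst]
  | |- measurable_fun _ (fun x => dotrV (@?f x) (@?g x)) => apply: measurable_dotf
  | |- measurable_fun _ (fun x => expR (@?f x)) => apply: measurable_exp
  | |- measurable_fun _ (fun x => cos (@?f x)) => apply: measurable_cosf
  | |- measurable_fun _ (fun x => sin (@?f x)) => apply: measurable_sinf
  | |- measurable_fun _ (fun x => ((@?f x)%:E)%E) => apply: measurable_EFinf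
  | |- measurable_fun _ (fun x => ((@?f x) ^+ ?n)%R) => apply: measurable_expf
  | |- measurable_fun _ (fun x => ((@?f x) * (@?g x))%R) => apply: measurable_mulf
  | |- measurable_fun _ (fun x => ((@?f x) *: (@?g x))%R) => apply: measurable_scalef
  | |- measurable_fun _ (fun x => ((@?f x) + (@?g x))%R) =>
      first [apply: measurable_addf | apply: measurable_rV_add]
  | |- measurable_fun _ (fun x => (- (@?f x))%R) =>
      first [apply: measurable_oppf | apply: measurable_rV_opp]
  end.

Ltac measurability := repeat first
  [ measurability_step
  | assumption | exact: measurable_id | apply: measurable_cst' | apply: measurable_cst
  | exact: measurable_fst | exact: measurable_snd
  | apply: measurable_EFinf
  | apply: measurable_rV_add | apply: measurable_rV_opp | apply: measurable_scalef
  | apply: measurable_oppf | apply: measurable_addf | apply: measurable_mulf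
  | apply: measurable_expf | apply: measurable_exp | apply: measurable_cosf
  | apply: measurable_sinf | apply: measurable_normf | apply: measurable_dotf
  | apply: measurable_fstf | apply: measurable_sndf ].

(** * Inner product *)

Section dot.
Variables (R : realType) (n : nat).
Implicit Types x y z : 'rV[R]_n.

Lemma dotC x y : dotrV x y = dotrV y x.
Proof. by apply: eq_bigr => i _; rewrite mulrC. Qed.

Lemma dotDl x y z : dotrV (x + y) z = dotrV x z + dotrV y z.
Proof. by rewrite -big_split; apply: eq_bigr => i _; rewrite mxE mulrDl. Qed.

Lemma dotDr x y z : dotrV x (y + z) = dotrV x y + dotrV x z.
Proof. by rewrite dotC dotDl !(dotC x). Qed.

Lemma dotZl (a : R) x y : dotrV (a *: x) y = a * dotrV x y.
Proof. by rewrite mulr_sumr; apply: eq_bigr => i _; rewrite mxE mulrA. Qed.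

Lemma dotZr (a : R) x y : dotrV x (a *: y) = a * dotrV x y.
Proof. by rewrite dotC dotZl dotC. Qed.

Lemma dotNl x y : dotrV (- x) y = - dotrV x y.
Proof. by rewrite -scaleN1r dotZl mulN1r. Qed.

Lemma dotNr x y : dotrV x (- y) = - dotrV x y.
Proof. by rewrite dotC dotNl dotC. Qed.

Lemma dot0l x : dotrV 0 x = 0.
Proof. by rewrite -(scale0r 0) dotZl mul0r. Qed.

Lemma dot0r x : dotrV x 0 = 0.
Proof. by rewrite dotC dot0l. Qed.

Lemma dotBl x y z : dotrV (x - y) z = dotrV x z - dotrV y z.
Proof. by rewrite dotDl dotNl. Qed.

Lemma dotBr x y z : dotrV x (y - z) = dotrV x y - dotrV x z.
Proof. by rewrite dotDr dotNr. Qed.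

Lemma dot_ge0 x : 0 <= dotrV x x.
Proof. by apply: sumr_ge0 => i _; rewrite -expr2 sqr_ge0. Qed.

Lemma dot_eq0 x : dotrV x x = 0 -> x = 0.
Proof.
move=> /eqP; rewrite psumr_eq0 => [/allP h|i _]; last by rewrite -expr2 sqr_ge0.
apply/rowP => i; rewrite mxE; apply/eqP.
by have := h i; rewrite mem_index_enum -expr2 sqrf_eq0 => /(_ isT).
Qed.

Lemma dot_AMGM x y : 2 * `|dotrV x y| <= dotrV x x + dotrV y y.
Proof.
have := dot_ge0 (x - y); have := dot_ge0 (x + y).
rewrite !(dotDl, dotDr, dotNl, dotNr) (dotC y x) => h1 h2.
by case: ger0P => h; lra.
Qed.

Lemma dot_sqD x y : dotrV (x + y) (x + y) <= 2 * (dotrV x x + dotrV y y).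
Proof.
have := dot_ge0 (x - y).
rewrite !(dotDl, dotDr, dotNl, dotNr) (dotC y x) => h.
by lra.
Qed.

End dot.

Section gauss_rV.
Variable R : realType.

Lemma lebesgue_rVS_integral n (f : 'rV[R]_n.+1 -> \bar R) :
  measurable_fun setT f -> (forall x, 0 <= f x)%E ->
  (\int[lebesgue_rV R n.+1]_x f x =
   \int[lebesgue_measure]_t \int[lebesgue_rV R n]_v f (rV_cons (t, v)))%E.
Proof.
move=> mf f0.
have mc := @measurable_rV_cons R n.
transitivity (\int[pushforward (lebesgue_measure \x lebesgue_rV R n) (@rV_cons R n)]_x f x)%E.
  by apply: eq_measure_integral.
rewrite ge0_integral_pushforward// preimage_setT.
rewrite (fubini_tonelli1 (f \o @rV_cons R n))//.
  exact: measurableT_comp.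
by move=> x; exact: f0.
Qed.

Lemma dot_rV_cons n t t' (v v' : 'rV[R]_n) :
  dotrV (rV_cons (t, v)) (rV_cons (t', v')) = t * t' + dotrV v v'.
Proof.
rewrite /dotrV big_ord_recl !mxE !unlift_none/=; congr (_ + _).
by apply: eq_bigr => i _; rewrite !mxE !liftK.
Qed.

Lemma gauss1 (a : R) : 0 < a ->
  (\int[lebesgue_measure]_t (expR (- (a * t ^+ 2)))%:E = (Num.sqrt (pi / a))%:E)%E.
Proof.
move=> a0.
have s0 : 0 < Num.sqrt a by rewrite sqrtr_gt0.
have [m H] := scales_lebesgue_scale s0.
have c0 : 0 <= (Num.sqrt a)^-1 by rewrite invr_ge0 ltW.
have := @scaled_measure_integral _ _ _ _ _ _ m c0 H (fun t => (gauss_fun t)%:E).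
rewrite integralT_gauss => /(_ _ _)/wrap[| |E].
- by apply/measurable_EFinP; exact: measurable_gauss_fun.
- by move=> t; rewrite lee_fin gauss_fun_ge0.
rewrite (_ : Num.sqrt (pi / a) = (Num.sqrt a)^-1 * Num.sqrt pi); last first.
  by rewrite sqrtrM ?pi_ge0// sqrtrV ?ltW// mulrC.
rewrite EFinM -E; apply: eq_integral => t _; congr EFin.
by rewrite /gauss_fun exprMn sqr_sqrtr// ltW.
Qed.

Lemma gauss_rV n (a : R) : 0 < a ->
  (\int[lebesgue_rV R n]_x (expR (- (a * dotrV x x)))%:E = (Num.sqrt (pi / a) ^+ n)%:E)%E.
Proof.
move=> a0; elim: n => [|n IH].
  rewrite integral_dirac//=; last by measurability.
  by rewrite diracE in_setT mul1e dot0l mulr0 oppr0 expR0 expr0.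
rewrite lebesgue_rVS_integral//; last by measurability.
under eq_integral => t _.
  under eq_integral => v _ do rewrite dot_rV_cons mulrDr opprD expRD EFinM.
  rewrite ge0_integralZl//; last by measurability.
  rewrite IH; over.
rewrite ge0_integralZr//; last by measurability.
by rewrite gauss1// -EFinM exprS.
Qed.

Lemma gauss_rV_integrable n (a : R) : 0 < a ->
  (lebesgue_rV R n).-integrable setT (EFin \o (fun x => expR (- (a * dotrV x x)))).
Proof.
move=> a0; apply/integrableP; split; first by rewrite /comp; measurability.
under eq_integral do rewrite /= ger0_norm ?expR_ge0//.
by rewrite gauss_rV// ltry.
Qed.

Lemma gauss_Rint n (a : R) : 0 < a ->
  \int[lebesgue_rV R n]_x expR (- (a * dotrV x x)) = Num.sqrt (pi / a) ^+ n.
Proof. by move=> a0; rewrite /Rintegral gauss_rV. Qed.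

End gauss_rV.

Lemma integrable_bound d (T : measurableType d) (R : realType)
    (mu : {measure set T -> \bar R}) (f g : T -> R) :
  measurable_fun setT f -> (forall x, `|f x| <= g x) ->
  mu.-integrable setT (EFin \o g) -> mu.-integrable setT (EFin \o f).
Proof.
move=> mf fg; apply: le_integrable => //; first exact/measurable_EFinP.
by move=> x _; rewrite /= lee_fin (le_trans (fg x))// ler_norm.
Qed.

Lemma integrable_mulc d (T : measurableType d) (R : realType)
    (mu : {measure set T -> \bar R}) (f : T -> R) (c : R) :
  mu.-integrable setT (EFin \o f) -> mu.-integrable setT (EFin \o (fun x => c * f x)).
Proof.
move=> fi; rewrite (_ : _ \o _ = (fun x => c%:E * (f x)%:E)%E); last exact/funext.
exact: integrableZl.
Qed.

Section gauss_fourier.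
Variables (R : realType) (n : nat) (a : R) (w : 'rV[R]_n).
Hypothesis a0 : 0 < a.
Notation mu := (lebesgue_rV R n).
Notation sq x := (dotrV x x).
Notation c := (dotrV w w).
Let k (y : 'rV[R]_n) : R := 2 * a * dotrV y w.
Let c0 : 0 <= c. Proof. exact: dot_ge0. Qed.
(** [P] (at [s = 0]) and [- Q] are the real and imaginary parts of [e^(- a <z, z>)] at
    [z = x + (s - i th) w]. *)
Let P (th : R) (x : 'rV[R]_n) := expR (- (a * sq x) + a * th ^+ 2 * c) * cos (th * k x).
Let Q (th s : R) (x : 'rV[R]_n) :=
  - (expR (- (a * sq (x + s *: w)) + a * th ^+ 2 * c) * sin (th * k (x + s *: w))).
Let p (th s : R) (x : 'rV[R]_n) :=
  expR (- (a * sq (x + s *: w)) + a * th ^+ 2 * c) *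
   (k (x + s *: w) * sin (th * k (x + s *: w)) - 2 * a * th * c * cos (th * k (x + s *: w))).

Let dP th x : is_derive th (1 : R) (fun t => P t x) (- p th 0 x).
Proof.
by apply: is_derive_eq; rewrite /p scale0r addr0 /GRing.scale/=; ring.
Qed.

Let dQ th s x : is_derive s (1 : R) (fun t => Q th t x) (p th s x).
Proof.
have h1 t : sq (x + t *: w) = sq x + 2 * t * dotrV x w + t ^+ 2 * c.
  by rewrite !(dotDl, dotDr, dotZl, dotZr) (dotC w x); ring.
have h2 t : k (x + t *: w) = k x + t * (2 * a * c).
  by rewrite /k dotDl dotZl; ring.
rewrite (_ : (fun t => Q th t x) = (fun t => - (expR (- (a * (sq x + 2 * t * dotrV x w + t ^+ 2 * c)) + a * th ^+ 2 * c)
    * sin (th * (k x + t * (2 * a * c)))))); last first.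
  by apply/funext => t; rewrite /Q h1 h2.
apply: is_derive_eq; rewrite /p h1 h2 /GRing.scale/= /k.
by ring.
Qed.


Let C := expR (a * c) * (2 + 3 * (a * c)).

Let pC th y : 0 <= th <= 1 ->
  `|expR (- (a * sq y) + a * th ^+ 2 * c) *
     (k y * sin (th * k y) - 2 * a * th * c * cos (th * k y))|
  <= C * expR (- (a * sq y / 2)).
Proof.
move=> /andP[th0 th1].
have ac0 : 0 <= a * c by rewrite mulr_ge0// ltW.
have sy0 : 0 <= a * sq y by rewrite mulr_ge0 ?dot_ge0// ltW.
have th2 : th ^+ 2 <= 1 by rewrite expr_le1.
rewrite normrM ger0_norm ?expR_ge0//.
apply: (@le_trans _ _ (expR (- (a * sq y) + a * c) * (a * sq y + 3 * (a * c)))).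
  apply: ler_pM => //.
    by rewrite ler_expR lerD2l -mulrA ler_wpM2l ?(ltW a0)// ler_piMl.
  apply: (le_trans (ler_normB _ _)).
  have h1 : `|k y * sin (th * k y)| <= a * sq y + a * c.
    rewrite normrM (@le_trans _ _ `|k y|)//.
      by rewrite ler_piMr// ler_norml sin_le1 sin_geN1.
    have := ler_wpM2l (ltW a0) (dot_AMGM y w).
    by rewrite /k normrM gtr0_norm ?mulr_gt0//; lra.
  have h2 : `|2 * a * th * c * cos (th * k y)| <= 2 * (a * c).
    rewrite normrM (@le_trans _ _ `|2 * a * th * c|)//.
      by rewrite ler_piMr// ler_norml cos_le1 cos_geN1.
    rewrite ger0_norm; last by rewrite !mulr_ge0// ltW.
    rewrite (_ : 2 * a * th * c = th * (2 * (a * c))); last by ring.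
    by rewrite ler_piMl// mulr_ge0.
  by lra.
have -> : C * expR (- (a * sq y / 2)) =
    expR (- (a * sq y) + a * c) * ((2 + 3 * (a * c)) * expR (a * sq y / 2)).
  rewrite /C [LHS]mulrAC -expRD [RHS]mulrCA -expRD mulrC; congr (_ * expR _); lra.
rewrite ler_wpM2l ?expR_ge0//.
have e1 := expR_ge1Dx (a * sq y / 2).
have e2 : 1 <= expR (a * sq y / 2) by apply: le_trans e1; rewrite lerDl divr_ge0.
by have := ler_wpM2l ac0 e2; lra.
Qed.

(** Half of the Gaussian decay absorbs the polynomial factor of [p]; the other half is moved from
    [x + s w] to [x] by [|x|^2 <= 2 (|x + s w|^2 + |w|^2)], whence [a / 4] and [a c / 2]. *)
Let G (x : 'rV[R]_n) := C * expR (a * c / 2) * expR (- (a / 4 * sq x)).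

Let pG th s x : 0 <= th <= 1 -> -1 < s < 1 -> `|p th s x| <= G x.
Proof.
move=> Ith /andP[s1 s2]; apply: (le_trans (pC _ Ith)).
have ac0 : 0 <= a * c by rewrite mulr_ge0// ltW.
have ss2 : s ^+ 2 <= 1 by rewrite -real_normK ?num_real// expr_le1// ler_norml; lra.
rewrite /G -(mulrA C) ler_wpM2l//.
  by rewrite /C mulr_ge0 ?expR_ge0// addr_ge0// mulr_ge0.
rewrite -expRD ler_expR; move: (x + s *: w) (addrK (s *: w) x) => y yE.
have : sq x <= 2 * (sq y + c).
  rewrite -yE -scaleNr; apply: (le_trans (dot_sqD _ _)).
  rewrite ler_wpM2l// lerD2l dotZl dotZr mulrA mulrNN -expr2.
  by rewrite ler_piMl.
move=> h; have := ler_wpM2l (ltW a0) h.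
by lra.
Qed.

Let iG : mu.-integrable setT (EFin \o G).
Proof. by apply: integrable_mulc; apply: gauss_rV_integrable; rewrite divr_gt0. Qed.

Let integrable_osc (th : R) (g : R -> R) : measurable_fun setT g -> (forall t, `|g t| <= 1) ->
  mu.-integrable setT (EFin \o (fun x => expR (- (a * sq x) + a * th ^+ 2 * c) * g (th * k x))).
Proof.
move=> mg g1.
apply: (@integrable_bound _ _ _ _ _ (fun x => expR (a * th ^+ 2 * c) * expR (- (a * sq x)))).
- apply: measurable_mulf; first by measurability.
  by apply: (measurableT_comp mg); rewrite /k; measurability.
- move=> x; rewrite normrM ger0_norm ?expR_ge0// -expRD [X in _ <= expR X]addrC.
  by rewrite ler_piMr ?expR_ge0.
- exact/integrable_mulc/gauss_rV_integrable.
Qed.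

Let iP th : 0 <= th <= 1 -> mu.-integrable setT (EFin \o P th).
Proof.
move=> _; apply: (@integrable_osc th cos); first by measurability.
by move=> t; rewrite ler_norml cos_le1 cos_geN1.
Qed.

Let Q0 th (x : 'rV[R]_n) := - (expR (- (a * sq x) + a * th ^+ 2 * c) * sin (th * k x)).

Let iQ0 th : mu.-integrable setT (EFin \o Q0 th).
Proof.
rewrite (_ : Q0 th = (fun x => -1 * (expR (- (a * sq x) + a * th ^+ 2 * c) * sin (th * k x)))).
  apply: integrable_mulc; apply: (@integrable_osc th sin); first by measurability.
  by move=> t; rewrite ler_norml sin_le1 sin_geN1.
by apply/funext => x; rewrite mulN1r.
Qed.

Let iQ th s : mu.-integrable setT (EFin \o Q th s).
Proof.
have [ms Hs] := @scales_rV_shift R n (s *: w).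
exact: (scaled_measure_integrable ms ler01 Hs (iQ0 th)).
Qed.

Let Qinv th s : \int[mu]_x Q th s x = \int[mu]_x Q th 0 x.
Proof.
have E r : \int[mu]_x Q th r x = \int[mu]_x Q0 th x.
  have [ms Hs] := @scales_rV_shift R n (r *: w).
  by have := scaled_measure_Rintegral ms ler01 Hs (iQ0 th); rewrite mul1r.
exact: etrans (E s) (esym (E 0)).
Qed.

(** Invariance under the real translations by [s w] is transferred to the imaginary ones by
    [flow_integral]; the angle 0 gives the plain Gaussian and the angle 1 the left side times
    [e^(a c)]. *)
Lemma gauss_cos_shift : \int[mu]_x (expR (- (a * sq x)) * cos (2 * a * dotrV x w)) =
  expR (- (a * c)) * Num.sqrt (pi / a) ^+ n.
Proof.
have mp th : 0 <= th <= 1 -> measurable_fun setT (p th 0).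
  by move=> _; rewrite /p /k; measurability.
have := @flow_integral _ _ _ mu 1 P Q p G ler01 (fun th x _ => dP th x)
  (fun th s x _ _ => dQ th s x) pG mp iG iP (fun th s _ _ => iQ th s) (fun th s _ _ => Qinv th s).
rewrite (_ : P 0 = (fun x => expR (- (a * sq x)))); last first.
  by apply/funext => x; rewrite /P mul0r cos0 mulr1 expr0n mulr0 mul0r addr0.
rewrite gauss_Rint// => <-.
rewrite -RintegralZl//; last by apply: iP; rewrite lexx ler01.
apply: eq_Rintegral => x _; rewrite /P mul1r expr1n mulr1 mulrA -expRD.
by congr (expR _ * _); lra.
Qed.

End gauss_fourier.

Section gauss_fourier_transform.
Variables (R : realType) (n : nat) (a : R) (v : 'rV[R]_n).
Hypothesis a0 : 0 < a.
Notation mu := (lebesgue_rV R n).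

Lemma gauss_cos : \int[mu]_x (expR (- (a * dotrV x x)) * cos (dotrV x v)) =
  expR (- (dotrV v v / (4 * a))) * Num.sqrt (pi / a) ^+ n.
Proof.
have := @gauss_cos_shift R n a ((2 * a)^-1 *: v) a0.
rewrite dotZl dotZr => H.
have an0 : a != 0 by rewrite gt_eqF.
transitivity (\int[mu]_x (expR (- (a * dotrV x x)) * cos (2 * a * dotrV x ((2 * a)^-1 *: v)))).
  by apply: eq_Rintegral => x _; rewrite dotZr mulrA mulfV ?mul1r// mulf_neq0.
by rewrite H; congr (expR _ * _); field.
Qed.

Lemma integrable_gauss_osc (g : R -> R) : measurable_fun setT g -> (forall t, `|g t| <= 1) ->
  mu.-integrable setT (EFin \o (fun x => expR (- (a * dotrV x x)) * g (dotrV x v))).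
Proof.
move=> mg g1.
apply: (@integrable_bound _ _ _ _ _ (fun x => expR (- (a * dotrV x x)))).
- apply: measurable_mulf; first by measurability.
  by apply: (measurableT_comp mg); measurability.
- by move=> x; rewrite normrM ger0_norm ?expR_ge0// ler_piMr ?expR_ge0.
- exact/gauss_rV_integrable.
Qed.

Lemma gauss_sin : \int[mu]_x (expR (- (a * dotrV x x)) * sin (dotrV x v)) = 0.
Proof.
have i : mu.-integrable setT (EFin \o (fun x => expR (- (a * dotrV x x)) * sin (dotrV x v))).
  apply: integrable_gauss_osc; first by measurability.
  by move=> t; rewrite ler_norml sin_le1 sin_geN1.
have [m H] := @scales_rV_opp R n.
have h := scaled_measure_Rintegral m ler01 H i.
have E : \int[mu]_x (expR (- (a * dotrV (- x) (- x))) * sin (dotrV (- x) v)) =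
    -1 * \int[mu]_x (expR (- (a * dotrV x x)) * sin (dotrV x v)).
  rewrite -RintegralZl//; apply: eq_Rintegral => x _.
  by rewrite !(dotNl, dotNr) opprK sinN mulN1r mulrN.
by have := etrans (esym E) h; lra.
Qed.

End gauss_fourier_transform.

(** * Monotone splittings of R^2n *)

Section continuous_rV.
Variable R : realType.

Lemma continuous_measurable_rV n (f : 'rV[R]_n -> R) :
  continuous f -> measurable_fun setT f.
Proof.
move=> cf; apply: (measurability _ (RGenOInfty.measurableE R)) => // _ [_ [x ->] <-].
rewrite setTI; apply: open_measurable_rV.
by move/continuousP : cf; apply; exact: interval_open.
Qed.

Lemma sq_le_norm n (x : 'rV[R]_n) : dotrV x x <= n%:R * `|x| ^+ 2.
Proof.
rewrite /dotrV (@le_trans _ _ (\sum_(i < n) `|x| ^+ 2))//.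
  apply: ler_sum => i _; rewrite -expr2 -(real_normK (num_real (x ord0 i))).
  rewrite lerXn2r ?nnegrE//.
  by rewrite [leRHS]/Num.norm /= mx_normrE; apply/bigmax_geP; right => /=; exists (ord0, i).
by rewrite sumr_const card_ord -[leLHS]mulr_natl.
Qed.

Lemma coord_le_sq n (x : 'rV[R]_n) i : (x ord0 i) ^+ 2 <= dotrV x x.
Proof.
rewrite /dotrV (bigD1 i)//= -expr2 lerDl sumr_ge0// => j _.
by rewrite -expr2 sqr_ge0.
Qed.

Lemma lipschitz_measurable_rV n (f : 'rV[R]_n -> R) (C : R) :
  (forall x y, (f x - f y) ^+ 2 <= C * dotrV (x - y) (x - y)) ->
  measurable_fun setT f.
Proof.
move=> H; apply: continuous_measurable_rV => x.
apply/(@cvgrPdist_lt _ _ _ _ (nbhs_filter x)) => e e0.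
pose K := `|C| * n%:R + 1.
have K0 : 0 < K by rewrite ltr_wpDl// mulr_ge0.
have s0 : 0 < e / K + 0 by rewrite addr0 divr_gt0.
have d0 : 0 < e / Num.sqrt K by rewrite divr_gt0// sqrtr_gt0.
near=> y.
have xy : `|x - y| < e / Num.sqrt K.
  by near: y; apply/nbhs_ballP; exists (e / Num.sqrt K) => //= y; rewrite -ball_normE.
have h : (f x - f y) ^+ 2 < e ^+ 2.
  apply: (le_lt_trans (H x y)).
  apply: (@le_lt_trans _ _ (`|C| * (n%:R * `|x - y| ^+ 2))).
    apply: (@le_trans _ _ (`|C| * dotrV (x - y) (x - y))).
      by rewrite ler_wpM2r ?dot_ge0// ler_norm.
    by rewrite ler_wpM2l// sq_le_norm.
  rewrite mulrA.
  have h2 : `|x - y| ^+ 2 < e ^+ 2 / K.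
    rewrite -(sqr_sqrtr (ltW K0)) -expr_div_n ltrXn2r ?nnegrE// ltW//.
  apply: (@le_lt_trans _ _ (K * `|x - y| ^+ 2)).
    by rewrite ler_wpM2r ?sqr_ge0// lerDl.
  by rewrite mulrC -ltr_pdivlMr.
rewrite -(ltr_pXn2r (n := 2)) ?nnegrE ?(ltW e0)//.
by rewrite real_normK ?num_real.
Unshelve. all: by end_near. Qed.

Lemma lipschitz_measurable_pair n (f : 'rV[R]_n * 'rV[R]_n -> R) (C : R) :
  (forall w w', (f w - f w') ^+ 2 <=
     C * (dotrV (w.1 - w'.1) (w.1 - w'.1) + dotrV (w.2 - w'.2) (w.2 - w'.2))) ->
  measurable_fun setT f.
Proof.
move=> H; pose g (z : 'rV[R]_(n + n)) := f (lsubmx z, rsubmx z).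
have mg : measurable_fun setT g.
  apply: (@lipschitz_measurable_rV _ g C) => x y.
  rewrite /g (le_trans (H _ _))//= le_eqVlt; apply/orP; left; apply/eqP; congr (_ * _).
  rewrite /dotrV big_split_ord/=; congr (_ + _); apply: eq_bigr => i _.
    by rewrite !mxE.
  by rewrite !mxE.
rewrite (_ : f = g \o (fun w => row_mx w.1 w.2)).
  apply: (measurableT_comp mg); exact: measurable_row_mx.
by apply/funext => w; rewrite /g/= row_mxKl row_mxKr -surjective_pairing.
Qed.

End continuous_rV.

Section cover_scales.
Context d (T : measurableType d) (R : realType) (mu : {measure set T -> \bar R}).
Local Open Scope ereal_scope.

(* A map preserving each set of a finite cover scales the measure as soon as it does so on
   every set of the cover; the sets may overlap. *)
Lemma cover_scales (I : finType) (A : I -> set T) (phi : T -> T) (c : R) :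
  measurable_fun setT phi -> (forall i, measurable (A i)) ->
  (forall w, exists i, A i w) -> (forall i w, A i (phi w) <-> A i w) ->
  (forall i B, measurable B -> B `<=` A i -> mu (phi @^-1` B) = c%:E * mu B) ->
  scales mu phi c.
Proof.
move=> mphi mA covA Aphi H; split => // B mB.
have mpre C : measurable C -> measurable (phi @^-1` C).
  by move=> mC; rewrite -[X in measurable X]setTI; exact: mphi.
suff : forall (s : seq I) C, measurable C -> (forall w, C w -> exists2 i, i \in s & A i w) ->
    mu (phi @^-1` C) = c%:E * mu C.
  move=> /(_ (index_enum I) B mB); apply => w _.
  by have [i Ai] := covA w; exists i => //; exact: mem_index_enum.
elim => [|i s IH] C mC Cs.
  have -> : C = set0 by apply/seteqP; split => w // /Cs[].
  by rewrite preimage_set0 measure0 mule0.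
have E (D : set T) : measurable D -> mu D = mu (D `&` A i) + mu (D `\` A i).
  by move=> mD; rewrite addeC; exact: measureDI.
have EI : phi @^-1` C `&` A i = phi @^-1` (C `&` A i).
  by apply/seteqP; split => w /= [Cw /Aphi].
have ED : phi @^-1` C `\` A i = phi @^-1` (C `\` A i).
  by apply/seteqP; split => w /= [Cw nA]; split => // /Aphi.
have mCD : measurable (C `\` A i) by exact: measurableD.
have mCI : measurable (C `&` A i) by exact: measurableI.
rewrite (E (phi @^-1` C))//; last exact: mpre.
rewrite EI ED (H i)//.
rewrite IH//; last first.
  move=> w [/Cs[j]]; rewrite inE => /orP[/eqP->//|js Aj _]; by exists j.
by rewrite (E C)// ge0_muleDr.
Qed.

End cover_scales.

(* [U] is a strongly monotone cone in [V * V]; [(x1, e1)] and [(x2, e2)] are the two parts of the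
   splitting of [w] as [u + v*]. *)
Section split_flow.
Variables (R : realType) (n : nat).
Notation V := 'rV[R]_n.
Variables (U : V -> V -> Prop) (eps : R) (I : finType) (B : I -> 'M[R]_(n, n + n)).
Hypothesis eps0 : 0 < eps.
Hypothesis U0 : U 0 0.
Hypothesis Uscale : forall r x e, 0 < r -> U x e -> U (r *: x) (r *: e).
Hypothesis Umono : forall x e x' e', U x e -> U x' e' ->
  eps * (dotrV (x - x') (x - x') + dotrV (e - e') (e - e')) <= dotrV (x - x') (e - e').
Hypothesis Usurj : forall x e, exists x1 e1 x2 e2,
  [/\ U x1 e1, U x2 e2, x = x1 + x2 & e = e1 - e2].
Hypothesis Ucov : forall x e, U x e -> exists i, (row_mx x e <= B i)%MS.

Notation sq x := (dotrV x x).

Lemma split_exists (w : V * V) : exists z : (V * V) * (V * V),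
  [/\ U z.1.1 z.1.2, U z.2.1 z.2.2, w.1 = z.1.1 + z.2.1 & w.2 = z.1.2 - z.2.2].
Proof.
by have [x1 [e1 [x2 [e2 [? ? ? ?]]]]] := Usurj w.1 w.2; exists ((x1, e1), (x2, e2)).
Qed.

Definition split_pt w := projT1 (cid (split_exists w)).
Definition sx1 w := (split_pt w).1.1.
Definition se1 w := (split_pt w).1.2.
Definition sx2 w := (split_pt w).2.1.
Definition se2 w := (split_pt w).2.2.

Lemma split_ptP w : [/\ U (sx1 w) (se1 w), U (sx2 w) (se2 w),
  w.1 = sx1 w + sx2 w & w.2 = se1 w - se2 w].
Proof. exact: projT2 (cid (split_exists w)). Qed.

(** For the differences [a, b] and [c, d] of the two parts, [<a + c, b + d> + <a - c, b - d> = 2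
    (<a, b> + <c, d>)]. The right side is bounded below by monotonicity, and each product on the
    left contains one of the known differences [a + c] and [b - d], so Young's inequality concludes.
    Uniqueness and measurability of the splitting both follow. *)
Lemma split_lipschitz x1 e1 x2 e2 x1' e1' x2' e2' :
  U x1 e1 -> U x2 e2 -> U x1' e1' -> U x2' e2' ->
  eps ^+ 2 * (sq (x1 - x1') + sq (e1 - e1') + (sq (x2 - x2') + sq (e2 - e2'))) <=
  sq (x1 + x2 - (x1' + x2')) + sq (e1 - e2 - (e1' - e2')).
Proof.
move=> u1 u2 u1' u2'.
have := Umono u1 u1'; have := Umono u2 u2'.
have -> : x1 + x2 - (x1' + x2') = (x1 - x1') + (x2 - x2') by rewrite opprD addrACA.
have -> : e1 - e2 - (e1' - e2') = (e1 - e1') - (e2 - e2').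
  by rewrite !opprD !opprK addrACA.
move: (x1 - x1') (e1 - e1') (x2 - x2') (e2 - e2') => a b c d h2 h1.
have e2_0 : 0 <= eps ^+ 2 by rewrite sqr_ge0.
have k1 := dot_ge0 (2 *: (a + c) - eps *: (b + d)).
have k2 := dot_ge0 (2 *: (b - d) - eps *: (a - c)).
have k3 := dot_ge0 (b - d); have k4 := dot_ge0 (a + c).
have h3 := ler_wpM2l (ltW eps0) h1; have h4 := ler_wpM2l (ltW eps0) h2.
move: k1 k2 k3 k4 h3 h4.
rewrite !(dotDl, dotDr, dotNl, dotNr, dotZl, dotZr) (dotC d b) (dotC c a) (dotC b a) (dotC d a) (dotC b c) (dotC d c).
have := dot_ge0 (b - d); have := dot_ge0 (a + c); have := dot_ge0 (b + d); have := dot_ge0 (a - c).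
rewrite !(dotDl, dotDr, dotNl, dotNr) (dotC d b) (dotC c a).
move: (sq a) (sq b) (sq c) (sq d) (dotrV b d) (dotrV a c) (dotrV a b) (dotrV a d) (dotrV c b) (dotrV c d).
move=> aa bb cc dd bd ac ab ad cb cd p1 p2 p3 p4 k1 k2 k3 k4 h3 h4.
have p1' := mulr_ge0 e2_0 p1; have p2' := mulr_ge0 e2_0 p2.
have p3' := mulr_ge0 e2_0 p3; have p4' := mulr_ge0 e2_0 p4.
lra.
Qed.

Lemma split_ptE w x1 e1 x2 e2 : U x1 e1 -> U x2 e2 -> w.1 = x1 + x2 -> w.2 = e1 - e2 ->
  [/\ sx1 w = x1, se1 w = e1, sx2 w = x2 & se2 w = e2].
Proof.
move=> u1 u2 w1 w2; have [v1 v2 w1' w2'] := split_ptP w.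
have := split_lipschitz u1 u2 v1 v2.
rewrite -w1' -w2' -w1 -w2 !subrr !dot0l addr0 pmulr_rle0 ?exprn_gt0// => h.
have p1 := dot_ge0 (x1 - sx1 w); have p2 := dot_ge0 (e1 - se1 w).
have p3 := dot_ge0 (x2 - sx2 w); have p4 := dot_ge0 (e2 - se2 w).
have E (x y : V) : sq (x - y) = 0 -> y = x by move=> /dot_eq0/subr0_eq ->.
by split; apply: E; lra.
Qed.

Definition split_scale (r s : R) (w : V * V) : V * V :=
  (r *: sx1 w + s *: sx2 w, r *: se1 w - s *: se2 w).

Lemma split_pt_scale r s w : 0 < r -> 0 < s ->
  [/\ sx1 (split_scale r s w) = r *: sx1 w, se1 (split_scale r s w) = r *: se1 w,
     sx2 (split_scale r s w) = s *: sx2 w & se2 (split_scale r s w) = s *: se2 w].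
Proof.
move=> r0 s0; have [v1 v2 _ _] := split_ptP w.
by apply: split_ptE => //; exact: Uscale.
Qed.

Lemma split_scaleK r s : 0 < r -> 0 < s -> cancel (split_scale r s) (split_scale r^-1 s^-1).
Proof.
move=> r0 s0 w; have [a b c d] := split_pt_scale w r0 s0.
rewrite /(split_scale r^-1) a b c d !scalerA !mulVf ?gt_eqF// !scale1r.
by have [_ _ <- <-] := split_ptP w; rewrite -surjective_pairing.
Qed.

Definition split_mass w := sq (sx1 w) + sq (se1 w) + (sq (sx2 w) + sq (se2 w)).

Lemma split_mass_le w : eps ^+ 2 * split_mass w <= sq w.1 + sq w.2.
Proof.
have [v1 v2 w1 w2] := split_ptP w.
by have := split_lipschitz v1 v2 U0 U0; rewrite !subr0 addr0 subr0 -w1 -w2.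
Qed.

Lemma le_split_mass w : sq w.1 + sq w.2 <= 2 * split_mass w.
Proof.
have [v1 v2 w1 w2] := split_ptP w; rewrite {1 2}w1 {1 2}w2.
have := dot_sqD (sx1 w) (sx2 w); have := dot_sqD (se1 w) (- se2 w).
by rewrite !(dotNl, dotNr) opprK /split_mass; lra.
Qed.

Lemma measurable_split : [/\ measurable_fun setT sx1, measurable_fun setT se1,
  measurable_fun setT sx2 & measurable_fun setT se2].
Proof.
have K (f : V * V -> V) : (forall w w', eps ^+ 2 * sq (f w - f w') <=
    sq (w.1 - w'.1) + sq (w.2 - w'.2)) -> measurable_fun setT f.
  move=> H; apply/measurable_fun_rVP => i.
  apply: (@lipschitz_measurable_pair _ _ _ (eps ^+ 2)^-1) => w w'.
  rewrite ler_pdivlMl ?exprn_gt0//; apply: le_trans (H w w').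
  by rewrite ler_wpM2l ?sqr_ge0//; have := coord_le_sq (f w - f w') i; rewrite !mxE.
by split; apply: K => w w'; have [v1 v2 w1 w2] := split_ptP w;
  have [v1' v2' w1' w2'] := split_ptP w'; rewrite w1 w2 w1' w2';
  apply: le_trans (split_lipschitz v1 v2 v1' v2');
  rewrite ler_pM2l ?exprn_gt0//;
  have p1 := dot_ge0 (sx1 w - sx1 w'); have p2 := dot_ge0 (se1 w - se1 w');
  have p3 := dot_ge0 (sx2 w - sx2 w'); have p4 := dot_ge0 (se2 w - se2 w'); lra.
Qed.

Lemma measurable_split_scale r s : measurable_fun setT (split_scale r s).
Proof.
have [m1 m2 m3 m4] := measurable_split.
by apply: measurable_fun_pair; measurability.
Qed.

Let J : 'M[R]_(n + n) := block_mx 1%:M 0 0 (- 1%:M).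

Let split_mulmx (w : V * V) i j (D F : V) :
  row_mx (sx1 w) (se1 w) = D *m B i -> row_mx (sx2 w) (se2 w) = F *m B j ->
  forall r s, split_scale r s w = pair_mul (col_mx (B i) (B j *m J)) (r *: D, s *: F).
Proof.
move=> hD hF r s.
rewrite /pair_mul /= mul_row_col -!scalemxAl mulmxA -hD -hF /J mul_row_block.
rewrite !mulmx1 !mulmx0 mulmxN mulmx1 addr0 add0r !scale_row_mx add_row_mx.
by rewrite row_mxKl row_mxKr scalerN.
Qed.

(* On the set where [u] and [v] lie in given [n]-dimensional subspaces the map is linear; that of
   determinant [(r s)^n] is conjugate to a diagonal one. *)
Lemma scales_split_scale r s : 0 < r -> 0 < s ->
  scales (lebE R n) (split_scale r s) (r^-1 ^+ n * s^-1 ^+ n).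
Proof.
move=> r0 s0.
have [m1 m2 m3 m4] := measurable_split.
pose A (ij : I * I) : set (V * V) := [set w | (row_mx (sx1 w) (se1 w) <= B ij.1)%MS /\
  (row_mx (sx2 w) (se2 w) <= B ij.2)%MS].
have mV i (f g : V * V -> V) : measurable_fun setT f -> measurable_fun setT g ->
    measurable [set w | (row_mx (f w) (g w) <= B i)%MS].
  move=> mf mg.
  have m0 : measurable [set (0 : 'rV[R]_(n + n))].
    have -> : [set (0 : 'rV[R]_(n + n))] = [set x | forall i, [set (0 : R)] (x ord0 i)].
      apply/seteqP; split => x /= h; last by apply/rowP => k; rewrite h mxE.
      by move=> k; rewrite h mxE.
    by apply: (@measurable_box R (n + n) (fun=> [set 0])).
  have mh : measurable_fun setT (fun w => row_mx (f w) (g w) *m cokermx (B i)).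
    apply: measurable_rV_mulmx.
    rewrite (_ : (fun w => _) = (fun p : V * V => row_mx p.1 p.2) \o (fun w => (f w, g w)))//.
    apply: (measurableT_comp (@measurable_row_mx R n)).
    by apply: measurable_fun_pair.
  have := mh measurableT _ m0; rewrite setTI; congr measurable.
  by apply/seteqP; split => w /=; rewrite submxE => /eqP.
have mA ij : measurable (A ij) by apply: measurableI; exact: mV.
have AS r' s' ij w : 0 < r' -> 0 < s' -> A ij (split_scale r' s' w) <-> A ij w.
  move=> r'0 s'0; rewrite /A/=; have [-> -> -> ->] := split_pt_scale w r'0 s'0.
  rewrite -!scale_row_mx; split=> -[h1 h2].
    move: h1 h2; rewrite !(eqmx_scale _ (lt0r_neq0 _))//.
  by rewrite !(eqmx_scale _ (lt0r_neq0 _)).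
apply: (@cover_scales _ _ _ _ _ A).
- exact: measurable_split_scale.
- exact: mA.
- move=> w; have [v1 v2 _ _] := split_ptP w.
  by have [i hi] := Ucov v1; have [j hj] := Ucov v2; exists (i, j).
- by move=> ij w; exact: AS.
move=> [i j] C mC CA.
pose M := col_mx (B i) (B j *m J).
have mpre : measurable (split_scale r s @^-1` C).
  by rewrite -[X in measurable X]setTI; exact: measurable_split_scale.
(* If the two subspaces do not span R^2n, the whole piece [A (i, j)] lies in a hyperplane, and both
   sides vanish. *)
have [uM|sM] := boolP (M \in unitmx); last first.
  have [N [mN N0 NM]] := lebE_singular sM.
  have AN w : A (i, j) w -> N w.
    move=> [/submxP[D hD] /submxP[F hF]].
    have := split_mulmx hD hF 1 1; rewrite /split_scale !scale1r.
    have [_ _ <- <-] := split_ptP w; rewrite -surjective_pairing => ->.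
    exact: NM.
  have null X : measurable X -> X `<=` A (i, j) -> lebE R n X = 0%E.
    move=> mX XA; apply/eqP; rewrite -measure_le0 -N0 le_measure// ?inE// => w /XA.
    exact: AN.
  transitivity (0%E : \bar R).
    by apply: null => // w /CA Aw; apply/(AS r s).
  transitivity ((r^-1 ^+ n * s^-1 ^+ n)%:E * 0)%E; first by rewrite mule0.
  by congr (_ * _)%E; apply/esym/null.
have [c [c0 sM sM']] := scales_pair_mul uM.
pose L := pair_mul M \o (fun p : V * V => (r *: p.1, s *: p.2)) \o pair_mul (invmx M).
have sL : scales (lebE R n) L (r^-1 ^+ n * s^-1 ^+ n).
  have := scales_comp (scales_comp sM (scales_lebE_scale n r0 s0)) sM'.
  by rewrite mulrAC mulfV ?mul1r// gt_eqF.
rewrite -(sL.2 _ mC); congr (lebE R n _).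
have LE w : A (i, j) w -> L w = split_scale r s w.
  move=> [/submxP[D hD] /submxP[F hF]]; rewrite (split_mulmx hD hF).
  have wE : w = pair_mul M (D, F).
    have := split_mulmx hD hF 1 1; rewrite /split_scale !scale1r.
    by have [_ _ <- <-] := split_ptP w; rewrite -surjective_pairing.
  have invE : pair_mul (invmx M) w = (D, F).
    by rewrite wE pair_mul_comp mulmxV// /pair_mul mulmx1 row_mxKl row_mxKr.
  by rewrite /L /comp invE.
have Linj : injective L.
  have pmK : cancel (pair_mul M) (pair_mul (invmx M)).
    by move=> x; rewrite pair_mul_comp mulmxV// /pair_mul mulmx1 row_mxKl row_mxKr -surjective_pairing.
  have pmK' : cancel (pair_mul (invmx M)) (pair_mul M).
    by move=> x; rewrite pair_mul_comp mulVmx// /pair_mul mulmx1 row_mxKl row_mxKr -surjective_pairing.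
  apply: inj_comp; last exact: can_inj pmK'.
  apply: inj_comp; first exact: can_inj pmK.
  move=> [x1 x2] [y1 y2] [/(scalerI (lt0r_neq0 r0)) h1 /(scalerI (lt0r_neq0 s0)) h2].
  by rewrite h1 h2.
apply/seteqP; split => w /= Cw.
  by rewrite LE//; apply/(AS r s) => //; exact: CA.
(* Here only [L w] is known to lie in the piece, not [w]. Its preimage under [split_scale r s] does
   lie in the piece, has the same image under [L] as [w], and so equals [w]. *)
have rV0 : 0 < r^-1 by rewrite invr_gt0.
have sV0 : 0 < s^-1 by rewrite invr_gt0.
have Aw' : A (i, j) (split_scale r^-1 s^-1 (L w)) by apply/AS => //; exact: CA.
have E : split_scale r s (split_scale r^-1 s^-1 (L w)) = L w.
  by have := split_scaleK rV0 sV0 (L w); rewrite !invrK.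
have ww : split_scale r^-1 s^-1 (L w) = w by apply: Linj; rewrite LE.
by move: E; rewrite ww => ->.
Qed.

End split_flow.

(** * Layer cake formulas *)

Lemma measurable_ltR d (T : measurableType d) (R : realType) (f g : T -> R) :
  measurable_fun setT f -> measurable_fun setT g ->
  measurable_fun setT (fun x => (f x < g x)%R%:R : R).
Proof.
move=> mf mg; rewrite (_ : (fun x => _) = \1_[set x | f x < g x]).
  apply: measurable_indic; rewrite -[X in measurable X]setTI.
  have : measurable_fun setT (fun x => f x < g x) by exact: measurable_fun_ltr.
  by move=> /(_ measurableT [set true]); apply.
by apply/funext => p; rewrite indicE mem_setE.
Qed.

Section layer_cake.
Variable R : realType.
Notation leb := (@lebesgue_measure R).
Local Open Scope ereal_scope.

Lemma expR_tail (a : R) : \int[leb]_s ((a < s)%R%:R * expR (- s))%:E = (expR (- a))%:E.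
Proof.
transitivity (\int[leb]_(s in `[a, +oo[) (expR (- s))%:E).
  rewrite -integral_itv_obnd_cbnd; last by apply/measurable_EFinP/measurable_funTS; measurability.
  rewrite [RHS]integral_mkcond; apply: eq_integral => s _.
  rewrite patchE; case: ifPn => [|/negP]; rewrite inE/= in_itv/= andbT.
    by move=> ->; rewrite mul1r.
  by move=> /negP/negbTE ->; rewrite mul0r.
have d x : is_derive x (1%R : R) (fun t => - expR (- t))%R (expR (- x)).
  by apply: is_derive_eq; rewrite /GRing.scale/=; ring.
have c : continuous (fun t : R => - expR (- t))%R.
  by move=> x; apply: differentiable_continuous; apply/derivable1_diffP; have [] := d x.
have c' : continuous (fun t : R => expR (- t))%R.
  move=> x; apply: differentiable_continuous; apply/derivable1_diffP.
  by have [] : is_derive x (1%R : R) (fun t => expR (- t))%R (- expR (- x))%R by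
    apply: is_derive_eq; rewrite /GRing.scale/=; ring.
rewrite (@ge0_continuous_FTC2y _ _ (fun t => - expR (- t))%R a 0%R).
- by rewrite EFinN oppeK add0e.
- by move=> x _; exact: expR_ge0.
- exact: continuous_subspaceT.
- by rewrite -oppr0; apply: cvgN; exact: cvgr_expR.
- by move=> x _; have [] := d x.
- by apply: cvg_at_right_filter; exact: c.
- by move=> x _; rewrite derive1E; have [_ ->] := d x.
Qed.

(** Write [e^(- h)] as the integral of [e^(- s)] over [s > h] and exchange the integrals. *)
Lemma layer_cake_weighted d (T : measurableType d) (mu : {sigma_finite_measure set T -> \bar R})
    (phi h : T -> R) : measurable_fun setT phi -> (forall x, (0 <= phi x)%R) ->
  measurable_fun setT h ->
  \int[mu]_x (phi x * expR (- h x))%:E =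
  \int[leb]_s ((expR (- s))%:E * \int[mu]_(x in [set x | (h x < s)%R]) (phi x)%:E).
Proof.
move=> mphi phi0 mh.
pose F (p : T * measurableTypeR R) : \bar R :=
  (phi p.1 * ((h p.1 < p.2)%R%:R * expR (- p.2)))%:E.
have mF : measurable_fun setT F.
  apply/measurable_EFinP/measurable_mulf.
    exact: (measurableT_comp mphi measurable_fst).
  apply: measurable_mulf; last by measurability.
  apply: measurable_ltR; last by measurability.
  exact: (measurableT_comp mh measurable_fst).
have F0 p : 0 <= F p by rewrite lee_fin mulr_ge0// ?mulr_ge0 ?expR_ge0.
have := @fubini_tonelli _ _ _ _ R mu leb F mF F0.
rewrite /F/=; under eq_integral => x _.
  under eq_integral do rewrite EFinM.
  rewrite ge0_integralZl; last 4 first.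
  - by [].
  - apply/measurable_EFinP/measurable_mulf; last by measurability.
    by apply: measurable_ltR; measurability.
  - by move=> s _; rewrite lee_fin mulr_ge0// expR_ge0.
  - by rewrite lee_fin.
  rewrite expR_tail -EFinM; over.
move=> ->; apply: eq_integral => s _.
have mB : measurable [set x | (h x < s)%R].
  rewrite -[X in measurable X]setTI.
  have : measurable_fun setT (fun x => (h x < s)%R) by exact: measurable_fun_ltr.
  by move=> /(_ measurableT [set true]); apply.
rewrite -ge0_integralZl; last 4 first.
- exact: mB.
- by apply/measurable_EFinP/measurable_funTS.
- by move=> x _; rewrite lee_fin.
- by rewrite lee_fin expR_ge0.
rewrite [RHS]integral_mkcond; apply: eq_integral => x _.
rewrite patchE; case: ifPn => [|/negP]; rewrite inE/=.
  by move=> ->; rewrite -EFinM mul1r mulrC.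
by move=> /negP/negbTE ->; rewrite mul0r mulr0.
Qed.

Lemma layer_cake d (T : measurableType d) (mu : {sigma_finite_measure set T -> \bar R})
    (A : set T) (h : T -> R) : measurable A -> measurable_fun setT h ->
  \int[mu]_(x in A) (expR (- h x))%:E =
  \int[leb]_s ((expR (- s))%:E * mu (A `&` [set x | (h x < s)%R])).
Proof.
move=> mA mh.
transitivity (\int[mu]_x (\1_A x * expR (- h x))%:E).
  rewrite integral_mkcond; apply: eq_integral => x _.
  by rewrite patchE indicE; case: ifPn => _; rewrite ?mul1r ?mul0r.
rewrite layer_cake_weighted//; apply: eq_integral => s _.
rewrite integral_indic//; rewrite -[X in measurable X]setTI.
have : measurable_fun setT (fun x => (h x < s)%R) by exact: measurable_fun_ltr.
by move=> /(_ measurableT [set true]); apply.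
Qed.

(** Cut off at 0, also for [n = 0], so that Gamma integrals and volumes of sublevel sets can be
    written over the whole line. *)
Definition posX n (s : R) : R := if (0 < s)%R then (s ^+ n)%R else 0%R.

Lemma posX_ge0 n s : (0 <= posX n s)%R.
Proof. by rewrite /posX; case: ifPn => // s0; rewrite exprn_ge0// ltW. Qed.

Lemma measurable_posX n : measurable_fun setT (posX n : measurableTypeR R -> R).
Proof.
by apply: measurable_fun_ifT => //; exact: measurable_fun_ltr.
Qed.

Lemma int_posX n (s : R) : \int[leb]_x ((x < s)%R%:R * posX n x)%:E = (posX n.+1 s / n.+1%:R)%:E.
Proof.
have [s0|s0] := leP s 0%R.
  rewrite integral0_eq /posX ?ltNge ?s0 ?mul0r// => x _.
  by case: (ltP 0%R x); [|by rewrite mulr0]; move=> x0; rewrite ltNge (ltW (le_lt_trans s0 x0)) mul0r.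
have d x : is_derive x (1%R : R) (fun t => n.+1%:R^-1 * t ^+ n.+1)%R (x ^+ n)%R.
  have h : is_derive x (1%R : R) (fun t : R => t ^+ n.+1)%R (n.+1%:R * x ^+ n)%R.
    split; first exact: exprn_derivable.
    by rewrite exp_derive /GRing.scale/= mulr1.
  have E : (x ^+ n = n.+1%:R^-1 *: (n.+1%:R * x ^+ n))%R.
    by rewrite /GRing.scale/= mulrA mulVf ?mul1r// pnatr_eq0.
  by rewrite [X in is_derive _ _ _ X]E; exact: is_deriveZ.
have c x : {for x, continuous (fun t : R => n.+1%:R^-1 * t ^+ n.+1)%R}.
  by apply: differentiable_continuous; apply/derivable1_diffP; have [] := d x.
transitivity (\int[leb]_(x in `]0%R, s[) ((x ^+ n)%R)%:E).
  rewrite [RHS]integral_mkcond; apply: eq_integral => x _.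
  rewrite patchE; case: ifPn => [|/negP]; rewrite inE/= in_itv/= /posX.
    by move=> /andP[-> ->]; rewrite mul1r.
  by case: (ltP 0%R x) => //=; rewrite ?mulr0// => _ /negP/negbTE ->; rewrite mul0r.
rewrite integral_itv_bndo_bndc; last first.
  by apply/measurable_EFinP/measurable_funTS; exact: measurable_funX.
rewrite integral_itv_obnd_cbnd; last first.
  by apply/measurable_EFinP/measurable_funTS; exact: measurable_funX.
rewrite (@continuous_FTC2 _ _ (fun t => n.+1%:R^-1 * t ^+ n.+1)%R 0%R s s0).
- by rewrite expr0n mulr0 sube0 /posX s0 mulrC.
- by apply: continuous_subspaceT => x; exact: exprn_continuous.
- split.
  + by move=> x _; have [] := d x.
  + by apply: cvg_at_right_filter; exact: c.
  + by apply: cvg_at_left_filter; exact: c.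
- by move=> x _; rewrite derive1E; have [_ ->] := d x.
Qed.

(** Tonelli takes the place of integration by parts: [s ^+ n.+1] is [n.+1] times the integral of
    [x ^+ n] up to [s]. *)
Lemma Gamma_nat n : \int[leb]_s (expR (- s) * posX n s)%:E = n`!%:R%:E.
Proof.
elim: n => [|n IH].
  transitivity (\int[leb]_(s in `]0%R, +oo[) (expR (- s))%:E).
    rewrite [RHS]integral_mkcond; apply: eq_integral => s _.
    rewrite patchE; case: ifPn => [|/negP]; rewrite inE/= in_itv/= andbT /posX.
      by move=> ->; rewrite mulr1.
    by move=> /negP/negbTE ->; rewrite mulr0.
  have := expR_tail 0%R; rewrite oppr0 expR0 => <-.
  rewrite integral_mkcond; apply: eq_integral => s _.
  rewrite patchE; case: ifPn => [|/negP]; rewrite inE/= in_itv/= andbT.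
    by move=> ->; rewrite mul1r.
  by move=> /negP/negbTE ->; rewrite mul0r.
pose F (p : measurableTypeR R * measurableTypeR R) : \bar R :=
  (n.+1%:R * expR (- p.1) * ((p.2 < p.1)%R%:R * posX n p.2))%R%:E.
have mle : measurable_fun setT (fun p : measurableTypeR R * measurableTypeR R => ((p.2 < p.1)%R%:R : R)).
  by apply: measurable_ltR; measurability.
have mF : measurable_fun setT F.
  apply/measurable_EFinP/measurable_mulf; first by measurability.
  apply: measurable_mulf => //.
  exact: (measurableT_comp (measurable_posX n) measurable_snd).
have F0 p : 0 <= F p by rewrite lee_fin !mulr_ge0// ?expR_ge0 ?posX_ge0.
have := @fubini_tonelli _ _ _ _ R leb leb F mF F0.
rewrite /F/=; under eq_integral => s _.
  under eq_integral do rewrite EFinM.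
  rewrite ge0_integralZl; last 4 first.
  - by [].
  - apply/measurable_EFinP.
    apply: (measurable_mulf _ (measurable_posX n)).
    by apply: measurable_ltR; measurability.
  - by move=> x _; rewrite lee_fin mulr_ge0// posX_ge0.
  - by rewrite lee_fin mulr_ge0// expR_ge0.
  rewrite int_posX -EFinM.
  rewrite (_ : n.+1%:R * _ * _ = expR (- s) * posX n.+1 s)%R; last first.
    by rewrite -mulrA mulrC -!mulrA mulVf ?mulr1// pnatr_eq0.
  over.
move=> ->.
under eq_integral => x _.
  rewrite (_ : (fun s => _) = (fun s => (n.+1%:R * posX n x)%:E * ((x < s)%R%:R * expR (- s))%:E)); last first.
    by apply/funext => s; rewrite -EFinM; congr EFin; ring.
  rewrite ge0_integralZl; last 4 first.
  - by [].
  - apply/measurable_EFinP; apply: measurable_mulf; last by measurability.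
    by apply: measurable_ltR; measurability.
  - by move=> s _; rewrite lee_fin mulr_ge0// expR_ge0.
  - by rewrite lee_fin mulr_ge0// posX_ge0.
  rewrite expR_tail -EFinM -mulrA [X in (_ * X)%R]mulrC EFinM.
  over.
rewrite ge0_integralZl; last 4 first.
- by [].
- apply/measurable_EFinP/measurable_mulf; first by measurability.
  exact: measurable_posX.
- by move=> s _; rewrite lee_fin mulr_ge0 ?expR_ge0 ?posX_ge0.
- by rewrite lee_fin.
by rewrite IH -EFinM factS natrM.
Qed.

End layer_cake.

(** * The volume inequality for a monotone cone *)

Section rotation_calculus.
Variables (R : realType) (A a B b D c : R).

(** With [zeta = s + i th], [rotX + i rotY = e^zeta (A - i a) + e^(- zeta) (B + i b) + D - i c];
    [rotXs] and [rotYs] are the derivatives in [s]. *)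
Definition rotX (th s : R) : R :=
  expR s * (A * cos th + a * sin th) + expR (- s) * (B * cos th + b * sin th) + D.
Definition rotY (th s : R) : R :=
  expR s * (A * sin th - a * cos th) + expR (- s) * (b * cos th - B * sin th) - c.
Definition rotXs (th s : R) : R :=
  expR s * (A * cos th + a * sin th) - expR (- s) * (B * cos th + b * sin th).
Definition rotYs (th s : R) : R :=
  expR s * (A * sin th - a * cos th) - expR (- s) * (b * cos th - B * sin th).
Definition rotP (th s : R) : R := expR (- rotX th s) * cos (rotY th s).
Definition rotQ (th s : R) : R := - (expR (- rotX th s) * sin (rotY th s)).
Definition rotp (th s : R) : R :=
  expR (- rotX th s) * (rotXs th s * sin (rotY th s) - rotYs th s * cos (rotY th s)).

(* Exponent and phase are the real and imaginary parts of an analytic function of [s + i th];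
   these are its Cauchy-Riemann equations. *)
Lemma is_derive_rotP th : is_derive th (1 : R) (fun t => rotP t 0) (- rotp th 0).
Proof.
have dX : is_derive th (1 : R) (fun t => rotX t 0) (- rotYs th 0).
  by rewrite /rotX; apply: is_derive_eq; rewrite /rotYs /GRing.scale/=; ring.
have dY : is_derive th (1 : R) (fun t => rotY t 0) (rotXs th 0).
  by rewrite /rotY; apply: is_derive_eq; rewrite /rotXs /GRing.scale/=; ring.
have dNX := is_deriveN dX.
have H := is_deriveM (is_derive1_comp (is_derive_expR _) dNX) (is_derive1_comp (is_derive_cos _) dY).
by apply: (is_derive_eq H); rewrite /rotp /GRing.scale/=; ring.
Qed.

Lemma is_derive_rotQ th s : is_derive s (1 : R) (fun t => rotQ th t) (rotp th s).
Proof.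
have dX : is_derive s (1 : R) (fun t => rotX th t) (rotXs th s).
  by rewrite /rotX; apply: is_derive_eq; rewrite /rotXs /GRing.scale/=; ring.
have dY : is_derive s (1 : R) (fun t => rotY th t) (rotYs th s).
  by rewrite /rotY; apply: is_derive_eq; rewrite /rotYs /GRing.scale/=; ring.
have dNX := is_deriveN dX.
have H := is_deriveN (is_deriveM (is_derive1_comp (is_derive_expR _) dNX) (is_derive1_comp (is_derive_sin _) dY)).
by apply: (is_derive_eq H); rewrite /rotp /GRing.scale/=; ring.
Qed.

End rotation_calculus.

Section gauss_pair.
Variables (R : realType) (n : nat).
Notation mu := (lebesgue_rV R n).
Notation sq x := (dotrV x x).

Lemma lebE_tonelli (f : 'rV[R]_n * 'rV[R]_n -> \bar R) :
  measurable_fun setT f -> (forall w, 0 <= f w)%E ->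
  (\int[lebE R n]_w f w = \int[mu]_x \int[mu]_y f (x, y))%E.
Proof. by move=> mf f0; exact: (@fubini_tonelli1 _ _ _ _ _ mu mu f mf f0). Qed.

Lemma lebE_fubini (f : 'rV[R]_n * 'rV[R]_n -> \bar R) :
  (lebE R n).-integrable setT f ->
  (\int[lebE R n]_w f w = \int[mu]_x \int[mu]_y f (x, y))%E.
Proof. by move=> fi; apply/esym; exact: (@integral12_prod_meas1 _ _ _ _ _ mu mu f fi). Qed.

Lemma gauss_pair_integrable (k : R) : 0 < k ->
  (lebE R n).-integrable setT (EFin \o (fun w => expR (- (k * (sq w.1 + sq w.2))))).
Proof.
move=> k0; apply/integrableP; split; first by rewrite /comp; measurability.
under eq_integral do rewrite /= ger0_norm ?expR_ge0//.
rewrite (@lebE_tonelli (fun w => (expR (- (k * (sq w.1 + sq w.2))))%:E))//; last first.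
  by measurability.
under eq_integral => x _.
  rewrite (_ : (fun y => _) = (fun y => (expR (- (k * sq x)))%:E * (expR (- (k * sq y)))%:E)%E); last first.
    by apply/funext => y; rewrite /= mulrDr opprD expRD EFinM.
  rewrite ge0_integralZl; last 4 first.
  - by [].
  - by measurability.
  - by move=> y _; rewrite lee_fin expR_ge0.
  - by rewrite lee_fin expR_ge0.
  rewrite gauss_rV//.
  over.
rewrite ge0_integralZr; last 4 first.
- by [].
- by measurability.
- by move=> y _; rewrite lee_fin expR_ge0.
- by rewrite lee_fin exprn_ge0// sqrtr_ge0.
by rewrite gauss_rV// -EFinM ltry.
Qed.

Lemma gauss_pair_osc (k : R) : 0 < k ->
  \int[lebE R n]_w (expR (- (k * (sq w.1 + sq w.2))) * cos (dotrV w.1 w.2)) =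
  Num.sqrt (pi / (k + (4 * k)^-1)) ^+ n * Num.sqrt (pi / k) ^+ n.
Proof.
move=> k0.
pose F (w : 'rV[R]_n * 'rV[R]_n) : \bar R := (expR (- (k * (sq w.1 + sq w.2))) * cos (dotrV w.1 w.2))%:E.
have iF : (lebE R n).-integrable setT F.
  apply: (@integrable_bound _ _ _ _ _ (fun w => expR (- (k * (sq w.1 + sq w.2)))));
    [by measurability| |exact: gauss_pair_integrable].
  move=> w; rewrite normrM ger0_norm ?expR_ge0// ler_piMr ?expR_ge0//.
  by rewrite ler_norml cos_le1 cos_geN1.
rewrite [LHS]/Rintegral (lebE_fubini iF).
under eq_integral => x _.
  rewrite (_ : \int[mu]_y _ = ((expR (- (k * sq x)) * (expR (- (sq x / (4 * k))) * Num.sqrt (pi / k) ^+ n))%:E))%E; last first.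
    rewrite -gauss_cos// -RintegralZl//; last first.
      apply: integrable_gauss_osc => //; first by measurability.
      by move=> t; rewrite ler_norml cos_le1 cos_geN1.
    rewrite /Rintegral fineK; last first.
      apply: integrable_fin_num => //.
      apply: integrable_mulc; apply: integrable_gauss_osc => //; first by measurability.
      by move=> t; rewrite ler_norml cos_le1 cos_geN1.
    by apply: eq_integral => y _; rewrite /F/= mulrDr opprD expRD mulrA (dotC y x).
  rewrite mulrA -expRD (_ : - _ - _ = - ((k + (4 * k)^-1) * sq x)); last by ring.
  over.
under eq_integral do rewrite EFinM.
rewrite ge0_integralZr; last 4 first.
- by [].
- by measurability.
- by move=> y _; rewrite lee_fin expR_ge0.
- by rewrite lee_fin exprn_ge0// sqrtr_ge0.
by rewrite gauss_rV -?EFinM// addr_gt0// invr_gt0 mulr_gt0.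
Qed.

(** The exact value is [(2 pi / sqrt (1 + 4 k^2))^n]. The weaker bound is the [n]-th power of an
    expression linear in [k], fit for Bernoulli's inequality when [k] tends to 0. *)
Lemma gauss_pair_osc_ge (k : R) : 0 < k -> 2 * k <= 1 ->
  (2 * pi * (1 - 2 * k)) ^+ n <=
   \int[lebE R n]_w (expR (- (k * (sq w.1 + sq w.2))) * cos (dotrV w.1 w.2)).
Proof.
move=> k0 k1; rewrite gauss_pair_osc// -exprMn.
have h : 0 <= 1 - 2 * k by rewrite subr_ge0.
rewrite lerXn2r ?nnegrE ?mulr_ge0 ?sqrtr_ge0 ?pi_ge0//.
have kk0 : 0 < k + (4 * k)^-1 by rewrite addr_gt0// invr_gt0 mulr_gt0.
rewrite -sqrtrM ?divr_ge0 ?pi_ge0 ?(ltW kk0)//.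
rewrite -[leLHS]ger0_norm ?mulr_ge0 ?pi_ge0// -sqrtr_sqr ler_sqrt; last first.
  by rewrite mulr_ge0 ?divr_ge0 ?pi_ge0 ?(ltW kk0) ?(ltW k0).
rewrite mulf_div ler_pdivlMr ?mulr_gt0//.
rewrite (_ : (2 * pi * (1 - 2 * k)) ^+ 2 * _ = (pi * pi) * ((1 - 2 * k) ^+ 2 * (1 + 4 * k ^+ 2))); last first.
  by field; rewrite gt_eqF.
rewrite ler_piMr ?mulr_ge0 ?pi_ge0//.
rewrite (_ : (1 - 2 * k) ^+ 2 * _ = 1 - (4 * (k * (1 - 2 * k)) + 16 * (k ^+ 3 * (1 - k)))); last by ring.
rewrite gerBl addr_ge0// ?mulr_ge0 ?exprn_ge0 ?(ltW k0)//.
by lra.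
Qed.

End gauss_pair.

Lemma measurable_sqrtf d (T : measurableType d) (R : realType) (f : T -> R) :
  measurable_fun setT f -> measurable_fun setT (fun x => Num.sqrt (f x)).
Proof. by apply: measurableT_comp; exact: (continuous_measurable_fun (@sqrt_continuous R)). Qed.

Lemma bernoulli_sub (R : realDomainType) n (t : R) : 0 <= t -> t <= 1 ->
  1 - n%:R * t <= (1 - t) ^+ n.
Proof.
move=> t0 t1; elim: n => [|n IH]; first by rewrite mul0r subr0.
have u0 : 0 <= 1 - t by lra.
rewrite exprS; apply: (le_trans _ (ler_wpM2l u0 IH)).
have : 0 <= n%:R * t * t by rewrite !mulr_ge0.
by rewrite -natr1; lra.
Qed.

(** Joint sublevel sets factor, so two successive layer cakes contribute the same one-dimensional
    integral. It is applied with the same [C] to [q] and to [sqrt q], which permits eliminating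
    [C]. *)
Lemma product_layer_cake d (T : measurableType d) (R : realType)
    (mu : {sigma_finite_measure set T -> \bar R}) (h k : T -> R) (P : R -> R) (C : \bar R) :
  measurable_fun setT h -> measurable_fun setT k ->
  measurable_fun setT (P : measurableTypeR R -> R) -> (forall s, 0 <= P s) -> (0 <= C)%E ->
  (forall s t, mu ([set x | h x < s] `&` [set x | k x < t]) = ((P s * P t)%R%:E * C)%E) ->
  (\int[mu]_x (expR (- (h x + k x)))%R%:E =
    C * (\int[@lebesgue_measure R]_s (expR (- s) * P s)%R%:E) ^+ 2)%E.
Proof.
move=> mh mk mP P0 C0 H; set G := (X in (C * X ^+ 2)%E).
have G0 : (0 <= G)%E by apply: integral_ge0 => s _; rewrite lee_fin; apply: mulr_ge0; rewrite ?expR_ge0.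
have mG : measurable_fun setT (fun s : measurableTypeR R => (expR (- s) * P s)%R%:E).
  by apply/measurable_EFinP; apply: measurable_mulf => //; measurability.
transitivity (\int[mu]_x (expR (- k x) * expR (- h x))%R%:E)%E.
  by apply: eq_integral => x _; rewrite -expRD opprD addrC.
rewrite (@layer_cake_weighted _ _ _ _ (fun x => expR (- k x)))//; last first.
- by apply: measurable_exp; apply: measurable_oppf.
transitivity (\int[@lebesgue_measure R]_s ((expR (- s) * P s)%R%:E * (G * C)))%E.
  apply: eq_integral => s _; rewrite EFinM -muleA; congr (_ * _)%E.
  rewrite layer_cake//; last by rewrite -[X in measurable X]setTI; exact: (measurable_fun_ltr mh (measurable_cst s)).
  transitivity (\int[@lebesgue_measure R]_t ((expR (- t) * P t)%R%:E * ((P s)%:E * C)))%E.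
    by apply: eq_integral => t _; rewrite H !EFinM -!muleA; congr (_ * _)%E; rewrite muleCA.
  rewrite ge0_integralZr//; last by rewrite mule_ge0// lee_fin.
    by rewrite -/G muleCA.
  by move=> t _; rewrite lee_fin; apply: mulr_ge0; rewrite ?expR_ge0.
rewrite ge0_integralZr//; last by rewrite mule_ge0.
  by rewrite -/G muleA muleC expe2.
by move=> t _; rewrite lee_fin; apply: mulr_ge0; rewrite ?expR_ge0.
Qed.

Lemma first_quadrant (R : realType) (th : R) : 0 <= th <= pi / 2 ->
  [/\ 0 <= cos th, 0 <= sin th & 1 <= cos th + sin th].
Proof.
move=> /andP[th0 th1].
have c0 : 0 <= cos th by apply: cos_ge0_pihalf; rewrite th1 andbT; have := pi_gt0 R; lra.
have s0 : 0 <= sin th by apply: sin_ge0_pi; rewrite th0/=; have := pi_gt0 R; lra.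
split => //; rewrite -(cos2Dsin2 th) lerD// expr2 ler_piMr ?cos_le1 ?sin_le1//.
Qed.

Lemma cross_terms_le (R : realDomainType) (p q a b c d u v : R) :
  2 * u <= a + b -> 2 * v <= c + d -> - p <= u -> q <= v ->
  - (2 * (p - q)) <= (a + c) + (b + d).
Proof. by move=> h1 h2 h3 h4; lra. Qed.

Lemma rotated_exponent_le (R : realDomainType) (k A B D a b q m : R) :
  k * - (2 * D) <= k * m -> k * m <= q * (a + b) ->
  (1 - q) * (a + b) <= 1 * (k * A * 0 + a * 1) + 1 * (k * B * 0 + b * 1) + 2 * k * D.
Proof. by move=> h1 h2; lra. Qed.

Section split_mass_inequality.
Variables (R : realType) (n : nat).
Notation V := 'rV[R]_n.
Variables (U : V -> V -> Prop) (eps : R) (I : finType) (Bx : I -> 'M[R]_(n, n + n)).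
Hypothesis eps0 : 0 < eps.
Hypothesis U0 : U 0 0.
Hypothesis Uscale : forall r x e, 0 < r -> U x e -> U (r *: x) (r *: e).
Hypothesis Umono : forall x e x' e', U x e -> U x' e' ->
  eps * (dotrV (x - x') (x - x') + dotrV (e - e') (e - e')) <= dotrV (x - x') (e - e').
Hypothesis Usurj : forall x e, exists x1 e1 x2 e2,
  [/\ U x1 e1, U x2 e2, x = x1 + x2 & e = e1 - e2].
Hypothesis Ucov : forall x e, U x e -> exists i, (row_mx x e <= Bx i)%MS.

Notation sq x := (dotrV x x).
Notation E := (lebE R n).
Notation x1 := (sx1 Usurj).
Notation x2 := (sx2 Usurj).
Notation e1 := (se1 Usurj).
Notation e2 := (se2 Usurj).
Notation S r s := (split_scale Usurj r s).

(** With mixed terms [sD] and [sc], [|w|^2 = sA + sB + 2 sD] and [<x, e> = sa - sb + sc]. The map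
    [S r s] multiplies mixed terms by [r s], hence fixes them when [r s = 1]. *)
Definition sA w := sq (x1 w) + sq (e1 w).
Definition sB w := sq (x2 w) + sq (e2 w).
Definition sa w := dotrV (x1 w) (e1 w).
Definition sb w := dotrV (x2 w) (e2 w).
Definition sD w := dotrV (x1 w) (x2 w) - dotrV (e1 w) (e2 w).
Definition sc w := dotrV w.1 w.2 - sa w + sb w.
Definition sN (w : V * V) := sq w.1 + sq w.2.

Let sPs w r s : 0 < r -> 0 < s ->
  [/\ sA (S r s w) = r ^+ 2 * sA w, sB (S r s w) = s ^+ 2 * sB w,
   sa (S r s w) = r ^+ 2 * sa w, sb (S r s w) = s ^+ 2 * sb w &
   sD (S r s w) = r * s * sD w].
Proof.
move=> r0 s0; rewrite /sA /sB /sa /sb /sD.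
have [-> -> -> ->] := split_pt_scale eps0 Uscale Umono Usurj w r0 s0.
by rewrite !(dotZl, dotZr); split; ring.
Qed.

Let scE w : sc w = dotrV (x2 w) (e1 w) - dotrV (x1 w) (e2 w).
Proof.
rewrite /sc; have [_ _ -> ->] := split_ptP Usurj w.
by rewrite !(dotDl, dotDr, dotNr) /sa /sb; ring.
Qed.

Let sc_scale w r s : 0 < r -> 0 < s -> sc (S r s w) = r * s * sc w.
Proof.
move=> r0 s0; rewrite !scE.
have [-> -> -> ->] := split_pt_scale eps0 Uscale Umono Usurj w r0 s0.
by rewrite !(dotZl, dotZr); ring.
Qed.

Let sNE w : sN w = sA w + sB w + 2 * sD w.
Proof.
rewrite /sN; have [_ _ -> ->] := split_ptP Usurj w.
rewrite !(dotDl, dotDr, dotNl, dotNr) (dotC (x2 w) (x1 w)) (dotC (e2 w) (e1 w)).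
by rewrite /sA /sB /sD; ring.
Qed.

Let sA0 w : 0 <= sA w. Proof. by rewrite addr_ge0 ?dot_ge0. Qed.
Let sB0 w : 0 <= sB w. Proof. by rewrite addr_ge0 ?dot_ge0. Qed.

Let sa_ge w : eps * sA w <= sa w.
Proof.
have [u _ _ _] := split_ptP Usurj w.
by have := Umono u U0; rewrite !subr0.
Qed.

Let sb_ge w : eps * sB w <= sb w.
Proof.
have [_ u _ _] := split_ptP Usurj w.
by have := Umono u U0; rewrite !subr0.
Qed.

Let sa_le w : sa w <= sA w.
Proof.
have := dot_AMGM (x1 w) (e1 w); have := ler_norm (sa w); rewrite -/(sa w) -/(sA w).
by have := sA0 w; lra.
Qed.

Let sb_le w : sb w <= sB w.
Proof.
have := dot_AMGM (x2 w) (e2 w); have := ler_norm (sb w); rewrite -/(sb w) -/(sB w).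
by have := sB0 w; lra.
Qed.

Lemma split_sa_ge0 w : 0 <= sa w.
Proof. by apply: le_trans (sa_ge w); rewrite mulr_ge0 ?(ltW eps0). Qed.
Lemma split_sb_ge0 w : 0 <= sb w.
Proof. by apply: le_trans (sb_ge w); rewrite mulr_ge0 ?(ltW eps0). Qed.

Let m w := sA w + sB w.

Let m_le w : eps ^+ 2 * m w <= sN w. Proof. exact: split_mass_le. Qed.
Let le_m w : sN w <= 2 * m w. Proof. exact: le_split_mass. Qed.

Lemma measurable_split_forms : [/\ measurable_fun setT sA, measurable_fun setT sB,
  measurable_fun setT sa, measurable_fun setT sb & measurable_fun setT sD].
Proof.
have [m1 m2 m3 m4] := measurable_split eps0 Umono Usurj.
by rewrite /sA /sB /sa /sb /sD; split; measurability.
Qed.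

Let msc : measurable_fun setT sc.
Proof.
have [mA mB ma mb mD] := measurable_split_forms.
by rewrite /sc; measurability.
Qed.

Let rC r s : 0 < r -> 0 < s -> 0 <= r^-1 ^+ n * s^-1 ^+ n :> R.
Proof. by move=> r0 s0; rewrite mulr_ge0 ?exprn_ge0 ?invr_ge0 ?ltW. Qed.

Let scaleS r s (r0 : 0 < r) (s0 : 0 < s) :
  scales E (S r s) (r^-1 ^+ n * s^-1 ^+ n).
Proof. exact: (scales_split_scale eps0 Uscale Umono Usurj Ucov r0 s0). Qed.

(* [X + i Y] is the exponent [e^s tau a + e^(-s) tau b] with [tau = e^(i th)]: at [th = 0] it is the
   Gaussian exponent with its oscillation, at [th = pi / 2] it has real part close to [sa + sb]. *)
Section rotation.
Variable k : R.
Hypotheses (k0 : 0 < k) (keps : k < eps) (k12 : 2 * k <= 1).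

Let X th s w := rotX (k * sA w) (sa w) (k * sB w) (sb w) (2 * k * sD w) th s.
Let P th s w := rotP (k * sA w) (sa w) (k * sB w) (sb w) (2 * k * sD w) (sc w) th s.
Let Q th s w := rotQ (k * sA w) (sa w) (k * sB w) (sb w) (2 * k * sD w) (sc w) th s.
Let p th s w := rotp (k * sA w) (sa w) (k * sB w) (sb w) (2 * k * sD w) (sc w) th s.

Let eta := k * (eps ^+ 2 * expR (- 1)).
Let eta0 : 0 < eta. Proof. by rewrite !mulr_gt0 ?expR_gt0// exprn_gt0. Qed.

(** Moving [s] amounts to a substitution in [w] with [r s = 1], which preserves the measure; this is
    the invariance that the flow needs. *)
Let XS th s w : X th s w = X th 0 (S (expR (s / 2)) (expR (- s / 2)) w).
Proof.
rewrite /X /rotX; have [-> -> -> -> ->] := @sPs w _ _ (expR_gt0 (s / 2)) (expR_gt0 (- s / 2)).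
rewrite -!expRM_natl -expRD oppr0 expR0.
rewrite (_ : 2%:R * (s / 2) = s); last by field.
rewrite (_ : 2%:R * (- s / 2) = - s); last by field.
rewrite (_ : s / 2 + - s / 2 = 0); last by field.
by rewrite expR0; ring.
Qed.

(** Since [k < eps], monotonicity gives [k A <= a], and [cos + sin >= 1] in the first quadrant; so
    the exponent dominates the Gaussian one at every angle. *)
Let X0_ge th w : 0 <= th <= pi / 2 -> k * sN w <= X th 0 w.
Proof.
move=> /first_quadrant[c0 s0 cs]; rewrite /X /rotX oppr0 expR0 sNE.
have h (A a : R) : 0 <= A -> eps * A <= a -> k * A <= k * A * cos th + a * sin th.
  move=> A0 ha.
  have : k * A <= a by apply: le_trans ha; rewrite ler_wpM2r// ltW.
  move=> /(ler_wpM2r s0) h1.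
  have := ler_wpM2l (mulr_ge0 (ltW k0) A0) cs; lra.
have := h _ _ (sA0 w) (sa_ge w); have := h _ _ (sB0 w) (sb_ge w); lra.
Qed.

Let X_ge th s w : 0 <= th <= pi / 2 -> -1 < s < 1 -> eta * m w <= X th s w.
Proof.
move=> Ith /andP[s1 s2]; rewrite XS; apply: le_trans (X0_ge _ Ith).
rewrite /eta -mulrA ler_wpM2l ?(ltW k0)//; apply: le_trans (m_le _).
rewrite -mulrA ler_wpM2l ?sqr_ge0// /m.
have [-> -> _ _ _] := @sPs w _ _ (expR_gt0 (s / 2)) (expR_gt0 (- s / 2)).
rewrite -!expRM_natl mulrDr lerD// ler_wpM2r// ler_expR; lra.
Qed.

Let Ys_le (s a' A' b' B' : R) : -1 < s < 1 -> 0 <= a' -> a' <= A' -> 0 <= b' -> b' <= B' ->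
  forall u v, `|u| <= 1 -> `|v| <= 1 -> forall u' v', `|u'| <= 1 -> `|v'| <= 1 ->
  `|expR s * (k * A' * u + a' * v) - expR (- s) * (k * B' * u' + b' * v')|
    <= expR 1 * (k + 1) * (A' + B').
Proof.
move=> /andP[s1 s2] a0 aA b0 bB u v hu hv u' v' hu' hv'.
have h (A a t u0 v0 : R) : t <= 1 -> 0 <= a -> a <= A -> `|u0| <= 1 -> `|v0| <= 1 ->
    `|expR t * (k * A * u0 + a * v0)| <= expR 1 * ((k + 1) * A).
  move=> t1 ha hA h1 h2; rewrite normrM ger0_norm ?expR_ge0// ler_pM ?expR_ge0 ?ler_expR//.
  apply: (le_trans (ler_normD _ _)); rewrite mulrDl mul1r lerD//.
    rewrite normrM ger0_norm ?ler_piMr//; rewrite mulr_ge0 ?(ltW k0)//; exact: le_trans hA.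
  by rewrite normrM ger0_norm// (le_trans _ hA)// ler_piMr.
apply: (le_trans (ler_normB _ _)).
rewrite (_ : expR 1 * (k + 1) * (A' + B') = expR 1 * ((k + 1) * A') + expR 1 * ((k + 1) * B')); last by ring.
by apply: lerD; apply: h => //; lra.
Qed.

Let nc (t : R) : `|cos t| <= 1. Proof. by rewrite ler_norml cos_le1 cos_geN1. Qed.
Let ns (t : R) : `|sin t| <= 1. Proof. by rewrite ler_norml sin_le1 sin_geN1. Qed.

(** The derivative contributes a factor linear in [m], absorbed by half of the decay through
    [m <= 2 / eta * e^(eta m / 2)]. *)
Let C := 2 * (expR 1 * (k + 1)) * (2 / eta).
Let G w := C * expR (- (eta / 4 * sN w)).

Let osc_bound th s w : 0 <= th <= pi / 2 -> -1 < s < 1 ->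
  expR (- X th s w) <= expR (- (eta / 2 * sN w)).
Proof.
move=> Ith Js; rewrite ler_expR lerN2 (le_trans _ (X_ge _ Ith Js))//.
by have := ler_wpM2l (ltW eta0) (le_m w); lra.
Qed.

Let pG th s w : 0 <= th <= pi / 2 -> -1 < s < 1 -> `|p th s w| <= G w.
Proof.
move=> Ith Js; rewrite /p /rotp normrM ger0_norm ?expR_ge0// -/(X th s w).
have mw0 : 0 <= m w by rewrite addr_ge0.
apply: (@le_trans _ _ (expR (- (eta * m w)) * (2 * (expR 1 * (k + 1) * m w)))).
  apply: ler_pM; rewrite ?expR_ge0 ?normr_ge0//.
    by rewrite ler_expR lerN2; exact: X_ge.
  apply: (le_trans (ler_normB _ _)); rewrite [leRHS]mulr_natl mulr2n lerD// normrM.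
    apply: (le_trans (ler_piMr (normr_ge0 _) (ns _))); rewrite /rotXs.
    exact: (Ys_le Js (split_sa_ge0 w) (sa_le w) (split_sb_ge0 w) (sb_le w) (nc th) (ns th) (nc th) (ns th)).
  apply: (le_trans (ler_piMr (normr_ge0 _) (nc _))); rewrite /rotYs.
  rewrite (_ : _ - _ = expR s * (k * sA w * sin th + sa w * (- cos th)) -
    expR (- s) * (k * sB w * (- sin th) + sb w * cos th)); last by ring.
  by apply: (Ys_le Js (split_sa_ge0 w) (sa_le w) (split_sb_ge0 w) (sb_le w)); rewrite ?normrN.
have e2' := expR_ge1Dx (eta / 2 * m w).
apply: (@le_trans _ _ (expR (- (eta * m w)) * (2 * (expR 1 * (k + 1) * (2 / eta * expR (eta / 2 * m w)))))).
  rewrite ler_wpM2l ?expR_ge0// ler_wpM2l// ler_wpM2l ?mulr_ge0 ?expR_ge0 ?addr_ge0 ?(ltW k0)//.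
  rewrite -ler_pdivrMl ?divr_gt0// invf_div mulrC.
  by rewrite mulrC; lra.
rewrite (_ : _ * _ = C * expR (- (eta * m w) + eta / 2 * m w)); last by rewrite expRD /C; ring.
have C0 : 0 <= C by rewrite /C !mulr_ge0 ?expR_ge0 ?addr_ge0 ?invr_ge0 ?(ltW k0) ?(ltW eta0).
rewrite /G ler_wpM2l// ler_expR; have := ler_wpM2l (ltW eta0) (le_m w); lra.
Qed.

Let iG : E.-integrable setT (EFin \o G).
Proof. by apply: integrable_mulc; apply: gauss_pair_integrable; rewrite divr_gt0. Qed.

Let mX th s : measurable_fun setT (X th s).
Proof.
have [mA mB ma mb mD] := measurable_split_forms.
by rewrite /X /rotX; measurability.
Qed.

Let osc_integrable th s (g : R -> R) : measurable_fun setT g -> (forall t, `|g t| <= 1) ->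
  0 <= th <= pi / 2 -> -1 < s < 1 ->
  E.-integrable setT (EFin \o (fun w => expR (- X th s w) *
    g (rotY (k * sA w) (sa w) (k * sB w) (sb w) (sc w) th s))).
Proof.
move=> mg g1 Ith Js; have [mA mB ma mb mD] := measurable_split_forms.
apply: (@integrable_bound _ _ _ _ _ (fun w => expR (- (eta / 2 * sN w)))).
- apply: measurable_mulf; first by apply: measurable_exp; apply: measurable_oppf; exact: mX.
  by apply: (measurableT_comp mg); rewrite /rotY; measurability.
- move=> w; rewrite normrM ger0_norm ?expR_ge0// (le_trans _ (osc_bound w Ith Js))//.
  by rewrite ler_piMr ?expR_ge0.
- by apply: gauss_pair_integrable; rewrite divr_gt0.
Qed.

Let J0 : -1 < (0 : R) < 1. Proof. by lra. Qed.

Let iP th : 0 <= th <= pi / 2 -> E.-integrable setT (EFin \o P th 0).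
Proof. by move=> Ith; apply: (osc_integrable (g := cos)) => //; measurability. Qed.

Let iQ th s : 0 <= th <= pi / 2 -> -1 < s < 1 -> E.-integrable setT (EFin \o Q th s).
Proof.
move=> Ith Js.
rewrite (_ : Q th s = fun w => -1 * (expR (- X th s w) *
    sin (rotY (k * sA w) (sa w) (k * sB w) (sb w) (sc w) th s))).
  by apply: integrable_mulc; apply: (osc_integrable (g := sin)) => //; measurability.
by apply/funext => w; rewrite mulN1r.
Qed.

Let QS th s w : Q th s w = Q th 0 (S (expR (s / 2)) (expR (- s / 2)) w).
Proof.
rewrite /Q /rotQ -!/(X _ _ _) XS; congr (- (_ * sin _)).
rewrite /rotY sc_scale ?expR_gt0//.
have [-> -> -> -> _] := @sPs w _ _ (expR_gt0 (s / 2)) (expR_gt0 (- s / 2)).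
rewrite -!expRM_natl -expRD oppr0 expR0.
rewrite (_ : 2%:R * (s / 2) = s); last by field.
rewrite (_ : 2%:R * (- s / 2) = - s); last by field.
rewrite (_ : s / 2 + - s / 2 = 0); last by field.
by rewrite expR0; ring.
Qed.

Let Qinv th s : 0 <= th <= pi / 2 -> -1 < s < 1 -> \int[E]_w Q th s w = \int[E]_w Q th 0 w.
Proof.
move=> Ith Js.
have [ms Hs] := scaleS (expR_gt0 (s / 2)) (expR_gt0 (- s / 2)).
have := scaled_measure_Rintegral ms (rC (expR_gt0 (s / 2)) (expR_gt0 (- s / 2))) Hs (iQ Ith J0).
rewrite -exprMn -invfM -expRD (_ : s / 2 + - s / 2 = 0); last by field.
rewrite expR0 invr1 expr1n mul1r => <-.
by apply: eq_Rintegral => w _; exact: QS.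
Qed.

Let rotation_invariance : \int[E]_w P (pi / 2) 0 w = \int[E]_w P 0 0 w.
Proof.
have [mA mB ma mb mD] := measurable_split_forms.
apply: (@flow_integral _ _ _ E (pi / 2) (fun th w => P th 0 w) Q p G).
- by rewrite divr_ge0 ?pi_ge0.
- by move=> th w _; exact: is_derive_rotP.
- by move=> th s w _ _; exact: is_derive_rotQ.
- exact: pG.
- by move=> th _; rewrite /p /rotp /rotX /rotY /rotXs /rotYs; measurability.
- exact: iG.
- exact: iP.
- exact: iQ.
- exact: Qinv.
Qed.

Let ab_ge w : eps * m w <= sa w + sb w.
Proof. by rewrite mulrDr lerD. Qed.

Lemma split_exp_integrable (d : R) : 0 < d ->
  E.-integrable setT (EFin \o (fun w => expR (- (d * (sa w + sb w))))).
Proof.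
move=> d0; have [mA mB ma mb mD] := measurable_split_forms.
apply: (@integrable_bound _ _ _ _ _ (fun w => expR (- (d * (eps / 2) * sN w)))).
- by measurability.
- move=> w; rewrite ger0_norm ?expR_ge0// ler_expR lerN2 -mulrA ler_wpM2l ?(ltW d0)//.
  by have := ab_ge w; have := ler_wpM2l (ltW eps0) (le_m w); lra.
- by apply: gauss_pair_integrable; rewrite mulr_gt0 ?divr_gt0.
Qed.

(** At angle [pi / 2] the exponent is [sa + sb + 2 k sD], and the mixed term costs at most the
    fraction [k / eps] of [sa + sb]. The dilation by [r = sqrt (1 - k / eps)] in both parts converts
    this loss into a factor. *)
Lemma split_exp_ge_k : (2 * pi * (1 - 2 * k)) ^+ n * (1 - k / eps) ^+ n <=
  \int[E]_w expR (- (sa w + sb w)).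
Proof.
have ke : 0 < 1 - k / eps by rewrite subr_gt0 ltr_pdivrMr// mul1r.
pose r := Num.sqrt (1 - k / eps).
have r0 : 0 < r by rewrite sqrtr_gt0.
have rr : r ^+ 2 = 1 - k / eps by rewrite sqr_sqrtr// ltW.
have [ms Hs] := scaleS r0 r0.
have i1 : E.-integrable setT (EFin \o (fun w => expR (- (sa w + sb w)))).
  have := @split_exp_integrable 1 ltr01.
  by rewrite (_ : (fun w => expR (- (1 * _))) = (fun w => expR (- (sa w + sb w))))//; apply/funext => w; rewrite mul1r.
have h := scaled_measure_Rintegral ms (rC r0 r0) Hs i1.
have h1 : \int[E]_w expR (- ((1 - k / eps) * (sa w + sb w))) =
   (r^-1 ^+ n * r^-1 ^+ n) * \int[E]_w expR (- (sa w + sb w)).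
  rewrite -h; apply: eq_Rintegral => w _.
  by have [_ _ -> -> _] := @sPs w _ _ r0 r0; rewrite rr mulrDr.
have -> : \int[E]_w expR (- (sa w + sb w)) =
    (1 - k / eps) ^+ n * \int[E]_w expR (- ((1 - k / eps) * (sa w + sb w))).
  rewrite h1 mulrA -exprMn -exprMn -rr expr2 -invfM mulfV ?expr1n ?mul1r//.
  by rewrite mulf_neq0// gt_eqF.
rewrite mulrC ler_wpM2l ?exprn_ge0 ?(ltW ke)//.
apply: (le_trans (gauss_pair_osc_ge n k0 k12)).
have -> : \int[E]_w (expR (- (k * (sq w.1 + sq w.2))) * cos (dotrV w.1 w.2)) = \int[E]_w P 0 0 w.
  apply: eq_Rintegral => w _; rewrite /P /rotP /rotX /rotY oppr0 expR0 cos0 sin0.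
  rewrite -[sq _ + sq _]/(sN w) sNE -cosN; congr (expR _ * cos _); first ring.
  by rewrite /sc; ring.
rewrite -rotation_invariance; apply: le_Rintegral => //.
- by apply: iP; rewrite lexx divr_ge0 ?pi_ge0.
- exact: split_exp_integrable.
move=> w _; rewrite /P /rotP /rotX oppr0 expR0 cos_pihalf sin_pihalf.
apply: (@le_trans _ _ (expR (- (1 * (k * sA w * 0 + sa w * 1) + 1 * (k * sB w * 0 + sb w * 1) + 2 * k * sD w)) * 1)).
  by rewrite ler_wpM2l ?expR_ge0// cos_le1.
rewrite mulr1 ler_expR lerN2.
have : - (2 * sD w) <= m w.
  have l1 := ler_norm (- dotrV (x1 w) (x2 w)); rewrite normrN in l1.
  exact: cross_terms_le (dot_AMGM (x1 w) (x2 w)) (dot_AMGM (e1 w) (e2 w)) l1 (ler_norm _).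
move=> /(ler_wpM2l (ltW k0)) h2.
have h3 : k * m w <= k / eps * (sa w + sb w).
  rewrite -mulrA ler_wpM2l ?(ltW k0)// ler_pdivlMl//; exact: ab_ge.
exact: rotated_exponent_le h2 h3.
Qed.

End rotation.

Lemma split_exp_ge : (2 * pi) ^+ n <= \int[E]_w expR (- (sa w + sb w)).
Proof.
set J := \int[E]_w _; have P0 : 0 <= (2 * pi) ^+ n :> R by rewrite exprn_ge0// mulr_ge0// pi_ge0.
pose q := 2 + eps^-1; have q0 : 0 < q by rewrite addr_gt0 ?invr_gt0.
have n0 : 0 <= n%:R :> R by [].
apply/ler_addgt0Pr => d d0.
pose c := (2 * pi) ^+ n * n%:R * q + 1.
have c0 : 0 < c by rewrite ltr_wpDl// !mulr_ge0// ltW.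
(* The product [(1 - 2 k) (1 - k / eps)] is at least [1 - k q]. The bound [q^-1 / 2] gives
   [k q <= 1 / 2], and [d / c] makes the total loss [(2 pi)^n n k q] at most [d]. *)
pose k := Num.min (Num.min (eps / 2) (q^-1 / 2)) (d / c).
have k0 : 0 < k by rewrite !lt_min !divr_gt0 ?invr_gt0.
have k1 : k <= eps / 2 by rewrite /k !ge_min lexx.
have k2 : k <= q^-1 / 2 by rewrite /k !ge_min lexx orbT.
have k3 : k * c <= d by rewrite -ler_pdivlMr// /k !ge_min lexx orbT.
have kq : k * q <= 1 / 2.
  by apply: (le_trans (ler_wpM2r (ltW q0) k2)); rewrite mulrAC mulVf ?gt_eqF.
have ke : 0 < k / eps by rewrite divr_gt0.
have kqE : k * q = 2 * k + k / eps by rewrite /q; ring.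
have h := @split_exp_ge_k k k0 _ _.
have {}h : (2 * pi * (1 - 2 * k)) ^+ n * (1 - k / eps) ^+ n <= J by apply: h; lra.
have h1 : 1 - n%:R * (k * q) <= (1 - 2 * k) ^+ n * (1 - k / eps) ^+ n.
  apply: (@le_trans _ _ ((1 - k * q) ^+ n)).
    apply: bernoulli_sub; first by rewrite mulr_ge0 ?(ltW k0) ?(ltW q0).
    lra.
  rewrite -exprMn; apply: lerXn2r; rewrite ?nnegrE; [lra|apply: mulr_ge0; lra|].
  by have := mulr_gt0 k0 ke; lra.
rewrite exprMn -mulrA in h.
have h2 := ler_wpM2l P0 h1.
have := le_trans h2 h.
rewrite mulrBr mulr1 => h3.
have : (2 * pi) ^+ n * (n%:R * (k * q)) <= k * c.
  by rewrite /c; have := ltW k0; lra.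
lra.
Qed.

Let C := E ([set w | sa w < 1] `&` [set w | sb w < 1]).
Let D := E [set w | Num.sqrt (sa w) + Num.sqrt (sb w) < 1].

(** [q] is quadratic, so raising its bound from 1 to [s] dilates one [n]-dimensional part by
    [sqrt s]. *)
Let posh (s : R) : R := if 0 < s then Num.sqrt s ^+ n else 0.

Let msab : measurable_fun setT sa /\ measurable_fun setT sb.
Proof. by have [_ _ ma mb _] := measurable_split_forms. Qed.

Let mltR (h : V * V -> R) (s : R) : measurable_fun setT h -> measurable [set w | h w < s].
Proof.
move=> mh; rewrite -[X in measurable X]setTI.
exact: (measurable_fun_ltr mh (measurable_cst s)).
Qed.

Let mC : measurable ([set w | sa w < 1] `&` [set w | sb w < 1]).
Proof. by apply: measurableI; apply: mltR; have [] := msab. Qed.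

Let sa_sq (h : R) (s : R) : 0 <= h -> (Num.sqrt h < s) = (0 < s) && (h < s ^+ 2).
Proof.
move=> h0; case: (ltP 0 s) => s0 /=; last by apply/negbTE; rewrite -leNgt (le_trans s0).
rewrite -{1}(ger0_norm (ltW s0)) -sqrtr_sqr ltr_sqrt// exprn_gt0//.
Qed.

Let posh_ge0 s : 0 <= posh s.
Proof. by rewrite /posh; case: ifP => // _; rewrite exprn_ge0. Qed.

Let mposh : measurable_fun setT (posh : measurableTypeR R -> R).
Proof.
apply: measurable_fun_ifT; first exact: measurable_fun_ltr.
  by apply: measurable_expf; apply: (@measurable_sqrtf _ (measurableTypeR R) R id); exact: measurable_id.
exact: measurable_cst.
Qed.

Lemma split_box_measure s t : E ([set w | sa w < s] `&` [set w | sb w < t]) =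
  ((posh s * posh t)%R%:E * C)%E.
Proof.
rewrite /posh; case: (ltP 0 s) => s0; last first.
  rewrite mul0r mul0e (_ : _ `&` _ = set0) ?measure0//; apply/seteqP; split => w //= -[+ _].
  by rewrite ltNge (le_trans s0)// split_sa_ge0.
case: (ltP 0 t) => t0; last first.
  rewrite mulr0 mul0e (_ : _ `&` _ = set0) ?measure0//; apply/seteqP; split => w //= -[_].
  by rewrite ltNge (le_trans t0)// split_sb_ge0.
have rs : 0 < (Num.sqrt s)^-1 by rewrite invr_gt0 sqrtr_gt0.
have rt : 0 < (Num.sqrt t)^-1 by rewrite invr_gt0 sqrtr_gt0.
have [_ Hs] := scaleS rs rt.
rewrite -[Num.sqrt s]invrK -[Num.sqrt t]invrK -(Hs _ mC); congr (E _).
apply/seteqP; split => w /=; have [_ _ -> -> _] := @sPs w _ _ rs rt;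
  by rewrite !exprVn !sqr_sqrtr ?(ltW s0) ?(ltW t0)// ![_^-1 * _]mulrC !ltr_pdivrMr// !mul1r.
Qed.

Lemma split_diamond_measure s : E [set w | Num.sqrt (sa w) + Num.sqrt (sb w) < s] =
  ((posX (2 * n) s)%:E * D)%E.
Proof.
rewrite /posX; case: (ltP 0 s) => s0; last first.
  rewrite mul0e (_ : mkset _ = set0) ?measure0//; apply/seteqP; split => w //=.
  by rewrite ltNge (le_trans s0)// addr_ge0.
have rs : 0 < s^-1 by rewrite invr_gt0.
have [_ Hs] := scaleS rs rs.
have [ma mb] := msab.
have mD : measurable [set w | Num.sqrt (sa w) + Num.sqrt (sb w) < 1].
  by apply: mltR; apply: measurable_addf; apply: measurable_sqrtf.
have sqE h : Num.sqrt (s^-1 ^+ 2 * h) = s^-1 * Num.sqrt h.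
  by rewrite sqrtrM ?sqr_ge0// sqrtr_sqr ger0_norm// ltW.
rewrite mul2n -addnn exprD -[s in (s ^+ _ * _)%R]invrK -[s in (_ * s ^+ _)%R]invrK -(Hs _ mD); congr (E _).
apply/seteqP; split => w /=; have [_ _ -> -> _] := @sPs w _ _ rs rs;
  by rewrite !sqE -mulrDr mulrC ltr_pdivrMr// mul1r.
Qed.

Let Gh := (\int[@lebesgue_measure R]_s (expR (- s) * posh s)%R%:E)%E.

(** [Gamma] is a real-valued integral, so the identification requires finiteness, obtained in
    [split_diamond_ge] from [0 < C * Gh ^+ 2 < +oo]. *)
Let GhE : Gh \is a fin_num -> Gh = (Gamma (n%:R / 2 + 1))%:E.
Proof.
have -> : Gh = (\int[@lebesgue_measure R]_(t in `]0%R, +oo[) (t `^ (n%:R / 2 + 1 - 1) * expR (- t))%R%:E)%E.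
  rewrite [RHS]integral_mkcond; apply: eq_integral => s _.
  rewrite patchE; case: ifPn => [|/negP]; rewrite inE/= in_itv/= andbT /posh.
    move=> s0; rewrite s0 mulrC addrK -powR12_sqrt ?ltW//.
    by congr (_ * _)%:E; rewrite -powR_mulrn ?powR_ge0// -powRrM mulrC.
  by move=> /negP/negbTE ->; rewrite mulr0.
by move=> /fineK <-.
Qed.

(** Three integrals: [C Gh^2] for [q], at least [(2 pi)^n] by [split_exp_ge]; and for [sqrt q] the
    two evaluations [C n!^2] and [(2n)! D]. Eliminating [C] leaves the bound on [D]. *)
Lemma split_diamond_ge :
  ((n`!%:R ^+ 2 * (2 * pi) ^+ n)%R%:E <=
    ((2 * n)`!%:R * Gamma (n%:R / 2 + 1) ^+ 2)%R%:E * D)%E.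
Proof.
have [ma mb] := msab.
have C0 : (0 <= C)%E by exact: measure_ge0.
have i1 : E.-integrable setT (EFin \o (fun w => expR (- (sa w + sb w)))).
  have := @split_exp_integrable 1 ltr01.
  by rewrite (_ : (fun w => expR (- (1 * _))) = (fun w => expR (- (sa w + sb w))))//; apply/funext => w; rewrite mul1r.
have I1 : (\int[E]_w (expR (- (sa w + sb w)))%:E = C * Gh ^+ 2)%E.
  exact: product_layer_cake ma mb mposh posh_ge0 C0 split_box_measure.
have I2 : (\int[E]_w (expR (- (Num.sqrt (sa w) + Num.sqrt (sb w))))%:E = C * (n`!%:R%:E) ^+ 2)%E.
  rewrite -Gamma_nat; apply: product_layer_cake => //.
  - exact: measurable_sqrtf.
  - exact: measurable_sqrtf.
  - exact: measurable_posX.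
  - exact: posX_ge0.
  move=> s t; have hs := sa_sq s (split_sa_ge0 _); have ht := sa_sq t (split_sb_ge0 _).
  rewrite /posX; case: (ltP 0 s) => s0; last first.
    rewrite mul0r mul0e (_ : _ `&` _ = set0) ?measure0//; apply/seteqP; split => w //= -[+ _].
    by rewrite hs ltNge s0.
  case: (ltP 0 t) => t0; last first.
    rewrite mulr0 mul0e (_ : _ `&` _ = set0) ?measure0//; apply/seteqP; split => w //= -[_].
    by rewrite ht ltNge t0.
  have -> : ((s ^+ n * t ^+ n)%:E * C)%E = ((posh (s ^+ 2) * posh (t ^+ 2))%R%:E * C)%E.
    by rewrite /posh !exprn_gt0// !sqrtr_sqr !ger0_norm ?ltW.
  rewrite -split_box_measure; congr (E _).
  by apply/seteqP; split => w /=; rewrite hs ht s0 t0.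
have I3 : (\int[E]_w (expR (- (Num.sqrt (sa w) + Num.sqrt (sb w))))%:E = (2 * n)`!%:R%:E * D)%E.
  rewrite layer_cake//; last by apply: measurable_addf; exact: measurable_sqrtf.
  transitivity (\int[@lebesgue_measure R]_s ((expR (- s) * posX (2 * n) s)%R%:E * D))%E.
    by apply: eq_integral => s _; rewrite setTI split_diamond_measure muleA.
  rewrite ge0_integralZr//.
  - by rewrite Gamma_nat.
  - by apply/measurable_EFinP; apply: measurable_mulf; [measurability|exact: measurable_posX].
  - by move=> s _; rewrite lee_fin mulr_ge0 ?expR_ge0 ?posX_ge0.
  - exact: measure_ge0.
have h1 : (((2 * pi) ^+ n)%:E <= C * Gh ^+ 2)%E.
  rewrite -I1; have := split_exp_ge; rewrite -lee_fin fineK//.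
  exact: integrable_fin_num i1.
have hfin : (C * Gh ^+ 2 < +oo)%E.
  by rewrite -I1 ltey_eq; have := integrable_fin_num measurableT i1 => /= ->.
have hpos : (0 < C * Gh ^+ 2)%E by apply: lt_le_trans h1; rewrite lte_fin exprn_gt0// mulr_gt0// pi_gt0.
have Gh0 : (0 <= Gh)%E by apply: integral_ge0 => s _; rewrite lee_fin mulr_ge0 ?expR_ge0.
have fGh : Gh \is a fin_num.
  rewrite ge0_fin_numE// ltNge leye_eq; apply/negP => /eqP Goo.
  move: hfin hpos; rewrite Goo expe2 mulyy.
  have [->|Cn0] := eqVneq C 0%E; first by rewrite mul0e ltxx.
  by rewrite gt0_muley ?ltxx// lt_def Cn0.
move: h1; rewrite GhE// -EFin_expe => h1.
rewrite EFinM [in leRHS]EFinM -[leRHS]muleA [X in (_ <= _ * X)%E]muleC [leRHS]muleA -I3 I2.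
rewrite -[leRHS]muleA [leRHS]muleCA -EFin_expe.
by apply: lee_wpmul2l => //; rewrite lee_fin exprn_ge0.
Qed.

End split_mass_inequality.

(** * Subdifferentials of polyhedral gauges *)

Definition sympl_mx (F : nzRingType) n : 'M[F]_(n + n) := block_mx 0 1%:M (- 1%:M) 0.

Section symplectic_cover.
Variables (F : fieldType) (n : nat).

Lemma sympl_mx_unit : sympl_mx F n \in unitmx.
Proof.
suff H : sympl_mx F n *m (- sympl_mx F n) = 1%:M by have [] := mulmx1_unit H.
rewrite mulmxN /sympl_mx mulmx_block !mulmx0 !mul0mx !mul1mx mulmx1 add0r addr0.
by rewrite !addr0 opp_block_mx opprK oppr0 -scalar_mx_block.
Qed.

(* A maximal linearly independent family in [S] spans [S]; being isotropic for a nondegenerate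
   form on a space of dimension [2n], it has at most [n] elements. *)
Lemma isotropic_cover (S : 'rV[F]_(n + n) -> Prop) :
  (forall u v, S u -> S v -> u *m sympl_mx F n *m v^T = 0) ->
  exists B : 'M[F]_(n, n + n), forall v, S v -> (v <= B)%MS.
Proof.
move=> iso.
pose P (r : nat) := `[< exists m (M : 'M[F]_(m, n + n)), (forall i, S (row i M)) /\ \rank M = r >].
have Pex : exists r, P r.
  by exists 0%N; apply/asboolP; exists 0%N, 0; split=> [[]//|]; rewrite mxrank0.
have Ple r : P r -> (r <= n + n)%N.
  by move=> /asboolP[m [M [_ <-]]]; exact: rank_leq_col.
case: (ex_maxnP Pex Ple) => r /asboolP[m [M [SM rM]]] maxr.
have rn : (r <= n)%N.
  have MM : (M *m sympl_mx F n) *m M^T = 0.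
    apply/row_matrixP => i; apply/rowP => j; rewrite row0 mxE.
    transitivity ((row i M *m sympl_mx F n *m (row j M)^T) ord0 ord0); last by rewrite iso// !mxE.
    rewrite -row_mul [LHS]mxE [RHS]mxE; apply: eq_bigr => k _; congr (_ * _); last by rewrite !mxE.
    by rewrite [RHS]mxE.
  have := mulmx0_rank_max MM; rewrite mxrank_tr mxrankMfree ?row_free_unit ?sympl_mx_unit// rM.
  by rewrite !addnn leq_double.
(* The [r <= n] basis rows, padded with zero rows to exactly [n]. *)
exists ((pid_mx r : 'M[F]_(n, \rank M)) *m row_base M) => v Sv.
have vM : (v <= M)%MS.
  have h : (\rank (col_mx M v) <= r)%N.
    apply: maxr; apply/asboolP; exists (m + 1)%N, (col_mx M v); split => // i.
    rewrite -(splitK i); case: (fintype.split i) => j /=; first by rewrite rowKu.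
    by rewrite rowKd; rewrite (_ : row j v = v)//; apply/rowP => k; rewrite !mxE (ord1 j).
  have : (M <= col_mx M v)%MS by rewrite -addsmxE addsmxSl.
  move=> /mxrank_leqif_sup/leqifP; case: ifPn => [h1 _|_].
    by apply: submx_trans h1; rewrite -addsmxE addsmxSr.
  by rewrite rM ltnNge h.
move: vM; rewrite -(eq_row_base M) => /submxP[D ->].
apply/submxP; exists (D *m (pid_mx r : 'M[F]_(\rank M, n))).
rewrite -mulmxA; congr (_ *m _).
by rewrite mulmxA pid_mx_id// (_ : pid_mx r = 1%:M) ?mul1mx// -rM pid_mx_1.
Qed.

End symplectic_cover.

Section euclid.
Variables (R : realType) (n : nat).
Implicit Types x y : 'rV[R]_n.
Notation sq x := (dotrV x x).

Lemma dot_CS x y : dotrV x y <= Num.sqrt (sq x) * Num.sqrt (sq y).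
Proof.
have [y0|y0] := eqVneq (sq y) 0.
  by rewrite (dot_eq0 y0) dot0r mulr_ge0.
have yp : 0 < sq y by rewrite lt_def y0 dot_ge0.
have := dot_ge0 (sq y *: x - dotrV x y *: y).
rewrite !(dotDl, dotDr, dotNl, dotNr, dotZl, dotZr) (dotC y x) => h.
have h2 : 0 <= sq y * (sq x * sq y - dotrV x y ^+ 2) by lra.
rewrite pmulr_rge0// subr_ge0 in h2.
rewrite -sqrtrM ?dot_ge0//; apply: le_trans (ler_wsqrtr h2).
by rewrite sqrtr_sqr ler_norm.
Qed.

Lemma norm_sq_le x : `|x| ^+ 2 <= sq x.
Proof.
have h : `|x| <= Num.sqrt (sq x).
  rewrite [leLHS]/Num.norm /= mx_normrE; apply/bigmax_leP; split => //= -[i j] _ /=.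
  by rewrite (ord1 i) -sqrtr_sqr ler_wsqrtr// coord_le_sq.
by rewrite -(sqr_sqrtr (dot_ge0 x)) lerXn2r ?nnegrE.
Qed.

Lemma coercive_min (F : 'rV[R]_n -> R) (k B : R) : continuous F -> 0 < k ->
  (forall v, k * sq v - B <= F v) -> exists v, forall w, F v <= F w.
Proof.
move=> cF k0 FB; pose A := [set v | F v <= F 0].
have A0 : A 0 by rewrite /A/=.
have cA : closed A by apply: (@preimage_closed _ _ F [set t | t <= F 0]) => //; exact: closed_le.
have bA : bounded_set A.
  exists ((F 0 + B) / k + 1); split; first exact: num_real.
  move=> M hM v /= Av.
  have h1 : `|v| ^+ 2 <= (F 0 + B) / k.
    apply: (le_trans (norm_sq_le v)); rewrite ler_pdivlMr// mulrC.
    by have := FB v; rewrite /A/= in Av; lra.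
  have [//|Mv] := leP `|v| M.
  have M1 : 1 < M by apply: le_lt_trans hM; rewrite lerDr (le_trans _ h1)// sqr_ge0.
  have : M < `|v| ^+ 2 by apply: (lt_trans Mv); rewrite expr2 ltr_pMr//; lra.
  by move=> h; move: (lt_le_trans h h1); lra.
have [c cin Hc] := @EVT_min_rV R n F A (ex_intro _ 0 A0) (bounded_closed_compact bA cA)
  (continuous_subspaceT cF).
exists c => w; have [Aw|] := leP (F w) (F 0); first by apply: Hc; rewrite inE.
by move=> /ltW; apply: le_trans; apply: Hc; rewrite inE.
Qed.

End euclid.

Section continuous_combinators.
Variables (R : realType) (T : topologicalType).
Implicit Types f h : T -> R.

Lemma contD f h : continuous f -> continuous h -> continuous (fun t => f t + h t).
Proof. by move=> cf ch t; apply: (@continuousD _ R^o _ f h); [exact: cf|exact: ch]. Qed.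

Lemma contB f h : continuous f -> continuous h -> continuous (fun t => f t - h t).
Proof. by move=> cf ch t; apply: (@continuousB _ R^o _ f h); [exact: cf|exact: ch]. Qed.

Lemma contM f h : continuous f -> continuous h -> continuous (fun t => f t * h t).
Proof. by move=> cf ch t; apply: continuousM; [exact: cf|exact: ch]. Qed.

Lemma contC (c : R) : continuous (fun _ : T => c).
Proof. exact: cst_continuous. Qed.

Lemma contX f n : continuous f -> continuous (fun t => f t ^+ n).
Proof.
move=> cf; elim: n => [|n IH]; first exact: contC.
by under eq_fun do rewrite exprS; exact: contM.
Qed.

End continuous_combinators.

Lemma continuous_dotf (R : realType) (T : topologicalType) n (f h : T -> 'rV[R]_n) :
  (forall i, continuous (fun t => f t ord0 i)) -> (forall i, continuous (fun t => h t ord0 i)) ->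
  continuous (fun t => dotrV (f t) (h t)).
Proof.
move=> cf ch; rewrite /dotrV; apply: continuous_big => [|i _ t]; last first.
  by apply: continuousM; [exact: cf|exact: ch].
exact: add_continuous.
Qed.

Lemma le_limit0 (R : realFieldType) (a b c t0 : R) : 0 < t0 -> 
  (forall t, 0 < t -> t <= t0 -> a <= b + t * c) -> a <= b.
Proof.
move=> t00 H; apply/ler_addgt0Pr => d d0.
have c0 : 0 < `|c| + 1 by rewrite ltr_wpDl.
have dc : 0 < d / (`|c| + 1) by rewrite divr_gt0.
have t1 : 0 < Num.min t0 (d / (`|c| + 1)) by rewrite lt_min t00.
apply: (le_trans (H _ t1 _)); first by rewrite ge_min lexx.
rewrite lerD2l; apply: (@le_trans _ _ (Num.min t0 (d / (`|c| + 1)) * (`|c| + 1))).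
  by rewrite ler_wpM2l ?(ltW t1)// (le_trans (ler_norm c))// lerDl.
by rewrite -ler_pdivlMr// ge_min lexx orbT.
Qed.

Section polytope.
Variables (R : realType) (n : nat) (J : finType) (X : J -> 'rV[R]_n) (j0 : J).
Hypothesis X0 : X j0 = 0.
Notation V := 'rV[R]_n.
Notation sq x := (dotrV x x).

(** The support function of the polytope spanned by the [X j]; the start value 0 is itself one of
    the terms, as [X j0 = 0]. *)
Definition max_dot (v : V) : R := \big[Num.max/0]_j dotrV (X j) v.
Local Notation g := max_dot.

Lemma max_dot_ge j v : dotrV (X j) v <= g v.
Proof. exact: le_bigmax. Qed.

Lemma max_dot_le v a : 0 <= a -> (forall j, dotrV (X j) v <= a) -> g v <= a.
Proof. by move=> a0 H; apply: bigmax_le. Qed.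

Lemma max_dot_ge0 v : 0 <= g v.
Proof. by have := max_dot_ge j0 v; rewrite X0 dot0l. Qed.

Lemma max_dotD u v : g (u + v) <= g u + g v.
Proof.
apply: max_dot_le; first by rewrite addr_ge0 ?max_dot_ge0.
by move=> j; rewrite dotDr lerD ?max_dot_ge.
Qed.

Lemma max_dotZ r v : 0 <= r -> g (r *: v) = r * g v.
Proof.
rewrite le_eqVlt => /predU1P[<-|r0].
  rewrite scale0r mul0r; apply/eqP; rewrite eq_le max_dot_ge0 andbT.
  by apply: max_dot_le => // j; rewrite dot0r.
have h s u : 0 < s -> g (s *: u) <= s * g u.
  move=> s0; apply: max_dot_le; first by rewrite mulr_ge0 ?max_dot_ge0 ?(ltW s0).
  by move=> j; rewrite dotZr ler_wpM2l ?(ltW s0)// max_dot_ge.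
apply/eqP; rewrite eq_le h// /= -ler_pdivlMl//.
by rewrite -{1}(scale1r v) -(mulVf (lt0r_neq0 r0)) -scalerA h// invr_gt0.
Qed.

Lemma max_dot_lip : exists2 L, 0 <= L & forall v, g v <= L * Num.sqrt (sq v).
Proof.
exists (\sum_j Num.sqrt (sq (X j))); first by apply: sumr_ge0 => j _.
move=> v; apply: max_dot_le; first by rewrite mulr_ge0//; apply: sumr_ge0 => j _.
move=> j; apply: (le_trans (dot_CS _ _)); rewrite ler_wpM2r// (bigD1 j)//= lerDl.
by apply: sumr_ge0 => ? _.
Qed.

Definition active v : {set J} := [set j | dotrV (X j) v == g v].

(** On vectors with one active set [g] is linear, so active terms give equality at [u - t v]. Every
    inactive term has a positive gap at [u], and small [t] cannot close it; the [+ 1] in [gap] only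
    keeps the denominator positive. *)
Lemma max_dot_back u v : active u = active v ->
  exists2 t0, 0 < t0 & forall t, 0 < t -> t <= t0 -> g (u - t *: v) <= g u - t * g v.
Proof.
move=> Euv.
pose gap j := if dotrV (X j) u == g u then 1 else
  (g u - dotrV (X j) u) / (g v - dotrV (X j) v + 1).
have gap0 j : 0 < gap j.
  rewrite /gap; case: ifPn => // ne; rewrite divr_gt0//.
    by rewrite subr_gt0 lt_neqAle ne max_dot_ge.
  by have := max_dot_ge j v; lra.
exists (\big[Num.min/1]_j gap j); first by apply/bigmin_gtP; split => // j _.
move=> t t0 tle.
have H j : dotrV (X j) (u - t *: v) <= g u - t * g v.
  rewrite dotBr dotZr.
  have : t <= gap j by apply: (le_trans tle); exact: bigmin_le.
  have jE : (dotrV (X j) u == g u) = (dotrV (X j) v == g v).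
    by have /setP/(_ j) := Euv; rewrite !inE.
  rewrite /gap; case: ifPn => [e _|ne].
    by move: (e); rewrite jE => /eqP ->; rewrite (eqP e).
  have d1 : 0 < g v - dotrV (X j) v + 1 by have := max_dot_ge j v; lra.
  by rewrite ler_pdivlMr// => h; lra.
apply: max_dot_le => //.
by have := H j0; rewrite X0 dot0l.
Qed.

(** [y] belongs to the subdifferential of [g^2 / 2] at [e]. *)
Definition subgrad (y e : V) := forall e', g e ^+ 2 / 2 + dotrV y (e' - e) <= g e' ^+ 2 / 2.

Lemma subgrad_le y e v : subgrad y e -> dotrV y v <= g e * g v.
Proof.
move=> Hy; apply: (@le_limit0 _ _ _ (g v ^+ 2 / 2) 1) => // t t0 _.
have := Hy (e + t *: v); rewrite addrAC subrr add0r dotZr => h.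
have h2 : g (e + t *: v) ^+ 2 <= (g e + t * g v) ^+ 2.
  rewrite lerXn2r ?nnegrE ?max_dot_ge0//; last by rewrite -max_dotZ ?(ltW t0)// max_dotD.
  by rewrite addr_ge0 ?mulr_ge0 ?max_dot_ge0 ?(ltW t0).
rewrite -(ler_pM2l t0); lra.
Qed.

Lemma subgrad_ge y e v : subgrad y e -> active e = active v -> g e * g v <= dotrV y v.
Proof.
move=> Hy /max_dot_back[t1 t10 Ht].
apply: (@le_limit0 _ _ _ (g v ^+ 2 / 2) t1) => // t t0 tt1.
have := Hy (e - t *: v); rewrite addrAC subrr add0r dotNr dotZr => h.
have h1 := Ht t t0 tt1.
have h2 : g (e - t *: v) ^+ 2 <= (g e - t * g v) ^+ 2.
  by rewrite lerXn2r ?nnegrE ?max_dot_ge0// (le_trans _ h1) ?max_dot_ge0.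
rewrite -(ler_pM2l t0); lra.
Qed.

(** The right side is symmetric in [e] and [v]. Hence pairs with the same active set are isotropic
    for the symplectic form, which is what confines them to [n] dimensions. *)
Lemma subgrad_dot y e v : subgrad y e -> active e = active v -> dotrV y v = g e * g v.
Proof. by move=> h a; apply/eqP; rewrite eq_le subgrad_le// subgrad_ge. Qed.

Lemma subgrad_mono y e y' e' : subgrad y e -> subgrad y' e' -> 0 <= dotrV (y - y') (e - e').
Proof.
move=> /(_ e') h /(_ e) h'.
by move: h h'; rewrite !(dotDl, dotDr, dotNl, dotNr); lra.
Qed.

Lemma subgradZ r y e : 0 < r -> subgrad y e -> subgrad (r *: y) (r *: e).
Proof.
move=> r0 h e'; have := h (r^-1 *: e').
rewrite !max_dotZ ?invr_ge0 ?(ltW r0)// => {}h.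
have -> : e' - r *: e = r *: (r^-1 *: e' - e).
  by rewrite scalerBr scalerA mulfV ?scale1r// gt_eqF.
rewrite dotZl dotZr.
have := ler_wpM2l (sqr_ge0 r) h.
rewrite exprMn [X in _ <= X -> _](_ : _ = g e' ^+ 2 / 2); last by field; rewrite gt_eqF.
by rewrite exprMn; lra.
Qed.

Lemma subgrad0 : subgrad 0 0.
Proof.
move=> e'; rewrite dot0l addr0 -{1}(scale0r 0) max_dotZ// mul0r expr0n mul0r.
by rewrite divr_ge0 ?sqr_ge0.
Qed.

Lemma continuous_max_dot m (f : 'rV[R]_m -> V) : (forall i, continuous (fun t => f t ord0 i)) ->
  continuous (fun t => g (f t)).
Proof.
move=> cf; rewrite /max_dot; apply: continuous_big => [|j _]; first exact: max_continuous.
by apply: continuous_dotf => // i; exact: cst_continuous.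
Qed.

Section split_existence.
Variables (eps : R) (x xi : V).
Hypotheses (eps0 : 0 < eps) (eps1 : eps <= 1).

(** For [e1 = a] and [e2 = b] the two equations of the splitting determine [y1] and [y2]. These are
    minus the partial gradients of the smooth part of [Phi], so the subgradient conditions say
    exactly that [(a, b)] minimises [Phi]. *)
Let Phi (a b : V) := g a ^+ 2 / 2 + g b ^+ 2 / 2 + eps / 4 * sq (a + b) +
  sq (a - b - xi) / (4 * eps) - dotrV x (a + b) / 2.

Let Phi_min : exists a b, forall a' b', Phi a b <= Phi a' b'.
Proof.
have cl i : continuous (fun z : 'rV[R]_(n + n) => lsubmx z ord0 i).
  by under eq_fun do rewrite mxE; exact: coord_continuous.
have cr i : continuous (fun z : 'rV[R]_(n + n) => rsubmx z ord0 i).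
  by under eq_fun do rewrite mxE; exact: coord_continuous.
have cF : continuous (fun z : 'rV[R]_(n + n) => Phi (lsubmx z) (rsubmx z)).
  have cD i : continuous (fun z : 'rV[R]_(n + n) => (lsubmx z + rsubmx z) ord0 i).
    by under eq_fun do rewrite mxE; apply: contD.
  have cB i : continuous (fun z : 'rV[R]_(n + n) => (lsubmx z - rsubmx z - xi) ord0 i).
    under eq_fun => z do rewrite mxE [X in X + _]mxE [X in _ + X + _]mxE [X in _ + X]mxE.
    by apply: contB; [apply: contB|exact: contC].
  have cdD := continuous_dotf cD cD; have cdB := continuous_dotf cB cB.
  have cdx := continuous_dotf (fun i => @contC _ _ (x ord0 i)) cD.
  have cgl := continuous_max_dot cl; have cgr := continuous_max_dot cr.
  rewrite /Phi; apply: contB; last exact: contM cdx (@contC _ _ _).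
  apply: contD; last exact: contM cdB (@contC _ _ _).
  apply: contD; last exact: contM (@contC _ _ _) cdD.
  by apply: contD; apply: contM; try exact: contC; exact: contX.
have [z Hz] : exists z, forall w, Phi (lsubmx z) (rsubmx z) <= Phi (lsubmx w) (rsubmx w).
  apply: (coercive_min (k := eps / 4) (B := sq xi / (4 * eps) + sq x / (2 * eps)) cF) => [|v].
    by rewrite divr_gt0.
  have -> : sq v = sq (lsubmx v) + sq (rsubmx v).
    rewrite /dotrV big_split_ord/=; congr (_ + _); apply: eq_bigr => i _; by rewrite !mxE.
  set a := lsubmx v; set b := rsubmx v; rewrite /Phi.
  have h1 := sqr_ge0 (g a); have h2 := sqr_ge0 (g b).
  have h3 := dot_ge0 (a - b - xi - xi).
  have h4 := dot_ge0 (eps *: (a + b) - 2 *: x).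
  have h5 := dot_ge0 (a - b).
  have h6 : 0 <= sq (a - b) * (1 - eps ^+ 2) by rewrite mulr_ge0// subr_ge0 expr_le1// ltW.
  have ie : 0 < eps^-1 by rewrite invr_gt0.
  have {}h3 := mulr_ge0 (ltW ie) h3; have {}h4 := mulr_ge0 (ltW ie) h4.
  have {}h6 := mulr_ge0 (ltW ie) h6.
  rewrite -subr_ge0.
  rewrite (_ : _ - _ = g a ^+ 2 / 2 + g b ^+ 2 / 2 + eps^-1 * sq (a - b - xi - xi) / 8 
     + eps^-1 * sq (eps *: (a + b) - 2 *: x) / 8 + eps^-1 * (sq (a - b) * (1 - eps ^+ 2)) / 8).
    by lra.
  rewrite !(dotDl, dotDr, dotNl, dotNr, dotZl, dotZr) (dotC b a) (dotC xi a) (dotC xi b) (dotC a x) (dotC b x).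
  by field; rewrite gt_eqF.
exists (lsubmx z), (rsubmx z) => a' b'.
by have := Hz (row_mx a' b'); rewrite row_mxKl row_mxKr.
Qed.

Let convex_sq (u v : V) t : 0 <= t -> t <= 1 ->
  g (u + t *: (v - u)) ^+ 2 <= g u ^+ 2 + t * (g v ^+ 2 - g u ^+ 2).
Proof.
move=> t0 t1.
have -> : u + t *: (v - u) = (1 - t) *: u + t *: v.
  by rewrite scalerBr scalerBl scale1r addrA addrAC.
have h : g ((1 - t) *: u + t *: v) <= (1 - t) * g u + t * g v.
  by apply: (le_trans (max_dotD _ _)); rewrite !max_dotZ// subr_ge0.
have h2 : g ((1 - t) *: u + t *: v) ^+ 2 <= ((1 - t) * g u + t * g v) ^+ 2.
  by rewrite lerXn2r ?nnegrE ?max_dot_ge0// (le_trans _ h) ?max_dot_ge0.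
apply: (le_trans h2); rewrite -subr_ge0.
rewrite (_ : _ - _ = t * ((1 - t) * (g u - g v) ^+ 2)); last by ring.
by rewrite mulr_ge0// mulr_ge0 ?sqr_ge0// subr_ge0.
Qed.

(* The two pairs are read off the minimiser of the strongly convex function [Phi]. *)
Lemma subgrad_split : exists y1 e1 y2 e2, [/\ subgrad y1 e1, subgrad y2 e2,
  x = (y1 + eps *: e1) + (y2 + eps *: e2) & xi = (e1 + eps *: y1) - (e2 + eps *: y2)].
Proof.
have [a [b Hab]] := Phi_min.
exists (2^-1 *: (x - eps *: (a + b) + eps^-1 *: (xi - a + b))), a.
exists (2^-1 *: (x - eps *: (a + b) - eps^-1 *: (xi - a + b))), b.
have en : eps != 0 by rewrite gt_eqF.
split.
- move=> v; rewrite -lerBrDl.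
  (* Minimality on the segment from [a] towards [v], divided by its parameter [t], gives the
     inequality up to a term of order [t]. *)
  apply: (@le_limit0 _ _ _ (eps / 4 * sq (v - a) + sq (v - a) / (4 * eps)) 1) => // t t0 t1.
  have h := Hab (a + t *: (v - a)) b; have c := convex_sq a v (ltW t0) t1.
  rewrite -(ler_pM2l t0).
  have -> : t * dotrV (2^-1 *: (x - eps *: (a + b) + eps^-1 *: (xi - a + b))) (v - a) =
    Phi a b - Phi (a + t *: (v - a)) b + (g (a + t *: (v - a)) ^+ 2 / 2 - g a ^+ 2 / 2)
     + t * (t * (eps / 4 * sq (v - a) + sq (v - a) / (4 * eps))).
    rewrite /Phi; move: (v - a) => u.
    rewrite !(dotDl, dotDr, dotNl, dotNr, dotZl, dotZr) (dotC b a) (dotC xi a) (dotC xi b) ?(dotC u a) ?(dotC u b) ?(dotC u xi).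
    by field.
  by lra.
- move=> v; rewrite -lerBrDl.
  apply: (@le_limit0 _ _ _ (eps / 4 * sq (v - b) + sq (v - b) / (4 * eps)) 1) => // t t0 t1.
  have h := Hab a (b + t *: (v - b)); have c := convex_sq b v (ltW t0) t1.
  rewrite -(ler_pM2l t0).
  have -> : t * dotrV (2^-1 *: (x - eps *: (a + b) - eps^-1 *: (xi - a + b))) (v - b) =
    Phi a b - Phi a (b + t *: (v - b)) + (g (b + t *: (v - b)) ^+ 2 / 2 - g b ^+ 2 / 2)
     + t * (t * (eps / 4 * sq (v - b) + sq (v - b) / (4 * eps))).
    rewrite /Phi; move: (v - b) => u.
    rewrite !(dotDl, dotDr, dotNl, dotNr, dotZl, dotZr) (dotC b a) (dotC xi a) (dotC xi b) ?(dotC u a) ?(dotC u b) ?(dotC u xi).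
    by field.
  by lra.
- by apply/rowP => i; rewrite !mxE; field.
- by apply/rowP => i; rewrite !mxE; field.
Qed.

End split_existence.

End polytope.

(** Disposes of the dilation factors that remain after approximation. Positivity of [N] rules out
    [F = 0], and with it the product of 0 and infinity. *)
Lemma ereal_limit_pow (R : realType) (N F : R) (T : \bar R) m : 0 < N -> 0 <= F -> (0 <= T)%E ->
  (forall d, 0 < d -> d <= 1 -> (N%:E <= F%:E * (((1 + d) ^+ m)%:E * T))%E) ->
  (N%:E <= F%:E * T)%E.
Proof.
move=> N0 F0 T0 H.
have {}F0 : 0 < F.
  rewrite lt_def F0 andbT; apply/eqP => F00.
  by have := H 1 ltr01 (lexx _); rewrite F00 mul0e lee_fin leNgt N0.
case: T T0 H => [t|_ _|//]; last by rewrite gt0_muley ?lte_fin// leey.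
rewrite lee_fin => t0 H; rewrite -EFinM lee_fin.
apply: (@le_limit0 _ _ _ (N * m%:R) 1) => // d d0 d1.
have := H d d0 d1; rewrite -!EFinM lee_fin => h.
have h1 := bernoulli_sub m (ltW d0) d1.
have h2 : (1 + d) ^+ m * (1 - d) ^+ m <= 1.
  rewrite -exprMn exprn_ile1//; last by rewrite (_ : _ * _ = 1 - d ^+ 2); [rewrite gerBl sqr_ge0|ring].
  by rewrite mulr_ge0//; lra.
have h3 := ler_wpM2l (ltW N0) h1.
have d2 : 0 <= (1 - d) ^+ m by rewrite exprn_ge0//; lra.
have h4 := ler_wpM2r d2 h.
have h5 := ler_wpM2l (mulr_ge0 (ltW F0) t0) h2.
lra.
Qed.

(** * The volume inequality for symmetric polytopes *)

Section polytope_bound.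
Variables (R : realType) (n : nat) (J : finType) (X : J -> 'rV[R]_n) (j0 : J).
Hypothesis X0 : X j0 = 0.
Notation V := 'rV[R]_n.
Notation sq x := (dotrV x x).
Notation mu := (lebesgue_rV R n).
Notation g := (max_dot X).
Notation nrm v := (Num.sqrt (sq v)).

Section thickening.
Variables (eps : R).
Hypotheses (eps0 : 0 < eps) (eps1 : eps <= 1).

(** The linear map [(y, eta) -> (y + eps eta, eta + eps y)] multiplies the symplectic form by
    [1 - eps^2], so isotropy survives, and it adds a definite term [eps (|y|^2 + |eta|^2)] to
    [<x, e>]. *)
Definition thick (x e : V) := exists y eta,
  [/\ subgrad X y eta, x = y + eps *: eta & e = eta + eps *: y].

Lemma thick_mono x e x' e' : thick x e -> thick x' e' ->
  eps / 2 * (sq (x - x') + sq (e - e')) <= dotrV (x - x') (e - e').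
Proof.
move=> [y [eta [h -> ->]]] [y' [eta' [h' -> ->]]].
have h1 := subgrad_mono h h'.
have h2 := dot_ge0 (y - y'); have h3 := dot_ge0 (eta - eta').
rewrite (_ : y + _ - _ = (y - y') + eps *: (eta - eta')); last first.
  by rewrite scalerBr opprD addrACA.
rewrite (_ : eta + _ - _ = (eta - eta') + eps *: (y - y')); last first.
  by rewrite scalerBr opprD addrACA.
move: (y - y') (eta - eta') h1 h2 h3 => u v h1 h2 h3.
rewrite !(dotDl, dotDr, dotZl, dotZr) (dotC v u) -subr_ge0.
rewrite (_ : _ - _ = (1 - eps ^+ 2) * dotrV u v + eps * (1 - eps ^+ 2) / 2 * (sq u + sq v)); last by field.
have e2 : 0 <= 1 - eps ^+ 2 by rewrite subr_ge0 expr_le1// ltW.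
have q1 := mulr_ge0 e2 h1; have q2 := mulr_ge0 (mulr_ge0 (ltW eps0) e2) (addr_ge0 h2 h3).
lra.
Qed.

(** One subspace for each of the finitely many active sets: by [subgrad_dot] the pairs over one
    active set are isotropic. *)
Lemma thick_cover : exists B : {set J} -> 'M[R]_(n, n + n),
  forall x e, thick x e -> exists A, (row_mx x e <= B A)%MS.
Proof.
pose S (A : {set J}) (v : 'rV[R]_(n + n)) := exists y eta,
  [/\ subgrad X y eta, active X eta = A & v = row_mx (y + eps *: eta) (eta + eps *: y)].
have H A : exists B : 'M[R]_(n, n + n), forall v, S A v -> (v <= B)%MS.
  apply: isotropic_cover => u v [y [eta [h a ->]]] [y' [eta' [h' a' ->]]].
  have dE (p q : V) : p *m q^T = (dotrV p q)%:M.
    by apply/rowP => i; rewrite !mxE (ord1 i)/= mulr1n; apply: eq_bigr => k _; rewrite mxE.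
  rewrite /sympl_mx mul_row_block tr_row_mx mul_row_col !mulmx0 mulmx1 mulmxN mulmx1 add0r addr0.
  rewrite mulNmx !dE; apply/rowP => i; rewrite !mxE (ord1 i) /= !mulr1n.
  have e1 : dotrV y eta' = g eta * g eta' by apply: (subgrad_dot X0 h); rewrite a a'.
  have e2 : dotrV y' eta = g eta' * g eta by apply: (subgrad_dot X0 h'); rewrite a a'.
  rewrite !(dotDl, dotDr, dotZl, dotZr) e1 (dotC eta y') e2.
  ring.
have /choice[B HB] := H; exists B => x e [y [eta [h -> ->]]].
by exists (active X eta); apply: HB; exists y, eta.
Qed.

(** As [<y, eta> = g(eta)^2], [s^2 = (1 + eps^2) g(eta)^2 + eps (|y|^2 + |eta|^2)]. Thus
    [g(eta) <= s], and the corrections [eps |y|] and [eps |eta|] are at most [sqrt eps s]. *)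
Lemma thick_bounds L x e : 0 <= L -> (forall v, g v <= L * nrm v) -> thick x e ->
  let s := Num.sqrt (dotrV x e) in
  g e <= s * (1 + Num.sqrt eps * L) /\ forall v, dotrV x v <= s * (g v + Num.sqrt eps * nrm v).
Proof.
move=> L0 gL [y [eta [h xE eE]]] s.
have sE : dotrV x e = (1 + eps ^+ 2) * g eta ^+ 2 + eps * (sq y + sq eta).
  rewrite xE eE !(dotDl, dotDr, dotZl, dotZr) (dotC eta y) (subgrad_dot X0 h)//.
  by ring.
have y0 := dot_ge0 y; have e0 := dot_ge0 eta; have g0 := max_dot_ge0 X0 eta.
have q1 : 0 <= eps ^+ 2 * g eta ^+ 2 by rewrite mulr_ge0 ?sqr_ge0.
have q2 := mulr_ge0 (ltW eps0) y0; have q3 := mulr_ge0 (ltW eps0) e0.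
have gs : g eta <= s.
  by rewrite -(ger0_norm g0) -sqrtr_sqr ler_wsqrtr// sE; lra.
have ns (z : V) : sq z = sq y \/ sq z = sq eta -> eps * nrm z <= s * Num.sqrt eps.
  move=> hz; rewrite -{1}(sqr_sqrtr (ltW eps0)) expr2 -mulrA mulrC ler_wpM2r//.
  rewrite -sqrtrM ?(ltW eps0)// ler_wsqrtr// sE; have := sqr_ge0 (g eta).
  by case: hz => ->; lra.
split=> [|v].
  rewrite {1}eE; apply: (le_trans (max_dotD X0 _ _)); rewrite (max_dotZ X0) ?(ltW eps0)//.
  rewrite mulrDr mulr1 lerD//; apply: (@le_trans _ _ (eps * (L * nrm y))).
    by apply: ler_wpM2l; [exact: ltW|exact: gL].
  by rewrite mulrCA [leRHS]mulrA [leRHS]mulrC ler_wpM2l//; apply: ns; left.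
rewrite {1}xE dotDl dotZl mulrDr; apply: lerD.
  by apply: (le_trans (subgrad_le X0 _ h)); rewrite ler_wpM2r ?(max_dot_ge0 X0).
apply: (@le_trans _ _ (eps * (nrm eta * nrm v))); first by rewrite ler_wpM2l ?dot_CS ?(ltW eps0).
by rewrite !mulrA ler_wpM2r//; apply: ns; right.
Qed.

End thickening.

Hypothesis Xsym : forall v, g (- v) = g v.
Variables (c : R).
Hypotheses (c0 : 0 < c) (gc : forall v, c * nrm v <= g v).
Variable K : set V.
Hypothesis mK : measurable K.
Hypothesis polarK : forall x, (forall v, dotrV x v <= g v) -> K x.

Lemma measurable_max_dot : measurable_fun setT g.
Proof.
apply: continuous_measurable_rV; apply: (@continuous_max_dot _ _ _ X n id) => i.
exact: coord_continuous.
Qed.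

Let G := [set v : V | g v < 1].

Let mG : measurable G.
Proof.
rewrite -[X in measurable X]setTI.
exact: (measurable_fun_ltr measurable_max_dot (measurable_cst (1 : R))).
Qed.

Lemma polytope_bound : ((n`!%:R ^+ 2 * (2 * pi) ^+ n)%R%:E <=
  ((2 * n)`!%:R * Gamma (n%:R / 2 + 1) ^+ 2)%R%:E * (mu K * mu G))%E.
Proof.
have pi0 := pi_gt0 R.
apply: (@ereal_limit_pow _ _ _ _ (n + n)).
- by rewrite mulr_gt0 ?exprn_gt0 ?mulr_gt0// ltr0n fact_gt0.
- by rewrite mulr_ge0 ?sqr_ge0.
- by rewrite mule_ge0.
move=> d d0 d1.
have [L L0 gL] := max_dot_lip X.
have L1 : 0 < L + 1 by rewrite ltr_wpDl.
(* [r] is [sqrt eps]: the bound [d c] turns the error [r |v|] into [d g(v)], and [d / (L + 1)] makes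
   [r L] at most [d]. *)
pose r := Num.min 1 (Num.min (d * c) (d / (L + 1))).
have r0 : 0 < r by rewrite !lt_min ltr01 mulr_gt0// divr_gt0.
have r1 : r <= 1 by rewrite /r ge_min lexx.
have r2 : r <= d * c by rewrite /r !ge_min lexx !orbT.
have r3 : r * L <= d.
  have : r * (L + 1) <= d by rewrite -ler_pdivlMr// /r !ge_min lexx !orbT.
  lra.
pose eps := r ^+ 2.
have eps0 : 0 < eps by rewrite exprn_gt0.
have eps1 : eps <= 1 by rewrite expr_le1// ltW.
have seps : Num.sqrt eps = r by rewrite sqrtr_sqr ger0_norm// ltW.
have h20 : 0 < eps / 2 by rewrite divr_gt0.
have U0 : thick eps 0 0.
  by exists 0, 0; rewrite !scaler0 !addr0; split => //; exact: subgrad0 X0.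
have US s x e : 0 < s -> thick eps x e -> thick eps (s *: x) (s *: e).
  move=> s0 [y [eta [h -> ->]]]; exists (s *: y), (s *: eta); split.
  - exact: (subgradZ X0).
  - by rewrite scalerDr !scalerA mulrC.
  - by rewrite scalerDr !scalerA mulrC.
have UM := thick_mono eps0 eps1.
have Usurj x xi : exists x1 e1 x2 e2,
    [/\ thick eps x1 e1, thick eps x2 e2, x = x1 + x2 & xi = e1 - e2].
  have [y1 [e1 [y2 [e2 [h1 h2 -> ->]]]]] := subgrad_split X0 x xi eps0 eps1.
  exists (y1 + eps *: e1), (e1 + eps *: y1), (y2 + eps *: e2), (e2 + eps *: y2).
  by split => //; [exists y1, e1|exists y2, e2].
have [B HB] := thick_cover eps.
have main := split_diamond_ge h20 U0 US UM Usurj HB.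
apply: (le_trans main).
apply: lee_wpmul2l; first by rewrite lee_fin mulr_ge0 ?sqr_ge0.
have d1' : 0 < 1 + d by rewrite addr_gt0.
have di : 0 < (1 + d)^-1 by rewrite invr_gt0.
have [_ Hs] := scales_lebE_scale n di di.
have mKG : measurable (K `*` G) by exact: measurableX.
have := Hs _ mKG; rewrite !invrK -exprD.
rewrite [X in _ = (_ * X)%E](_ : _ = mu K * mu G)%E; last by rewrite lebEE product_measure1E.
move=> <-.
have [m1 m2 m3 m4] := measurable_split h20 UM Usurj.
have [mA mB ma mb mD] := measurable_split_forms h20 UM Usurj.
apply: le_measure; rewrite ?inE.
- rewrite -[X in measurable X]setTI.
  apply: (measurable_fun_ltr _ (measurable_cst (1 : R))) => //.
  by apply: measurable_addf; apply: measurable_sqrtf.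
- have [mS _] := scales_lebE_scale n di di.
  by rewrite -[X in measurable X]setTI; exact: mS.
move=> w /= hw.
have [u1 u2 wx we] := split_ptP Usurj w.
have [a1 b1] := thick_bounds eps0 L0 gL u1.
have [a2 b2] := thick_bounds eps0 L0 gL u2.
rewrite seps in a1 b1 a2 b2.
set s1 := Num.sqrt _ in a1 b1; set s2 := Num.sqrt _ in a2 b2.
have hs : s1 + s2 < 1 by [].
have s10 : 0 <= s1 by rewrite sqrtr_ge0.
have s20 : 0 <= s2 by rewrite sqrtr_ge0.
split; rewrite /G/=.
  apply: polarK => v; rewrite dotZl -ler_pdivlMl ?invrK//.
  rewrite {1}wx dotDl.
  have g0 := max_dot_ge0 X0 v.
  have hv : g v + r * nrm v <= (1 + d) * g v.
    have := ler_wpM2r (sqrtr_ge0 (sq v)) r2; have := ler_wpM2l (ltW d0) (gc v); lra.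
  apply: (le_trans (lerD (b1 v) (b2 v))); rewrite -mulrDl.
  have hv0 : 0 <= g v + r * nrm v by rewrite addr_ge0// mulr_ge0// ltW.
  apply: le_trans hv; rewrite ler_piMl// ltW//.
rewrite (max_dotZ X0) ?(ltW di)// mulrC ltr_pdivrMr// mul1r.
(* The evenness of [g] is used here, for [e = e1 - e2]. *)
rewrite {1}we; apply: (le_lt_trans (max_dotD X0 _ _)); rewrite Xsym.
apply: (le_lt_trans (lerD a1 a2)); rewrite -mulrDl.
have rL : 1 + r * L <= 1 + d by rewrite lerD2l.
have rL0 : 0 < 1 + r * L by rewrite ltr_wpDr ?mulr_ge0// ltW.
apply: lt_le_trans rL; by rewrite gtr_pMl.
Qed.

End polytope_bound.

(** * Separation of convex sets *)

Section hahn_banach.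
Variables (R : realType) (n : nat).
Notation V := 'rV[R]_n.

Definition sublinear (p : V -> R) :=
  (forall x y, p (x + y) <= p x + p y) /\ (forall r x, 0 < r -> p (r *: x) = r * p x).

Lemma sublinear0 p : sublinear p -> p 0 = 0.
Proof. by case=> _ /(_ 2 0 (ltr0Sn _ _)); rewrite scaler0 => h; lra. Qed.

Lemma sublinearZ p r x : sublinear p -> 0 <= r -> p (r *: x) = r * p x.
Proof.
move=> sp; rewrite le_eqVlt => /predU1P[<-|r0]; first by rewrite scale0r mul0r sublinear0.
by case: sp => _ ->.
Qed.

Lemma sublinear_ge p x : sublinear p -> - p (- x) <= p x.
Proof. by move=> sp; have [/(_ x (- x)) + _] := sp; rewrite subrr sublinear0//; lra. Qed.

Section along.
Variables (p : V -> R) (e : V).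
Hypothesis sp : sublinear p.

Let S v := [set z : R | exists2 t, 0 <= t & z = p (v + t *: e) - t * p e].
Let q v := inf (S v).

Let Slb v : lbound (S v) (- p (- v)).
Proof.
move=> z [t t0 ->]; have [pD _] := sp.
have := pD (v + t *: e) (- v); rewrite addrAC subrr add0r sublinearZ//; lra.
Qed.

Let qle v t : 0 <= t -> q v <= p (v + t *: e) - t * p e.
Proof. by move=> t0; apply: ge_inf; [exists (- p (- v))|exists t]. Qed.

Let leq v a : (forall t, 0 <= t -> a <= p (v + t *: e) - t * p e) -> a <= q v.
Proof.
move=> H; apply: lb_le_inf; first by exists (p (v + 0 *: e) - 0 * p e), 0.
by move=> z [t t0 ->]; exact: H.
Qed.

(* [q0 v = inf_(t >= 0) (p (v + t e) - t p e)] is linear along [e]. *)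
Lemma hahn_banach_step : exists q0, [/\ sublinear q0, forall v, q0 v <= p v,
  q0 (- e) = - q0 e, q0 e = p e & forall d, p (- d) = - p d -> q0 d = p d /\ q0 (- d) = - q0 d].
Proof.
have [pD _] := sp.
have qp v : q v <= p v by have := @qle v 0 (lexx _); rewrite scale0r mul0r addr0 subr0.
have qD u v : q (u + v) <= q u + q v.
  rewrite -lerBlDl; apply: leq => t t0; rewrite lerBlDl -lerBlDr; apply: leq => s s0.
  rewrite lerBlDr; have := @qle (u + v) (s + t) (addr_ge0 s0 t0).
  have := pD (u + s *: e) (v + t *: e); rewrite addrACA -scalerDl; lra.
have qZ r v : 0 < r -> q (r *: v) = r * q v.
  have h s w : 0 < s -> s * q w <= q (s *: w).
    move=> s0; apply: leq => t t0; have [_ pZ] := sp.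
    have -> : p (s *: w + t *: e) - t * p e = s * (p (w + (s^-1 * t) *: e) - (s^-1 * t) * p e).
      by rewrite mulrBr -(pZ s (w + _) s0) scalerDr scalerA !mulrA mulfV ?gt_eqF// !mul1r.
    by rewrite ler_pM2l//; apply: qle; rewrite mulr_ge0// invr_ge0 ltW.
  move=> r0; apply/eqP; rewrite eq_le h// andbT.
  rewrite -ler_pdivrMl//; have := h r^-1 (r *: v).
  by rewrite invr_gt0 scalerA mulVf ?scale1r ?gt_eqF// => /(_ r0).
have sq : sublinear q by split.
have qe : q (- e) = - q e.
  have h := @qle (- e) 1 ler01; rewrite scale1r mul1r addNr sublinear0// in h.
  have h1 := qp e; have := sublinear_ge (- e) sq; rewrite opprK => h2.
  have h3 := sublinear_ge e sq; lra.
have qe' : q e = p e.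
  have h := @qle (- e) 1 ler01; rewrite scale1r mul1r addNr sublinear0// in h.
  by have := qp e; lra.
exists q; split => // d dd.
have h1 := qp d; have := qp (- d); have := sublinear_ge d sq; rewrite dd; split; lra.
Qed.

End along.

(** The step along [y0] comes first and fixes the value there; the steps along the basis vectors
    then preserve it. A sublinear function that is odd along a basis is linear. *)
Lemma hahn_banach p (y0 : V) : sublinear p ->
  exists2 z, forall v, dotrV z v <= p v & dotrV z y0 = p y0.
Proof.
move=> sp.
have [q1 [sq1 q1p q1N q1y _]] := hahn_banach_step y0 sp.
have H (s : seq V) : exists q, [/\ sublinear q, forall v, q v <= p v,
   forall e, e \in s -> q (- e) = - q e, q (- y0) = - q y0 & q y0 = p y0].
  elim: s => [|e s [q [sq qp qs qN qy]]]; first by exists q1.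
  have [q2 [sq2 q2q q2N _ q2L]] := hahn_banach_step e sq.
  have [q2y q2yN] := q2L _ qN.
  exists q2; split => //; last by rewrite q2y.
  - by move=> v; exact: le_trans (q2q v) (qp v).
  - move=> e'; rewrite inE => /predU1P[->//|/qs h]; exact: (q2L _ h).2.
have [q [sq qp qs _ qy]] := H [seq delta_mx ord0 i | i <- enum 'I_n].
have qN i : q (- delta_mx ord0 i) = - q (delta_mx ord0 i) by apply: qs; apply: map_f; rewrite mem_enum.
pose z : V := \row_i q (delta_mx ord0 i).
have qz v : q v <= dotrV z v.
  rewrite {1}(row_sum_delta v) /dotrV.
  elim/big_ind2 : _ => [|x1 x2 y1 y2 h1 h2|i _]; first by rewrite sublinear0.
    by have [/(_ x2 y2) + _] := sq; lra.
  rewrite mxE; have [v0|v0] := leP 0 (v ord0 i); first by rewrite sublinearZ// mulrC.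
  rewrite -[v ord0 i]opprK scaleNr -scalerN sublinearZ//; last by rewrite oppr_ge0 ltW.
  by rewrite qN; lra.
have zq v : dotrV z v = q v.
  apply/eqP; rewrite eq_le qz andbT; apply: le_trans (sublinear_ge v sq).
  by have := qz (- v); rewrite dotNr; lra.
by exists z => [v|]; rewrite zq.
Qed.

Section separation.
Variable K : set V.
Hypotheses (openK : open K) (K0 : K 0).
Hypothesis convK : forall x y t, 0 <= t -> t <= 1 -> K x -> K y -> K (t *: x + (1 - t) *: y).

(** [p] below is the Minkowski gauge of [K]. *)
Let S v := [set t : R | 0 < t /\ K (t^-1 *: v)].
Let p v := inf (S v).

Lemma open_absorb v x : K x -> exists2 d, 0 < d & forall t, 0 <= t -> t <= d -> K (x + t *: v).
Proof.
move=> Kx; have /nbhs_ballP[e /= e0 eK] := open_nbhs_nbhs (conj openK Kx).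
have v1 : 0 < `|v| + 1 by rewrite ltr_wpDl.
exists (e / (`|v| + 1) / 2) => [|t t0 td]; first by rewrite !divr_gt0.
apply: eK; rewrite -ball_normE /= opprD addNKr normrN normrZ ger0_norm//.
apply: (@le_lt_trans _ _ (e / (`|v| + 1) / 2 * (`|v| + 1))).
  by apply: ler_pM => //; rewrite lerDl.
by rewrite mulrAC divfK ?gt_eqF// ltr_pdivrMr//; lra.
Qed.

Let Sn v : S v !=set0.
Proof.
have [d d0 H] := open_absorb v K0; exists d^-1; split; first by rewrite invr_gt0.
by have := H d (ltW d0) (lexx _); rewrite add0r invrK.
Qed.

Let Slb v : lbound (S v) 0. Proof. by move=> t [/ltW]. Qed.

Let Kscale v s : 0 <= s -> s <= 1 -> K v -> K (s *: v).
Proof. by move=> s0 s1 Kv; have := convK s0 s1 Kv K0; rewrite scaler0 addr0. Qed.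

Let ple v t : 0 < t -> K (t^-1 *: v) -> p v <= t.
Proof. by move=> t0 Kt; apply: ge_inf => //; exists 0. Qed.

Let lep v a : (forall t, 0 < t -> K (t^-1 *: v) -> a <= t) -> a <= p v.
Proof. by move=> H; apply: lb_le_inf => // t [t0 Kt]; exact: H. Qed.

(** Hahn-Banach for the gauge of [K], which is at least 1 at [w] and, [K] being open, less than 1 on
    [K]; hence the strict inequality. *)
Lemma separation w : ~ K w -> exists z, forall t, K t -> dotrV z t < dotrV z w.
Proof.
move=> nKw.
have pD u v : p (u + v) <= p u + p v.
  rewrite -lerBlDl; apply: lep => t t0 Kt; rewrite lerBlDl -lerBlDr; apply: lep => s s0 Ks.
  rewrite lerBlDr; have st : 0 < s + t by rewrite addr_gt0.
  apply: ple => //.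
  have := @convK _ _ (s / (s + t)) _ _ Ks Kt; rewrite !scalerA.
  rewrite (_ : s / (s + t) / s = (s + t)^-1); last by field; rewrite !gt_eqF.
  rewrite (_ : (1 - s / (s + t)) / t = (s + t)^-1); last by field; rewrite !gt_eqF.
  rewrite scalerDr; apply; first by rewrite divr_ge0// ltW.
  by rewrite ler_pdivrMr// mul1r lerDl ltW.
have pZ r v : 0 < r -> p (r *: v) = r * p v.
  have h s u : 0 < s -> s * p u <= p (s *: u).
    move=> s0; apply: lep => t t0 Kt; rewrite -ler_pdivlMl//; apply: ple.
      by rewrite mulr_gt0// invr_gt0.
    by rewrite invfM invrK mulrC -scalerA.
  move=> r0; apply/eqP; rewrite eq_le h// andbT -ler_pdivrMl//; have := h r^-1 (r *: v).
  by rewrite invr_gt0 scalerA mulVf ?scale1r ?gt_eqF// => /(_ r0).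
have [z zp zw] := hahn_banach w (conj pD pZ).
exists z => t Kt; rewrite zw; apply: (@lt_le_trans _ _ 1).
  have [d d0 H] := open_absorb t Kt; have d1 : 0 < 1 + d by rewrite addr_gt0.
  apply: (le_lt_trans (zp t)); apply: (@le_lt_trans _ _ (1 + d)^-1).
    apply: ple; first by rewrite invr_gt0.
    by rewrite invrK scalerDl scale1r; apply: H => //; exact: ltW.
  by rewrite invf_lt1// ltrDl.
apply: lep => t1 t10 Kt1; rewrite leNgt; apply/negP => t11; apply: nKw.
have := Kscale (ltW t10) (ltW t11) Kt1.
by rewrite scalerA mulfV ?scale1r// gt_eqF.
Qed.

End separation.

End hahn_banach.

(** * The Mahler type inequality *)

Section rogers_shephard.
Variables (R : realType) (n : nat).
Notation V := 'rV[R]_n.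
Notation mu := (lebesgue_rV R n).
Local Open Scope ereal_scope.

Lemma lebesgue_rV_int_shift (F : V -> \bar R) (c : V) : measurable_fun setT F ->
  (forall x, 0 <= F x) -> \int[mu]_x F (x + c)%R = \int[mu]_x F x.
Proof.
move=> mF F0; have [ms Hs] := scales_rV_shift c.
by rewrite (scaled_measure_integral ms ler01 Hs mF F0) mul1e.
Qed.

Lemma lebesgue_rV_int_opp (F : V -> \bar R) : measurable_fun setT F ->
  (forall x, 0 <= F x) -> \int[mu]_x F (- x)%R = \int[mu]_x F x.
Proof.
move=> mF F0; have [ms Hs] := scales_rV_opp R n.
by rewrite (scaled_measure_integral ms ler01 Hs mF F0) mul1e.
Qed.

Lemma lebesgue_rV_int_scale (F : V -> \bar R) (r : R) : (0 < r)%R -> measurable_fun setT F ->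
  (forall x, 0 <= F x) -> \int[mu]_x F (r *: x)%R = (r^-1 ^+ n)%:E * \int[mu]_x F x.
Proof.
move=> r0 mF F0; have [ms Hs] := scales_rV_scale n r0.
by rewrite (scaled_measure_integral ms _ Hs mF F0)// exprn_ge0// invr_ge0 ltW.
Qed.

(* For [y = a + b], the convolution [int e^(-h c) e^(-h (c - y)) dc], translated by [a], is at least
   [e^(-g y) int e^(-2 h)]; its integral over [y] is [(int e^(-h))^2]. *)
Lemma rogers_shephard (h g : V -> R) : measurable_fun setT h -> measurable_fun setT g ->
  (forall x y, (h (x + y) <= h x + h y)%R) -> (forall x, h (2 *: x) = 2 * h x)%R ->
  (forall y, exists a b, y = a + b /\ (h a + h (- b) <= g y))%R ->
  0 < \int[mu]_x (expR (- h x))%:E ->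
  \int[mu]_y (expR (- g y))%:E <= (2 ^+ n)%R%:E * \int[mu]_x (expR (- h x))%:E.
Proof.
move=> mh mg hD h2 hg; set N := \int[mu]_x (expR (- h x))%:E => N0.
have mF : measurable_fun setT (fun x : V => (expR (- h x))%:E) by measurability.
have mG : measurable_fun setT (fun x : V => (expR (- g x))%:E) by measurability.
have F0 x : 0 <= (expR (- h x))%:E by rewrite lee_fin expR_ge0.
have [Noo|Nfin] := eqVneq N +oo.
  by rewrite Noo gt0_muley ?lte_fin ?exprn_gt0// leey.
have fN : N \is a fin_num by rewrite ge0_fin_numE ?ltey// ltW.
have conv y : (expR (- g y))%:E * ((2^-1 ^+ n)%R%:E * N) <=
    \int[mu]_c (expR (- (h c + h (c - y))))%:E.
  have [a [b [yab hab]]] := hg y.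
  rewrite -(lebesgue_rV_int_shift (F := fun c => (expR (- (h c + h (c - y))))%:E) a); last 2 first.
  - apply/measurable_EFinP; apply: measurable_exp; apply: measurable_oppf; apply: measurable_addf => //.
    by apply: (measurableT_comp mh); apply: measurable_rV_add; [exact: measurable_id|exact: measurable_cst].
  - by move=> x; rewrite lee_fin expR_ge0.
  rewrite -lebesgue_rV_int_scale// -ge0_integralZl//; last first.
    by apply: (measurableT_comp mF); measurability.
  apply: ge0_le_integral => //.
  - by apply: measurable_funeM; apply: (measurableT_comp mF); measurability.
  - apply/measurable_EFinP; apply: measurable_exp; apply: measurable_oppf; apply: measurable_addf.
      by apply: (measurableT_comp mh); measurability.
    by apply: (measurableT_comp mh); measurability.
  move=> c _; rewrite -EFinM lee_fin -expRD ler_expR h2.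
  have -> : (c + a - y = c - b)%R by rewrite yab opprD addrA addrK.
  by have := hD c a; have := hD c (- b)%R; lra.
have mH : measurable_fun setT (fun w : V * V => (expR (- (h w.2 + h (w.2 - w.1))))%:E).
  apply/measurable_EFinP; apply: measurable_exp; apply: measurable_oppf; apply: measurable_addf.
    by apply: (measurableT_comp mh); measurability.
  by apply: (measurableT_comp mh); measurability.
have : \int[mu]_y ((expR (- g y))%:E * ((2^-1 ^+ n)%R%:E * N)) <=
   \int[mu]_y \int[mu]_c (expR (- (h c + h (c - y))))%:E.
  apply: ge0_le_integral => //.
  - by move=> x _; rewrite !mule_ge0 ?lee_fin ?expR_ge0 ?exprn_ge0 ?(ltW N0)// invr_ge0.
  - by apply: emeasurable_funM => //; exact: measurable_cst.
  - by apply: (@measurable_fun_fubini_tonelli_F _ _ _ _ _ mu _ mH) => w; rewrite lee_fin expR_ge0.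
rewrite (@fubini_tonelli _ _ _ _ _ mu mu _ mH); last by move=> w; rewrite lee_fin expR_ge0.
rewrite ge0_integralZr//; last by rewrite mule_ge0 ?(ltW N0)// lee_fin exprn_ge0 ?invr_ge0.
have -> : \int[mu]_x \int[mu]_y (expR (- (h x + h (x - y))))%:E = N * N.
  transitivity (\int[mu]_x ((expR (- h x))%:E * N)).
    apply: eq_integral => x _.
    transitivity (\int[mu]_y ((expR (- h x))%:E * (expR (- h (- y + x)))%:E)).
      by apply: eq_integral => y _; rewrite -EFinM -expRD -opprD (addrC x).
    have mS : measurable_fun setT (fun y : V => (expR (- h (y + x)))%:E).
      by apply: (measurableT_comp mF); measurability.
    rewrite ge0_integralZl//; last by apply: (measurableT_comp mS); measurability.
    rewrite (lebesgue_rV_int_opp mS); last by move=> y; rewrite lee_fin expR_ge0.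
    by rewrite (lebesgue_rV_int_shift x mF F0).
  by rewrite ge0_integralZr// ltW.
rewrite muleA; rewrite -(fineK fN) in N0 *; rewrite lte_fin in N0.
rewrite lee_pmul2r// => h3.
have p2 : (0 < 2 ^+ n :> R)%R by rewrite exprn_gt0.
by rewrite exprVn lee_pdivrMr// muleC in h3.
Qed.

End rogers_shephard.

Lemma open_nrm_ball (R : realType) n (B : set 'rV[R]_n) : open B -> B 0 ->
  exists2 r, 0 < r & forall v, Num.sqrt (dotrV v v) <= r -> B v.
Proof.
move=> oB B0; have /nbhs_ballP[e /= e0 eB] := open_nbhs_nbhs (conj oB B0).
exists (e / 2); first by rewrite divr_gt0.
move=> v hv; apply: eB; rewrite -ball_normE /= sub0r normrN.
have vn : `|v| <= e / 2 by apply: le_trans hv; rewrite -[leLHS]ger0_norm// -sqrtr_sqr ler_wsqrtr// norm_sq_le.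
by apply: (le_lt_trans vn); rewrite ltr_pdivrMr//; lra.
Qed.

Section net.
Variables (R : realType) (n : nat).
Notation V := 'rV[R]_n.
Notation nrm v := (Num.sqrt (dotrV v v)).

Lemma sq_le_coord (x : V) (s : R) : 0 <= s -> (forall i, `|x ord0 i| <= s) ->
  nrm x <= (n%:R + 1) * s.
Proof.
move=> s0 H; have n1 : 0 <= n%:R + 1 :> R by rewrite addr_ge0.
rewrite -[leRHS]ger0_norm ?mulr_ge0// -sqrtr_sqr ler_wsqrtr//.
apply: (@le_trans _ _ (n%:R * s ^+ 2)).
  rewrite /dotrV (@le_trans _ _ (\sum_(i < n) s ^+ 2))//.
    by apply: ler_sum => i _; rewrite -expr2 -(real_normK (num_real _)) lerXn2r ?nnegrE.
  by rewrite sumr_const card_ord -[leLHS]mulr_natl.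
rewrite exprMn ler_wpM2r ?sqr_ge0//.
have := sqr_ge0 (n%:R : R); have : 0 <= n%:R :> R by []; lra.
Qed.

(** The cube of half-side [B] is cut into cells of side [d / (n + 1)], and each cell that meets [M]
    is represented by one of its points in [M]. Empty cells receive 0, so that the net stays in
    [M]. *)
Lemma finite_net (M : set V) (B d : R) : 0 < d -> M 0 -> (forall m, M m -> nrm m <= B) ->
  exists (J : finType) (Y : J -> V), (forall j, M (Y j)) /\
    forall m, M m -> exists j, nrm (m - Y j) <= d.
Proof.
move=> d0 M0 MB.
have n1 : 0 < n%:R + 1 :> R by rewrite ltr_wpDl.
pose s := d / (n%:R + 1); have s0 : 0 < s by rewrite divr_gt0.
pose N := Num.truncn (2 * B / s).
pose u (m : V) i := (m ord0 i + B) / s.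
pose cell (m : V) : {ffun 'I_n -> 'I_N.+1} := [ffun i => inord (Num.truncn (u m i))].
have hB m i : M m -> `|m ord0 i| <= B.
  by move=> /MB; apply: le_trans; rewrite -sqrtr_sqr ler_wsqrtr// coord_le_sq.
have u0 m i : M m -> 0 <= u m i.
  by move=> /(hB _ i); rewrite ler_norml => /andP[h _]; rewrite divr_ge0 ?(ltW s0)//; lra.
have uN m i : M m -> (Num.truncn (u m i) <= N)%N.
  move=> /(hB _ i); rewrite ler_norml => /andP[_ h]; apply: le_truncn.
  by rewrite ler_wpM2r ?invr_ge0 ?(ltW s0)//; lra.
have /choice[Y HY] (c : {ffun 'I_n -> 'I_N.+1}) : exists y, M y /\ ((exists2 m, M m & cell m = c) -> cell y = c).
  have [[m Mm mc]|no] := pselect (exists2 m, M m & cell m = c); first by exists m.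
  by exists 0; split.
exists {ffun 'I_n -> 'I_N.+1}, Y; split=> [j|m Mm]; first by have [] := HY j.
exists (cell m); have [MY YE] := HY (cell m).
have {}YE := YE (ex_intro2 _ _ m Mm erefl).
apply: (@le_trans _ _ ((n%:R + 1) * s)); last by rewrite mulrC divfK// gt_eqF.
apply: sq_le_coord; first exact: ltW.
move=> i; move: YE => /(congr1 (fun f : {ffun 'I_n -> 'I_N.+1} => nat_of_ord (f i))).
rewrite !ffunE /= !inordK ?ltnS ?uN// => tE.
have /andP[a1 a2] := truncn_itv (u0 _ i Mm); have /andP[b1 b2] := truncn_itv (u0 _ i MY).
rewrite tE in b1 b2.
have : `|u m i - u (Y (cell m)) i| <= 1.
  rewrite ler_norml; move: a2 b2; rewrite -!natr1 => a2 b2; apply/andP; split; lra.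
rewrite /u -mulrBl normrM (ger0_norm (x := s^-1)) ?invr_ge0 ?(ltW s0)// ler_pdivrMr// mul1r.
by rewrite !mxE opprD addrACA subrr addr0.
Qed.

End net.

(** * Support functions of bounded open convex sets *)

Section support_function.
Variables (R : realType) (n : nat) (K : set 'rV[R]_n) (B : R).
Notation V := 'rV[R]_n.
Notation nrm v := (Num.sqrt (dotrV v v)).
Hypotheses (openK : open K) (K0 : K 0).
Hypothesis convK : forall x y t, 0 <= t -> t <= 1 -> K x -> K y -> K (t *: x + (1 - t) *: y).
Hypothesis KB : forall x, K x -> nrm x <= B.

Definition supp (v : V) := sup [set dotrV t v | t in K].

Let B0 : 0 <= B. Proof. exact: le_trans (sqrtr_ge0 _) (KB K0). Qed.

Let ubK v : has_ubound [set dotrV t v | t in K].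
Proof.
exists (B * nrm v) => _ [t Kt <-]; apply: (le_trans (dot_CS _ _)).
by rewrite ler_wpM2r// KB.
Qed.

Lemma supp_ge t v : K t -> dotrV t v <= supp v.
Proof. by move=> Kt; apply: ub_le_sup; [exact: ubK|exists t]. Qed.

Lemma supp_le v a : (forall t, K t -> dotrV t v <= a) -> supp v <= a.
Proof. by move=> H; apply: ge_sup => [|_ [t Kt <-]]; [exists (dotrV 0 v), 0|exact: H]. Qed.

Lemma supp_ge0 v : 0 <= supp v.
Proof. by have := supp_ge v K0; rewrite dot0l. Qed.

Lemma suppD u v : supp (u + v) <= supp u + supp v.
Proof. by apply: supp_le => t Kt; rewrite dotDr lerD ?supp_ge. Qed.

Lemma suppZ r v : 0 < r -> supp (r *: v) = r * supp v.
Proof.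
have h s w : 0 < s -> supp (s *: w) <= s * supp w.
  by move=> s0; apply: supp_le => t Kt; rewrite dotZr ler_pM2l// supp_ge.
move=> r0; apply/eqP; rewrite eq_le h//= -ler_pdivlMl//.
by rewrite -{1}(scale1r v) -(mulVf (lt0r_neq0 r0)) -scalerA h// invr_gt0.
Qed.

Lemma supp_le_nrm v : supp v <= B * nrm v.
Proof. by apply: supp_le => t Kt; apply: (le_trans (dot_CS _ _)); rewrite ler_wpM2r// KB. Qed.

Lemma measurable_supp : measurable_fun setT supp.
Proof.
apply: (@lipschitz_measurable_rV _ _ _ (B ^+ 2)) => x y.
have h u v : supp u - supp v <= B * nrm (u - v).
  have := suppD (u - v) v; rewrite subrK; have := supp_le_nrm (u - v); lra.
have sN : dotrV (y - x) (y - x) = dotrV (x - y) (x - y) by rewrite -opprB dotNl dotNr opprK.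
have h1 := h x y; have h2 := h y x; rewrite sN in h2.
rewrite -[X in _ <= _ * X](sqr_sqrtr (dot_ge0 _)) -exprMn -real_normK ?num_real//.
rewrite lerXn2r ?nnegrE// ?mulr_ge0// ler_norml; apply/andP; split; lra.
Qed.

(** Domination by the support function places [z] in the closure of [K] only, whence the contraction
    by [s < 1]. *)
Lemma supp_polar z s : (forall v, dotrV z v <= supp v) -> 0 <= s -> s < 1 -> K (s *: z).
Proof.
move=> zh s0 s1; apply: contrapT => /(separation openK K0 convK)[v Hv].
have v0 : 0 < dotrV v (s *: z) by have := Hv _ K0; rewrite dot0r.
have : supp v <= dotrV v (s *: z) by apply: supp_le => t Kt; rewrite dotC ltW// Hv.
have := zh v; move: v0; rewrite !dotZr (dotC v z) => v0 h1 h2.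
have : 0 < dotrV z v by rewrite ltNge; apply/negP => h; have := mulr_ge0_le0 s0 h; lra.
by move=> p; have : s * dotrV z v < 1 * dotrV z v; [rewrite ltr_pM2r|lra].
Qed.

Lemma supp_int_gt0 : (0 < \int[lebesgue_rV R n]_v (expR (- supp v))%:E)%E.
Proof.
apply: (@lt_le_trans _ _ ((expR (- B ^+ 2))%:E * \int[lebesgue_rV R n]_v (expR (- (1 * dotrV v v)))%:E)%E).
  rewrite gauss_rV// -EFinM lte_fin; apply: mulr_gt0; first exact: expR_gt0.
  by rewrite exprn_gt0// sqrtr_gt0 divr_gt0// pi_gt0.
rewrite -ge0_integralZl//; last by measurability.
apply: ge0_le_integral => //.
- by apply: measurable_funeM; measurability.
- by have mh := measurable_supp; measurability.
move=> v _; rewrite -EFinM lee_fin -expRD ler_expR mul1r.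
have := supp_le_nrm v; have := sqr_ge0 (B - nrm v); have := sqr_sqrtr (dot_ge0 v); have := dot_ge0 v.
have := sqr_ge0 B; rewrite sqrrB mulr2n; lra.
Qed.

End support_function.

Section max_dot_integral.
Variables (R : realType) (n : nat) (J : finType) (X : J -> 'rV[R]_n) (j0 : J).
Hypothesis X0 : X j0 = 0.
Notation mu := (lebesgue_rV R n).
Notation g := (max_dot X).

Lemma max_dot_integral (a : R) : 0 < a ->
  (\int[mu]_v (expR (- (a * g v)))%:E = (n`!%:R * a^-1 ^+ n)%R%:E * mu [set v | (g v < 1)%R])%E.
Proof.
move=> a0; have mg := measurable_max_dot X.
have mG : measurable [set v | g v < 1].
  by rewrite -[X in measurable X]setTI; exact: (measurable_fun_ltr mg (measurable_cst (1 : R))).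
rewrite layer_cake//; last by measurability.
transitivity (\int[@lebesgue_measure R]_s ((expR (- s) * posX n s)%R%:E *
    ((a^-1 ^+ n)%:E * mu [set v | (g v < 1)%R])))%E.
  apply: eq_integral => s _; rewrite setTI EFinM -muleA; congr (_ * _)%E.
  rewrite /posX; case: (ltP 0 s) => s0; last first.
    rewrite mul0e (_ : mkset _ = set0) ?measure0//; apply/seteqP; split => v //=.
    by rewrite ltNge (le_trans s0)// mulr_ge0 ?(ltW a0)// (max_dot_ge0 X0).
  have as0 : 0 < a / s by rewrite divr_gt0.
  have [_ Hs] := scales_rV_scale n as0.
  rewrite muleA -EFinM -exprMn (_ : s * a^-1 = (a / s)^-1); last by rewrite invf_div.
  rewrite -(Hs _ mG); congr (mu _); apply/seteqP.
  by split => v /=; rewrite (max_dotZ X0) ?(ltW as0)// mulrAC ltr_pdivrMr// mul1r.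
rewrite ge0_integralZr//.
- by rewrite Gamma_nat muleA -EFinM.
- by apply/measurable_EFinP; apply: measurable_mulf; [measurability|exact: measurable_posX].
- by move=> s _; rewrite lee_fin mulr_ge0 ?expR_ge0 ?posX_ge0.
- by rewrite mule_ge0// lee_fin exprn_ge0// invr_ge0 ltW.
Qed.

End max_dot_integral.

Section mahler_bounded.
Variables (R : realType) (n : nat) (K : set 'rV[R]_n) (B : R).
Notation V := 'rV[R]_n.
Notation nrm v := (Num.sqrt (dotrV v v)).
Notation mu := (lebesgue_rV R n).
Hypotheses (openK : open K) (K0 : K 0).
Hypothesis convK : forall x y t, 0 <= t -> t <= 1 -> K x -> K y -> K (t *: x + (1 - t) *: y).
Hypothesis KB : forall x, K x -> nrm x <= B.
Notation h := (supp K).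

Let M : set V := [set x | K x /\ K (- x)].

Let ball_in : exists2 r, 0 < r & forall v, nrm v <= r -> M v.
Proof.
have [r r0 rK] := open_nrm_ball openK K0; exists r => // v hv.
by split; apply: rK => //; rewrite dotNl dotNr opprK.
Qed.

(** The support function of an intersection is an infimal convolution. Let [p y] be the infimum of
    [h a + h (a - y)]; Hahn-Banach gives [z <= p] with equality at [y], and [p v <= h v],
    [p v <= h (- v)] put [z] in the closure of [M]. So [p y <= (1 + d) g y], and the second [d] pays
    for an infimum that need not be attained. *)
Let convolution_bound (g : V -> R) (d : R) : 0 <= d ->
  (forall z y, M z -> dotrV z y <= (1 + d) * g y) -> (forall y, y != 0 -> 0 < g y) -> g 0 = 0 -> 0 < d ->
  forall y, exists a b, y = a + b /\ h a + h (- b) <= (1 + 2 * d) * g y.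
Proof.
move=> d0 Mg g0 g00 dpos y.
have [->|y0] := eqVneq y 0.
  exists 0, 0; split; first by rewrite addr0.
  have h0 : h 0 = 0.
    by have := suppZ K0 KB 0 (ltr0Sn R 1); rewrite scaler0; lra.
  by rewrite oppr0 h0 g00; lra.
pose S y := [set h a + h (a - y) | a in setT].
have lbS v : lbound (S v) 0 by move=> _ [a _ <-]; rewrite addr_ge0 ?(supp_ge0 K0 KB).
pose p v := inf (S v).
have ple v a : p v <= h a + h (a - v) by apply: ge_inf; [exists 0|exists a].
have lep v c : (forall a, c <= h a + h (a - v)) -> c <= p v.
  by move=> H; apply: lb_le_inf => [|_ [a _ <-]//]; exists (h 0 + h (0 - v)), 0.
have sp : sublinear p.
  split=> [u v|r v r0].
    rewrite -lerBlDl; apply: (lep _ _) => b; rewrite lerBlDl -lerBlDr; apply: (lep _ _) => a.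
    rewrite lerBlDr; apply: (le_trans (ple _ (a + b))).
    have := suppD K0 KB a b; have := suppD K0 KB (a - u) (b - v).
    by rewrite addrACA -opprD; lra.
  have H s w : 0 < s -> p (s *: w) <= s * p w.
    move=> s0; rewrite -ler_pdivrMl//; apply: (lep _ _) => a; rewrite ler_pdivrMl//.
    by apply: (le_trans (ple _ (s *: a))); rewrite -scalerBr !(suppZ K0 KB)// -mulrDr.
  apply/eqP; rewrite eq_le H//= -ler_pdivlMl//.
  by rewrite -{1}(scale1r v) -(mulVf (lt0r_neq0 r0)) -scalerA H// invr_gt0.
have h0 : h 0 = 0.
  by have := suppZ K0 KB 0 (ltr0Sn R 1); rewrite scaler0; lra.
have [z zp zy] := hahn_banach y sp.
have z1 v : dotrV z v <= h v.
  by apply: (le_trans (zp v)); apply: (le_trans (ple v v)); rewrite subrr h0 addr0.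
have z2 v : dotrV (- z) v <= h v.
  have := le_trans (zp (- v)) (ple (- v) 0); rewrite h0 add0r sub0r opprK.
  by rewrite dotNr dotNl.
have py : p y <= (1 + d) * g y.
  apply: (@le_limit0 _ _ _ (p y) 1) => // t t0 t1.
  have s0 : 0 <= 1 - t by rewrite subr_ge0.
  have s1 : 1 - t < 1 by rewrite gtrBl.
  have Mz : M ((1 - t) *: z).
    split; first exact: (supp_polar openK K0 convK z1 s0 s1).
    by rewrite -scalerN; exact: (supp_polar openK K0 convK z2 s0 s1).
  by have := Mg _ y Mz; rewrite dotZl zy; lra.
have pl : p y < (1 + 2 * d) * g y.
  by apply: (le_lt_trans py); rewrite ltr_pM2r ?g0//; lra.
have [a Ha] : exists a, h a + h (a - y) < (1 + 2 * d) * g y.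
  apply: contrapT => no; suff : (1 + 2 * d) * g y <= p y by rewrite leNgt pl.
  by apply: (lep _ _) => a; rewrite leNgt; apply/negP => ?; apply: no; exists a.
exists a, (y - a); split; first by rewrite addrC subrK.
by rewrite opprB ltW.
Qed.

(** [M] is approximated from inside by a symmetric polytope with [g <= h_M <= (1 + e) g].
    [polytope_bound] treats the volumes, and [rogers_shephard], fed by [convolution_bound], replaces
    the integral of [e^(- g)] by that of [e^(- h)]. *)
Lemma mahler_bounded : ((n`!%:R ^+ 3 * (2 * pi) ^+ n)%R%:E <=
  ((2 * n)`!%:R * Gamma (n%:R / 2 + 1) ^+ 2 * 2 ^+ n)%R%:E *
    (mu M * \int[mu]_v (expR (- h v))%:E))%E.
Proof.
have pi0 := pi_gt0 R.
have mM : measurable M.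
  apply: measurableI; first exact: open_measurable_rV.
  by rewrite -[X in measurable X]setTI; have [ms _] := scales_rV_opp R n; apply: ms => //; exact: open_measurable_rV.
have N0 := supp_int_gt0 K0 KB; set N := (\int[mu]_v (expR (- h v))%:E)%E in N0 *.
apply: (@ereal_limit_pow _ _ _ _ n).
- by rewrite mulr_gt0 ?exprn_gt0 ?mulr_gt0// ltr0n fact_gt0.
- by apply: mulr_ge0; [apply: mulr_ge0; [exact: ler0n|exact: sqr_ge0]|rewrite exprn_ge0].
- by rewrite mule_ge0// ltW.
move=> d d0 _.
have [r r0 rM] := ball_in.
(* With a ball of radius [r = c (1 + e)] in [M] and a net of mesh [e c], one gets
   [r |v| <= g v + e c |v|], that is [c |v| <= g v]; the mesh error is then at most [e g v]. *)
pose e := d / 2; have e0 : 0 < e by rewrite divr_gt0.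
have e1 : 0 < 1 + e by rewrite addr_gt0.
pose c := r / (1 + e); have c0 : 0 < c by rewrite divr_gt0.
have ce : c * (1 + e) = r by rewrite divfK// gt_eqF.
have ec0 : 0 < e * c by rewrite mulr_gt0.
have M0 : M 0 by split; rewrite ?oppr0.
have MB m : M m -> nrm m <= B by case=> /KB.
have [J [Y [MY netY]]] := finite_net ec0 M0 MB.
have MN m : M m -> M (- m) by case=> a b; split; rewrite ?opprK.
(* The boolean symmetrises the net and [None] adds the origin. *)
pose X (j : option (J * bool)) : V := if j is Some (j, b) then (if b then Y j else - Y j) else 0.
have X0 : X None = 0 by [].
have MX j : M (X j) by case: j => [[j []]|] //=; exact: MN.
pose g := max_dot X.
have Xsym v : g (- v) = g v.
  have H w : g (- w) <= g w.
    apply: max_dot_le => [|j]; first exact: (max_dot_ge0 X0).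
    rewrite dotNr -dotNl.
    by case: j => [[j []]|]; [exact: (max_dot_ge X (Some (j, false)))|rewrite /= opprK; exact: (max_dot_ge X (Some (j, true)))|rewrite /= oppr0; exact: (max_dot_ge X None)].
  by apply/eqP; rewrite eq_le H/=; have := H (- v); rewrite opprK.
have Mg1 m v : M m -> dotrV m v <= g v + e * c * nrm v.
  move=> Mm; have [j hj] := netY m Mm.
  have -> : m = Y j + (m - Y j) by rewrite addrC subrK.
  rewrite dotDl lerD//; first exact: (max_dot_ge X (Some (j, true))).
  by apply: (le_trans (dot_CS _ _)); rewrite ler_wpM2r.
have gc v : c * nrm v <= g v.
  have vs : dotrV v v = nrm v * nrm v by rewrite -expr2 sqr_sqrtr ?dot_ge0.
  have := sqrtr_ge0 (dotrV v v); have Mgv m := @Mg1 m v; move: vs Mgv.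
  move: (nrm v) => k vs Mgv; rewrite le_eqVlt => /predU1P[<-|k0].
    by rewrite mulr0 (max_dot_ge0 X0).
  have kn : k != 0 by rewrite gt_eqF.
  have Mm : M ((r / k) *: v).
    apply: rM; rewrite dotZl dotZr vs (_ : r / k * (r / k * (k * k)) = r ^+ 2); last by field.
    by rewrite sqrtr_sqr ger0_norm// ltW.
  have := Mgv _ Mm; rewrite dotZl vs (_ : r / k * (k * k) = r * k); last by field.
  rewrite -ce; lra.
have Mg z y : M z -> dotrV z y <= (1 + e) * g y.
  by move=> Mz; have := Mg1 z y Mz; have := ler_wpM2l (ltW e0) (gc y); lra.
(* A finite maximum keeps the separation strict, so the polar body of [g] lies in the open set [M]
   itself and not merely in its closure. *)
have glt z a : (forall t, K t -> dotrV z t < a) -> g z < a.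
  move=> H; apply/bigmax_ltP; split; first by have := H _ K0; rewrite dot0r.
  by move=> j _; rewrite dotC; apply: H; have [] := MX j.
have polM x : (forall v, dotrV x v <= g v) -> M x.
  move=> xg; split; apply: contrapT => /(separation openK K0 convK)[z Hz].
    by have := glt _ _ Hz; rewrite dotC ltNge xg.
  by have := glt _ _ Hz; rewrite dotC -Xsym dotNl -dotNr ltNge xg.
have main := polytope_bound X0 Xsym c0 gc mM polM.
have g00 : g 0 = 0.
  by have := max_dotZ X0 0 (ler0n R 2); rewrite scaler0 -/g; lra.
have gpos y : y != 0 -> 0 < g y.
  move=> y0; apply: lt_le_trans (gc y); rewrite mulr_gt0// sqrtr_gt0 lt_def dot_ge0 andbT.
  by apply: contra y0 => /eqP/dot_eq0 ->.
have dec := convolution_bound (ltW e0) Mg gpos g00 e0.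
have rs := rogers_shephard (measurable_supp K0 KB) (measurable_mulf (measurable_cst (1 + 2 * e)) (measurable_max_dot X))
  (suppD K0 KB) (fun x => suppZ K0 KB x (ltr0Sn R 1)) dec N0.
have de : 1 + 2 * e = 1 + d by rewrite /e; field.
have d1 : 0 < 1 + d by rewrite addr_gt0.
move: rs; rewrite de (max_dot_integral X0)// => rs.
have Q0 : (0 <= (n`!%:R : R)%:E)%E by rewrite lee_fin.
have dn : (0 < (1 + d) ^+ n)%R by rewrite exprn_gt0.
have rs2 : ((n`!%:R)%:E * mu [set v | (g v < 1)%R] <= ((1 + d) ^+ n * 2 ^+ n)%R%:E * N)%E.
  have := lee_wpmul2l (x := ((1 + d) ^+ n)%:E) _ rs; rewrite !muleA -!EFinM.
  rewrite mulrCA -exprMn mulfV ?gt_eqF// expr1n mulr1; apply.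
  by rewrite lee_fin ltW.
rewrite exprS -mulrA EFinM; apply: (le_trans (lee_wpmul2l Q0 main)).
set c1 := (_`!%:R * Gamma _ ^+ 2)%R; set mG := mu [set v | (max_dot X v < 1)%R].
have c10 : 0 <= c1 by apply: mulr_ge0; [exact: ler0n|exact: sqr_ge0].
have AG : (0 <= c1%:E * mu M)%E by rewrite mule_ge0// lee_fin.
rewrite [X in (X <= _)%E](_ : _ = (c1%:E * mu M) * ((n`!%:R)%:E * mG))%E; last first.
  by rewrite muleA [X in (X * _)%E]muleC muleACA.
apply: (le_trans (lee_wpmul2l AG rs2)).
rewrite muleACA -EFinM [leRHS]muleA -EFinM le_eqVlt; apply/orP; left; apply/eqP.
by congr (_%:E * _)%E; ring.
Qed.

End mahler_bounded.

(** * Passage to unbounded convex sets *)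

Section exp_norm.
Variables (R : realType) (n : nat).
Notation V := 'rV[R]_n.
Notation nrm v := (Num.sqrt (dotrV v v)).
Notation mu := (lebesgue_rV R n).

(** [r |v|] dominates [r] times the largest coordinate, which is [max_dot] of the points [r e_i] and
    [- r e_i]; its unit sublevel set lies in a cube. *)
Lemma exp_nrm_fin (r : R) : 0 < r -> (\int[mu]_v (expR (- (r * nrm v)))%:E < +oo)%E.
Proof.
move=> r0.
pose X (j : option ('I_n * bool)) : V := if j is Some (i, b) then
  (if b then r else - r) *: delta_mx ord0 i else 0.
have X0 : X None = 0 by [].
have dE i (v : V) : dotrV (delta_mx ord0 i) v = v ord0 i.
  rewrite /dotrV (bigD1 i)//= !mxE !eqxx mul1r big1 ?addr0// => j /negbTE ji.
  by rewrite !mxE ji mul0r.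
have gE i (v : V) : r * `|v ord0 i| <= max_dot X v.
  have h1 := max_dot_ge X (Some (i, true)) v; have h2 := max_dot_ge X (Some (i, false)) v.
  move: h1 h2; rewrite /= !dotZl dE mulNr.
  by case: (ler0P (v ord0 i)) => _; rewrite ?mulrN.
have gle (v : V) : max_dot X v <= r * nrm v.
  apply: max_dot_le; first by rewrite mulr_ge0// ltW.
  move=> [[i b]|]; last by rewrite X0 dot0l mulr_ge0// ltW.
  have vi : `|v ord0 i| <= nrm v by rewrite -sqrtr_sqr ler_wsqrtr// coord_le_sq.
  rewrite dotZl dE; apply: (@le_trans _ _ (r * `|v ord0 i|)); last by rewrite ler_pM2l.
  apply: (le_trans (ler_norm _)); rewrite normrM.
  by case: b; rewrite ?normrN (ger0_norm (ltW r0)).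
have mg := measurable_max_dot X.
apply: (@le_lt_trans _ _ (\int[mu]_v (expR (- (1 * max_dot X v)))%:E)%E).
  apply: ge0_le_integral => //.
  - apply/measurable_EFinP; apply: measurable_exp; apply: measurable_oppf; apply: measurable_mulf; first by measurability.
    by apply: measurable_sqrtf; measurability.
  - by measurability.
  - by move=> v _; rewrite lee_fin ler_expR lerN2 mul1r.
rewrite (max_dot_integral X0)//; rewrite invr1 expr1n mulr1; apply: lte_mul_pinfty => //.
pose A : 'I_n -> set (measurableTypeR R) := fun=> `[- r^-1, r^-1]%classic.
have mA i : measurable (A i) by exact: measurable_itv.
apply: (@le_lt_trans _ _ (mu [set x : V | forall i, A i (x ord0 i)])).
  apply: le_measure; rewrite ?inE.
  - rewrite -[X in measurable X]setTI; exact: (measurable_fun_ltr mg (measurable_cst (1 : R))).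
  - exact: measurable_box.
  move=> v /= v1 i; rewrite /A /= in_itv /= -ler_norml -[leRHS]mulr1 ler_pdivlMl//.
  exact: le_trans (gE i v) (ltW v1).
rewrite lebesgue_rV_box// ltey_eq; apply/orP; left.
elim/big_ind : _ => [//|x y hx hy|i _]; first by rewrite fin_numM.
by rewrite /A lebesgue_measure_itv /=; case: ifP.
Qed.

Lemma integrable_exp_nrm (r : R) : 0 < r ->
  mu.-integrable setT (EFin \o (fun y : V => expR (- (r * nrm y)))).
Proof.
move=> r0; have mn : measurable_fun setT (fun y : V => nrm y) by apply: measurable_sqrtf; measurability.
apply/integrableP; split; first by rewrite /comp; measurability.
under eq_integral do rewrite /= ger0_norm ?expR_ge0//.
exact: exp_nrm_fin.
Qed.

Lemma dual_vector (r : R) (v : V) : 0 <= r -> exists t : V, nrm t <= r /\ dotrV t v = r * nrm v.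
Proof.
move=> r0; have [v0|v0] := eqVneq (dotrV v v) 0.
  by exists 0; rewrite !dot0l v0 sqrtr0 mulr0.
have vp : 0 < nrm v by rewrite sqrtr_gt0 lt_def v0 dot_ge0.
exists ((r / nrm v) *: v); rewrite !(dotZl, dotZr).
have ys : dotrV v v = nrm v * nrm v by rewrite -expr2 sqr_sqrtr ?dot_ge0.
move: vp ys; move: (nrm v) => k kp ->.
have kn : k != 0 by rewrite gt_eqF.
rewrite (_ : r / k * (r / k * (k * k)) = r ^+ 2); last by field.
by rewrite sqrtr_sqr ger0_norm//; split => //; field.
Qed.

End exp_norm.

Section exp_support.
Variables (R : realType) (n : nat) (K : set 'rV[R]_n).
Notation V := 'rV[R]_n.
Notation nrm v := (Num.sqrt (dotrV v v)).
Notation mu := (lebesgue_rV R n).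
Hypotheses (openK : open K) (K0 : K 0).
Hypothesis convK : forall x y t, 0 <= t -> t <= 1 -> K x -> K y -> K (t *: x + (1 - t) *: y).

(* [e^{-h}] for the support function [h] of [K], with value 0 where [h] is infinite. *)
Definition expsupp (y : V) : R := inf [set expR (- dotrV t y) | t in K].
(** The support function where it is finite; elsewhere the logarithm of 0 yields a meaningless
    value, so the bounds on it assume [0 < expsupp y]. *)
Definition suppfin (y : V) : R := - ln (expsupp y).

Let lb0 y : lbound [set expR (- dotrV t y) | t in K] 0.
Proof. by move=> _ [t _ <-]; exact: expR_ge0. Qed.

Lemma expsupp_le t y : K t -> expsupp y <= expR (- dotrV t y).
Proof. by move=> Kt; apply: ge_inf; [exists 0; exact: lb0|exists t]. Qed.

Lemma le_expsupp y c : (forall t, K t -> c <= expR (- dotrV t y)) -> c <= expsupp y.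
Proof.
by move=> H; apply: lb_le_inf => [|_ [t Kt <-]]; [exists (expR (- dotrV 0 y)), 0|exact: H].
Qed.

Lemma expsupp_ge0 y : 0 <= expsupp y.
Proof. by apply: le_expsupp => t _; exact: expR_ge0. Qed.

Lemma expsuppE y : 0 < expsupp y -> expsupp y = expR (- suppfin y).
Proof. by move=> y0; rewrite /suppfin opprK lnK. Qed.

Lemma suppfin_ge t y : 0 < expsupp y -> K t -> dotrV t y <= suppfin y.
Proof.
move=> y0 Kt; have := expsupp_le y Kt; rewrite expsuppE// ler_expR; lra.
Qed.

Lemma suppfin_le y a : (forall t, K t -> dotrV t y <= a) -> 0 < expsupp y /\ suppfin y <= a.
Proof.
move=> H; have h : expR (- a) <= expsupp y.
  by apply: le_expsupp => t Kt; rewrite ler_expR lerN2; exact: H.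
have y0 : 0 < expsupp y by apply: lt_le_trans h; exact: expR_gt0.
by split => //; move: h; rewrite expsuppE// ler_expR; lra.
Qed.

Lemma suppfin_ge0 y : 0 < expsupp y -> 0 <= suppfin y.
Proof. by move=> y0; have := suppfin_ge y0 K0; rewrite dot0l. Qed.

Let scale_half r y : 0 < r -> 0 < expsupp y -> 0 < expsupp (r *: y) /\ suppfin (r *: y) <= r * suppfin y.
Proof.
move=> r0 y0; apply: suppfin_le => t Kt; rewrite dotZr ler_pM2l//; exact: suppfin_ge.
Qed.

Lemma expsupp_gt0Z r y : 0 < r -> (0 < expsupp (r *: y)) = (0 < expsupp y).
Proof.
move=> r0; apply/idP/idP => h; last by have [] := scale_half r0 h.
have ri : 0 < r^-1 by rewrite invr_gt0.
by have [] := scale_half ri h; rewrite scalerA mulVf ?scale1r// gt_eqF.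
Qed.

Lemma suppfinZ r y : 0 < r -> 0 < expsupp y -> suppfin (r *: y) = r * suppfin y.
Proof.
move=> r0 y0; have [ry0 h1] := scale_half r0 y0.
have ri : 0 < r^-1 by rewrite invr_gt0.
have [_] := scale_half ri ry0; rewrite scalerA mulVf ?scale1r ?gt_eqF// => h2.
by apply/eqP; rewrite eq_le h1/= -ler_pdivlMl.
Qed.

(** Truncations to balls, to which the bounded case applies; they exhaust [K], so their [e^(- supp)]
    tends to [expsupp]. *)
Let Kc (k : nat) : set V := K `&` [set x | dotrV x x < k.+1%:R].

Let openKc k : open (Kc k).
Proof.
apply: openI => //.
have c : continuous (fun x : V => dotrV x x).
  by apply: (@continuous_dotf _ _ _ id id) => i; exact: coord_continuous.
by move/continuousP : c => /(_ [set t | t < k.+1%:R]); apply; exact: open_lt.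
Qed.

Let Kc0 k : Kc k 0. Proof. by split => //=; rewrite dot0l. Qed.

Let convKc k x y t : 0 <= t -> t <= 1 -> Kc k x -> Kc k y -> Kc k (t *: x + (1 - t) *: y).
Proof.
move=> t0 t1 [Kx /= xk] [Ky /= yk]; split => /=; first exact: convK.
have h : dotrV (t *: x + (1 - t) *: y) (t *: x + (1 - t) *: y) <= t * dotrV x x + (1 - t) * dotrV y y.
  rewrite -subr_ge0 (_ : _ - _ = t * (1 - t) * dotrV (x - y) (x - y)).
    by rewrite !mulr_ge0 ?dot_ge0// subr_ge0.
  rewrite !(dotDl, dotDr, dotNl, dotNr, dotZl, dotZr) (dotC y x); ring.
apply: (le_lt_trans h); have [->|tn0] := eqVneq t 0; first by rewrite mul0r subr0 mul1r add0r.
have tp : 0 < t by rewrite lt_def tn0.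
have h1 : t * dotrV x x < t * k.+1%:R by rewrite ltr_pM2l.
have h2 : (1 - t) * dotrV y y <= (1 - t) * k.+1%:R by rewrite ler_wpM2l ?subr_ge0// ltW.
lra.
Qed.

Let KcB k x : Kc k x -> nrm x <= Num.sqrt k.+1%:R.
Proof. by move=> [_ /= xk]; rewrite ler_wsqrtr// ltW. Qed.

Let expsupp_le_c k y : expsupp y <= expR (- supp (Kc k) y).
Proof.
have [y0|] := ltP 0 (expsupp y); last by move=> h; apply: (le_trans h); exact: expR_ge0.
rewrite expsuppE// ler_expR lerN2; apply: (supp_le (Kc0 k)) => t [Kt _]; exact: suppfin_ge.
Qed.

Let cvg_expsupp y : expR (- supp (Kc k) y) @[k --> \oo] --> expsupp y.
Proof.
apply/(@cvgrPdist_lt _ R^o) => e e0.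
have [_ [t Kt <-] te] := @inf_adherent R [set expR (- dotrV t y) | t in K] e e0
  (conj (ex_intro _ _ (ex_intro2 _ _ 0 K0 erefl)) (ex_intro _ 0 (@lb0 y))).
near=> k; rewrite distrC ger0_norm ?subr_ge0// ltrBlDl.
apply: le_lt_trans te; rewrite ler_expR lerN2; apply: (supp_ge (@KcB k)).
split => //=.
have /andP[_ h] := truncn_itv (dot_ge0 t).
apply: (lt_le_trans h); rewrite ler_nat ltnS.
by near: k; exact: nbhs_infty_ge.
Unshelve. all: by end_near. Qed.

Lemma measurable_expsupp : measurable_fun setT expsupp.
Proof.
apply: (measurable_fun_cvg (h := fun k y => expR (- supp (Kc k) y))); last by move=> y _; exact: cvg_expsupp.
by move=> k; have mh := measurable_supp (Kc0 k) (@KcB k); measurability.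
Qed.

Lemma measurable_suppfin : measurable_fun setT suppfin.
Proof. apply: measurable_oppf; apply: measurableT_comp measurable_expsupp; exact: measurable_ln. Qed.

Lemma suppfin_nrm : exists2 r, 0 < r & forall y, 0 < expsupp y -> r * nrm y <= suppfin y.
Proof.
have [r r0 rK] := open_nrm_ball openK K0; exists r => // y y0.
have [t [tr <-]] := dual_vector y (ltW r0).
exact: suppfin_ge y0 (rK _ tr).
Qed.

Let M : set V := [set x | K x /\ K (- x)].

(** The bounded case for each truncation, with its symmetric part enlarged to [M], followed by
    dominated convergence. A ball inside [Kc 0] lies in every truncation and supplies the majorant
    [e^(- r |v|)]; finiteness of [mu M] lets the limit pass through the product. *)
Lemma mahler : (mu M < +oo)%E ->
  ((n`!%:R ^+ 3 * (2 * pi) ^+ n)%R%:E <=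
  ((2 * n)`!%:R * Gamma (n%:R / 2 + 1) ^+ 2 * 2 ^+ n)%R%:E *
    (mu M * \int[mu]_v (expsupp v)%:E))%E.
Proof.
set c := (_ * _ * _)%R => Mfin.
have mo (B : set V) : open B -> measurable [set x | B x /\ B (- x)].
  move=> oB; apply: measurableI; first exact: open_measurable_rV.
  by rewrite -[X in measurable X]setTI; have [ms _] := scales_rV_opp R n; apply: ms => //; exact: open_measurable_rV.
have c0 : 0 <= c by rewrite /c mulr_ge0 ?exprn_ge0//; apply: mulr_ge0; [exact: ler0n|exact: sqr_ge0].
have Nk k : ((n`!%:R ^+ 3 * (2 * pi) ^+ n)%R%:E <= c%:E * (mu M * \int[mu]_v (expR (- supp (Kc k) v))%:E))%E.
  apply: (le_trans (mahler_bounded (@openKc k) (Kc0 k) (@convKc k) (@KcB k))).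
  apply: lee_wpmul2l; first by rewrite lee_fin.
  apply: lee_wpmul2r; first by apply: integral_ge0 => v _; rewrite lee_fin expR_ge0.
  by apply: le_measure; rewrite ?inE; [exact: mo|exact: mo|move=> x [[Kx _] [Kx' _]]].
have fM : mu M \is a fin_num by rewrite ge0_fin_numE.
have [r r0 rK] := open_nrm_ball (@openKc 0) (Kc0 0).
have hr k v : r * nrm v <= supp (Kc k) v.
  have [t [tr <-]] := dual_vector v (ltW r0).
  apply: (supp_ge (@KcB k)); have [Kt /= t1] := rK _ tr; split => //=.
  by apply: (lt_le_trans t1); rewrite ler_nat.
have cv : (\int[mu]_v (expR (- supp (Kc k) v))%:E)%E @[k --> \oo] --> (\int[mu]_v (expsupp v)%:E)%E.
  apply: (@dominated_cvg _ _ _ mu setT measurableT (fun k v => (expR (- supp (Kc k) v))%:E)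
     (fun v => (expsupp v)%:E) (fun v => (expR (- (r * nrm v)))%:E)).
  - by move=> k; have mh := measurable_supp (Kc0 k) (@KcB k); measurability.
  - move=> v _; apply/fine_cvgP; split; first by near=> k.
    exact: cvg_expsupp.
  - by [].
  - exact: integrable_exp_nrm.
  - by move=> k v _; rewrite /= lee_fin ger0_norm ?expR_ge0// ler_expR lerN2.
rewrite muleA; set a := (c%:E * mu M)%E.
have fa : a \is a fin_num by rewrite fin_numM.
have cv2 := cvgeZl fa cv.
rewrite -(cvg_lim _ cv2)//; apply: lime_ge; first by apply/cvg_ex; eexists; exact: cv2.
by near=> k; rewrite /a -muleA; exact: Nk.
Unshelve. all: by end_near. Qed.

End exp_support.

(** * The energy estimate *)

Section cone_rotation.
Variables (R : realType) (n : nat).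
Notation V := 'rV[R]_n.
Notation nrm v := (Num.sqrt (dotrV v v)).
Notation mu := (lebesgue_rV R n).
Variables (d a b : V -> R) (c L : R).
Hypotheses (md : measurable_fun setT d) (ma : measurable_fun setT a) (mb : measurable_fun setT b).
Hypothesis d01 : forall y, d y = 0 \/ d y = 1.
Hypothesis dZ : forall r y, 0 < r -> d (r *: y) = d y.
Hypothesis aZ : forall r y, 0 < r -> d y = 1 -> a (r *: y) = r * a y.
Hypothesis bZ : forall r y, 0 < r -> d y = 1 -> b (r *: y) = r * b y.
Hypotheses (c0 : 0 < c) (L0 : 0 <= L).
Hypothesis ac : forall y, d y = 1 -> c * nrm y <= a y.
Hypothesis bc : forall y, d y = 1 -> c * nrm y <= b y.
Hypothesis ab : forall y, d y = 1 -> a y <= L * b y.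
Hypothesis ba : forall y, d y = 1 -> b y <= L * a y.

Let N : R := n%:R.
(** With [tau = e^(s + i th)], [X + i Y = tau (a - i b)], and [P] (at [s = 0]) and [Q] are the real
    and imaginary parts of [d i^(- n) tau^n e^(- tau (a - i b))]. The power [tau^n] compensates the
    Jacobian of the dilation. *)
Let X (th s : R) y := expR s * (a y * cos th + b y * sin th).
Let Y (th s : R) y := expR s * (a y * sin th - b y * cos th).
Let F (th s : R) y := N * (th - pi / 2) - Y th s y.
Let P (th s : R) y := d y * (expR (N * s - X th s y) * cos (F th s y)).
Let Q (th s : R) y := d y * (expR (N * s - X th s y) * sin (F th s y)).
Let p (th s : R) y := d y * (expR (N * s - X th s y) * ((N - X th s y) * sin (F th s y) - Y th s y * cos (F th s y))).

Let dX th y : is_derive th (1 : R) (fun t => X t 0 y) (- Y th 0 y).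
Proof. by rewrite /X; apply: is_derive_eq; rewrite /Y /GRing.scale/=; ring. Qed.

Let dXs th s y : is_derive s (1 : R) (fun t => X th t y) (X th s y).
Proof. by rewrite /X; apply: is_derive_eq; rewrite /GRing.scale/=; ring. Qed.

Let dF th y : is_derive th (1 : R) (fun t => F t 0 y) (N - X th 0 y).
Proof. by rewrite /F /Y; apply: is_derive_eq; rewrite /X /GRing.scale/=; ring. Qed.

Let dFs th s y : is_derive s (1 : R) (fun t => F th t y) (- Y th s y).
Proof. by rewrite /F /Y; apply: is_derive_eq; rewrite /GRing.scale/=; ring. Qed.

Let dP th y : is_derive th (1 : R) (fun t => P t 0 y) (- p th 0 y).
Proof.
have dE : is_derive th (1 : R) (fun t => N * 0 - X t 0 y) (Y th 0 y).
  by have h := dX th y; apply: is_derive_eq; rewrite /GRing.scale/=; ring.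
have H := is_deriveM (is_derive1_comp (is_derive_expR _) dE) (is_derive1_comp (is_derive_cos _) (dF th y)).
have H2 := is_deriveZ (d y) H.
by apply: (is_derive_eq H2); rewrite /p /GRing.scale/=; ring.
Qed.

Let dQ th s y : is_derive s (1 : R) (fun t => Q th t y) (p th s y).
Proof.
have dE : is_derive s (1 : R) (fun t => N * t - X th t y) (N - X th s y).
  by have h := dXs th s y; apply: is_derive_eq; rewrite /GRing.scale/=; ring.
have H := is_deriveM (is_derive1_comp (is_derive_expR _) dE) (is_derive1_comp (is_derive_sin _) (dFs th s y)).
have H2 := is_deriveZ (d y) H.
by apply: (is_derive_eq H2); rewrite /p /GRing.scale/=; ring.
Qed.

Let k := expR (-1) / (1 + L).
Let k0 : 0 < k. Proof. by apply: divr_gt0; [exact: expR_gt0|rewrite ltr_pwDl]. Qed.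
Let q y := a y + b y.

Let a0 y : d y = 1 -> 0 <= a y. Proof. by move=> /ac; apply: le_trans; rewrite mulr_ge0// ltW. Qed.
Let b0 y : d y = 1 -> 0 <= b y. Proof. by move=> /bc; apply: le_trans; rewrite mulr_ge0// ltW. Qed.

Let q_ge y : d y = 1 -> 2 * c * nrm y <= q y.
Proof. by move=> dy; have := ac dy; have := bc dy; rewrite /q; lra. Qed.

(** Comparability makes both [a] and [b] at least [q / (1 + L)], and [cos + sin >= 1]; so the
    exponent remains coercive at every angle. *)
Let X_ge th s y : 0 <= th <= pi / 2 -> -1 < s < 1 -> d y = 1 -> k * q y <= X th s y.
Proof.
move=> Ith /andP[s1 s2] dy; have [h0 h1 h2] := first_quadrant Ith.
have L1 : 0 < 1 + L by rewrite ltr_pwDl.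
rewrite /X /k -mulrA; apply: ler_pM; rewrite ?expR_ge0//.
- by rewrite mulr_ge0 ?invr_ge0 ?(ltW L1)// addr_ge0 ?a0 ?b0.
- by rewrite ler_expR ltW.
have qa : (1 + L)^-1 * q y <= a y by rewrite ler_pdivrMl//; have := ba dy; rewrite /q; lra.
have qb : (1 + L)^-1 * q y <= b y by rewrite ler_pdivrMl//; have := ab dy; rewrite /q; lra.
have q0 : 0 <= (1 + L)^-1 * q y by rewrite mulr_ge0 ?invr_ge0 ?(ltW L1)// addr_ge0 ?a0 ?b0.
have := ler_wpM2r h0 qa; have := ler_wpM2r h1 qb; have := ler_wpM2l q0 h2; lra.
Qed.

Let abs_trig_le (t : R) : `|cos t| <= 1 /\ `|sin t| <= 1.
Proof. by rewrite !ler_norml cos_le1 cos_geN1 sin_le1 sin_geN1. Qed.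

Let XY_le th s y : -1 < s < 1 -> d y = 1 -> `|X th s y| <= expR 1 * q y /\ `|Y th s y| <= expR 1 * q y.
Proof.
move=> /andP[s1 s2] dy; have [nc ns] := abs_trig_le th.
have qn (u v : R) : `|u| <= 1 -> `|v| <= 1 -> `|a y * u + b y * v| <= q y.
  move=> hu hv; apply: (le_trans (ler_normD _ _)); rewrite !normrM (ger0_norm (a0 dy)) (ger0_norm (b0 dy)).
  by apply: lerD; rewrite ler_piMr ?a0 ?b0.
have e1 : expR s <= expR 1 by rewrite ler_expR ltW.
rewrite /X /Y !normrM ger0_norm ?expR_ge0//.
split; apply: ler_pM => //; rewrite ?expR_ge0//; first exact: qn.
by rewrite -mulrN; apply: qn; rewrite ?normrN.
Qed.

Let C := expR N * (N + 4 * expR 1 / k).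
Let C0 : 0 <= C.
Proof.
apply: mulr_ge0; first exact: expR_ge0.
apply: addr_ge0; first exact: ler0n.
by apply: divr_ge0; [apply: mulr_ge0 => //; exact: expR_ge0|exact: ltW].
Qed.
Let G (y : V) := C * expR (- (k * c * nrm y)).

Let pG th s y : 0 <= th <= pi / 2 -> -1 < s < 1 -> `|p th s y| <= G y.
Proof.
move=> Ith Js; rewrite /p; case: (d01 y) => dy; rewrite dy ?mul0r ?normr0.
  by rewrite mulr_ge0 ?expR_ge0.
have N0 : 0 <= N by rewrite ler0n.
rewrite mul1r normrM ger0_norm ?expR_ge0//.
have [hX hY] := XY_le th Js dy; have XG := X_ge Ith Js dy; have [nc ns] := abs_trig_le (F th s y).
have q0 : 0 <= q y by rewrite addr_ge0 ?a0 ?b0.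
have h1 : `|(N - X th s y) * sin (F th s y) - Y th s y * cos (F th s y)| <= N + 2 * expR 1 * q y.
  apply: (le_trans (ler_normB _ _)); rewrite (normrM (N - X th s y)) (normrM (Y th s y)).
  have h2 : `|N - X th s y| <= N + expR 1 * q y.
    by apply: (le_trans (ler_normB _ _)); rewrite (ger0_norm N0) lerD2l.
  have := ler_pM (normr_ge0 _) (normr_ge0 _) h2 ns; have := ler_pM (normr_ge0 _) (normr_ge0 _) hY nc.
  by rewrite !mulr1; lra.
have h3 : q y <= 2 / k * expR (k / 2 * q y).
  have k2 : 0 <= 2 / k by apply: divr_ge0 => //; exact: ltW.
  rewrite -[leLHS](_ : 2 / k * (k / 2 * q y) = q y); last first.
    by rewrite mulrA (_ : 2 / k * (k / 2) = 1) ?mul1r//; field; rewrite gt_eqF.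
  by rewrite ler_wpM2l//; have := expR_ge1Dx (k / 2 * q y); lra.
have e1 : 1 <= expR (k / 2 * q y).
  rewrite -expR0 ler_expR; apply: mulr_ge0 => //; apply: divr_ge0 => //; exact: ltW.
have h4 : N + 2 * expR 1 * q y <= (N + 4 * expR 1 / k) * expR (k / 2 * q y).
  rewrite [leRHS]mulrDl; apply: lerD; first by rewrite ler_peMr.
  rewrite [leRHS](_ : _ = 2 * expR 1 * (2 / k * expR (k / 2 * q y))); last by field; rewrite gt_eqF.
  by rewrite ler_wpM2l// mulr_ge0// expR_ge0.
have h5 : expR (N * s - X th s y) <= expR N * expR (- (k * q y)).
  rewrite -expRD ler_expR; have := Js => /andP[_ s1].
  have : N * s <= N by rewrite ler_piMr// ltW.
  lra.
apply: (le_trans (ler_pM _ _ h5 (le_trans h1 h4))); rewrite ?expR_ge0//.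
rewrite /G /C [leLHS](_ : _ = expR N * (N + 4 * expR 1 / k) * (expR (- (k * q y)) * expR (k / 2 * q y))); last by ring.
rewrite ler_wpM2l// -expRD ler_expR.
by have := ler_wpM2l (ltW k0) (q_ge dy); lra.
Qed.

Let mXYF th s : [/\ measurable_fun setT (X th s), measurable_fun setT (Y th s) & measurable_fun setT (F th s)].
Proof. by rewrite /F /X /Y; split; measurability. Qed.

Let integrable_osc th s (g : R -> R) : measurable_fun setT g -> (forall t, `|g t| <= 1) ->
  0 <= th <= pi / 2 -> -1 < s < 1 ->
  mu.-integrable setT (EFin \o (fun y => d y * (expR (N * s - X th s y) * g (F th s y)))).
Proof.
move=> mg g1 Ith Js; have [mX mY mF] := mXYF th s.
apply: (@integrable_bound _ _ _ _ _ (fun y => expR (N * s) * expR (- (k * (2 * c) * nrm y)))).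
- have m1 := measurableT_comp mg mF; by measurability.
- move=> y; case: (d01 y) => dy; rewrite dy ?mul0r ?mul1r ?normr0 ?mulr_ge0 ?expR_ge0//.
  rewrite normrM ger0_norm ?expR_ge0// (le_trans (ler_piMr _ (g1 _))) ?expR_ge0//.
  rewrite -expRD ler_expR lerD2l lerN2.
  by have := X_ge Ith Js dy; have := ler_wpM2l (ltW k0) (q_ge dy); lra.
- by apply: integrable_mulc; apply: integrable_exp_nrm; apply: mulr_gt0 => //; rewrite mulr_gt0.
Qed.

Let J0 : -1 < (0 : R) < 1. Proof. by lra. Qed.

(* Up to a constant phase, both sides are the real part of [int d tau^n e^(- tau (a - i b))] for
   [tau = i] and [tau = 1]; dilations [y -> e^s y] show that it does not depend on [tau]. *)
Lemma cone_rotation :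
  \int[mu]_y (d y * (expR (- b y) * cos (a y))) =
  \int[mu]_y (d y * (expR (- a y) * cos (b y - N * (pi / 2)))).
Proof.
have flow := @flow_integral _ _ _ mu (pi / 2) (fun th y => P th 0 y) Q p G.
have {}flow : \int[mu]_y P (pi / 2) 0 y = \int[mu]_y P 0 0 y.
  apply: flow.
  - by rewrite divr_ge0 ?pi_ge0.
  - by move=> th y _; exact: dP.
  - by move=> th s y _ _; exact: dQ.
  - exact: pG.
  - move=> th _; have [mX mY mF] := mXYF th 0; rewrite /p; measurability.
  - by apply: integrable_mulc; apply: integrable_exp_nrm; apply: mulr_gt0.
  - by move=> th Ith; apply: (integrable_osc (g := cos)) => //; [measurability|move=> t; have [] := abs_trig_le t].
  - by move=> th s Ith Js; apply: (integrable_osc (g := sin)) => //; [measurability|move=> t; have [] := abs_trig_le t].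
  move=> th s Ith Js.
  have iQ0 : mu.-integrable setT (EFin \o Q th 0).
    by apply: (integrable_osc (g := sin)) => //; [measurability|move=> t; have [] := abs_trig_le t].
  have [ms Hs] := scales_rV_scale n (expR_gt0 s).
  have ei0 : 0 <= (expR s)^-1 ^+ n by rewrite exprn_ge0// invr_ge0 expR_ge0.
  have h := scaled_measure_Rintegral ms ei0 Hs iQ0.
  have -> : \int[mu]_y Q th 0 y = expR s ^+ n * \int[mu]_y Q th 0 (expR s *: y).
    by rewrite h mulrA -exprMn mulfV ?expr1n ?mul1r// gt_eqF// expR_gt0.
  rewrite -RintegralZl//; last exact: (scaled_measure_integrable ms ei0 Hs iQ0).
  apply: eq_Rintegral => y _; rewrite /Q dZ ?expR_gt0//.
  case: (d01 y) => dy; rewrite dy ?mul0r ?mulr0// !mul1r.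
  have -> : X th 0 (expR s *: y) = X th s y.
    by rewrite /X aZ ?bZ ?expR_gt0// expR0; ring.
  have -> : F th 0 (expR s *: y) = F th s y.
    by rewrite /F /Y aZ ?bZ ?expR_gt0// expR0; ring.
  by rewrite ?mulr0 add0r expRD /N expRM_natl mulrA.
transitivity (\int[mu]_y P (pi / 2) 0 y).
  apply: eq_Rintegral => y _; rewrite /P /F /X /Y expR0 mulr0 cos_pihalf sin_pihalf subrr.
  by rewrite !mulr0 !mulr1 !mul1r !add0r subr0 cosN.
rewrite flow; apply: eq_Rintegral => y _; rewrite /P /F /X /Y expR0 mulr0 cos0 sin0.
congr (_ * (expR _ * cos _)); ring.
Qed.

End cone_rotation.

Section real_fubini.
Context d1 d2 (T1 : measurableType d1) (T2 : measurableType d2) (R : realType).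
Variables (m1 : {sigma_finite_measure set T1 -> \bar R}) (m2 : {sigma_finite_measure set T2 -> \bar R}).

Lemma Rfubini_prod (F : T1 * T2 -> R) : (m1 \x m2)%E.-integrable setT (EFin \o F) ->
  (forall x, m2.-integrable setT (EFin \o (fun y => F (x, y)))) ->
  \int[(m1 \x m2)%E]_z F z = \int[m1]_x \int[m2]_y F (x, y).
Proof.
move=> iF i2; rewrite /Rintegral -(integral12_prod_meas1 iF); congr fine.
apply: eq_integral => x _; rewrite [LHS]/fubini_F /= fineK//.
exact: (integrable_fin_num measurableT (i2 x)).
Qed.

Lemma Rfubini (F : T1 * T2 -> R) : (m1 \x m2)%E.-integrable setT (EFin \o F) ->
  (forall x, m2.-integrable setT (EFin \o (fun y => F (x, y)))) ->
  (forall y, m1.-integrable setT (EFin \o (fun x => F (x, y)))) ->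
  \int[m1]_x \int[m2]_y F (x, y) = \int[m2]_y \int[m1]_x F (x, y).
Proof.
move=> iF i2 i1; rewrite -Rfubini_prod// /Rintegral -(integral21_prod_meas1 iF); congr fine.
apply: eq_integral => y _; rewrite [LHS]/fubini_G /= fineK//.
exact: (integrable_fin_num measurableT (i1 y)).
Qed.

Variables (g1 : T1 -> R) (g2 : T2 -> R).
Hypotheses (i1 : m1.-integrable setT (EFin \o g1)) (i2 : m2.-integrable setT (EFin \o g2)).

Let mg1 : measurable_fun setT g1. Proof. by apply/measurable_EFinP; exact: measurable_int i1. Qed.
Let mg2 : measurable_fun setT g2. Proof. by apply/measurable_EFinP; exact: measurable_int i2. Qed.

Let mg12 : measurable_fun setT (fun z : T1 * T2 => g1 z.1 * g2 z.2).
Proof.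
apply: measurable_mulf; first exact: (measurableT_comp mg1 measurable_fst).
exact: (measurableT_comp mg2 measurable_snd).
Qed.

Lemma integrable_tensor : (m1 \x m2)%E.-integrable setT (EFin \o (fun z => g1 z.1 * g2 z.2)).
Proof.
apply/integrable12ltyP; first exact/measurable_EFinP.
have [_ /= h1] := integrableP _ _ _ i1; have [_ /= h2] := integrableP _ _ _ i2.
have ma2 : measurable_fun setT (fun y => `|(g2 y)%:E|%E).
  by apply: measurableT_comp => //; exact/measurable_EFinP.
have ma1 : measurable_fun setT (fun y => `|(g1 y)%:E|%E).
  by apply: measurableT_comp => //; exact/measurable_EFinP.
under eq_integral => x _.
  under eq_integral => y _ do rewrite /= normrM EFinM.
  rewrite ge0_integralZl//; over.
rewrite /= ge0_integralZr//; last by apply: integral_ge0.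
rewrite lte_mul_pinfty//; first by apply: integral_ge0.
by rewrite ge0_fin_numE//; apply: integral_ge0.
Qed.

Lemma Rintegral_tensor : \int[(m1 \x m2)%E]_z (g1 z.1 * g2 z.2) = (\int[m1]_x g1 x) * \int[m2]_y g2 y.
Proof.
rewrite (Rfubini_prod integrable_tensor); last by move=> x; exact: (integrable_mulc (g1 x) i2).
rewrite /= -RintegralZr//; apply: eq_Rintegral => x _; rewrite RintegralZl//.
Qed.

End real_fubini.

Lemma Rintegral_add4 d (T : measurableType d) (R : realType) (mu : {measure set T -> \bar R})
    (g1 g2 g3 g4 : T -> R) (c1 c2 c3 c4 : R) :
  mu.-integrable setT (EFin \o g1) -> mu.-integrable setT (EFin \o g2) ->
  mu.-integrable setT (EFin \o g3) -> mu.-integrable setT (EFin \o g4) ->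
  \int[mu]_x (c1 * g1 x + c2 * g2 x + (c3 * g3 x + c4 * g4 x)) =
  c1 * (\int[mu]_x g1 x) + c2 * (\int[mu]_x g2 x) + (c3 * (\int[mu]_x g3 x) + c4 * (\int[mu]_x g4 x)).
Proof.
move=> h1 h2 h3 h4.
have D (p q : T -> R) : mu.-integrable setT (EFin \o p) -> mu.-integrable setT (EFin \o q) ->
    mu.-integrable setT (EFin \o (fun x => p x + q x)).
  by move=> ip iq; have := integrableD measurableT ip iq; apply: eq_integrable.
have Z c (p : T -> R) (ip : mu.-integrable setT (EFin \o p)) := integrable_mulc c ip.
rewrite (RintegralD measurableT (D _ _ (Z c1 _ h1) (Z c2 _ h2)) (D _ _ (Z c3 _ h3) (Z c4 _ h4))).
rewrite (RintegralD measurableT (Z c1 _ h1) (Z c2 _ h2)) (RintegralD measurableT (Z c3 _ h3) (Z c4 _ h4)).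
by rewrite !RintegralZl.
Qed.

Lemma abs_rot_le (R : rcfType) (u v c s : R) : c ^+ 2 + s ^+ 2 = 1 ->
  `|u * c + v * s| <= Num.sqrt (u ^+ 2 + v ^+ 2).
Proof.
move=> cs; rewrite -sqrtr_sqr ler_wsqrtr//.
have := sqr_ge0 (u * s - v * c).
have : (u ^+ 2 + v ^+ 2) * (c ^+ 2 + s ^+ 2) = u ^+ 2 + v ^+ 2 by rewrite cs mulr1.
lra.
Qed.

(** * Autocorrelation with a Gaussian weight *)

Section autocorrelation.
Variables (R : realType) (n : nat) (f1 f2 : 'rV[R]_n -> R).
Notation V := 'rV[R]_n.
Notation mu := (lebesgue_rV R n).
Notation E := (lebE R n).
Hypotheses (i1 : mu.-integrable setT (EFin \o f1)) (i2 : mu.-integrable setT (EFin \o f2)).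

Let mf1 : measurable_fun setT f1. Proof. by apply/measurable_EFinP; exact: measurable_int i1. Qed.
Let mf2 : measurable_fun setT f2. Proof. by apply/measurable_EFinP; exact: measurable_int i2. Qed.

Definition modf x := Num.sqrt (f1 x ^+ 2 + f2 x ^+ 2).

Lemma measurable_modf : measurable_fun setT modf.
Proof. by apply: measurable_sqrtf; apply: measurable_addf; apply: measurable_expf. Qed.

Let modf_le x : modf x <= `|f1 x| + `|f2 x|.
Proof.
rewrite -[leRHS]ger0_norm ?addr_ge0// -sqrtr_sqr ler_wsqrtr// sqrrD !real_normK ?num_real//.
have : 0 <= `|f1 x| * `|f2 x| by rewrite mulr_ge0.
by rewrite mulr2n; lra.
Qed.

Lemma integrable_modf : mu.-integrable setT (EFin \o modf).
Proof.
apply: (@integrable_bound _ _ _ _ _ (fun x => `|f1 x| + `|f2 x|)).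
- exact: measurable_modf.
- by move=> x; rewrite ger0_norm ?sqrtr_ge0.
have := integrableD measurableT (integrable_abse i1) (integrable_abse i2).
by apply: eq_integrable => // x _.
Qed.

(* The real and imaginary parts of the Fourier transform of [f1 + i f2]. *)
Definition four_re xi := \int[mu]_y (f1 y * cos (2 * pi * dotrV xi y) + f2 y * sin (2 * pi * dotrV xi y)).
Definition four_im xi := \int[mu]_y (f2 y * cos (2 * pi * dotrV xi y) - f1 y * sin (2 * pi * dotrV xi y)).
Definition power xi := four_re xi ^+ 2 + four_im xi ^+ 2.

Let integrable_re xi : mu.-integrable setT
  (EFin \o (fun y => f1 y * cos (2 * pi * dotrV xi y) + f2 y * sin (2 * pi * dotrV xi y))).
Proof.
apply: (@integrable_bound _ _ _ _ _ modf); last exact: integrable_modf.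
- by measurability.
- by move=> y; apply: abs_rot_le; exact: cos2Dsin2.
Qed.

Let integrable_im xi : mu.-integrable setT
  (EFin \o (fun y => f2 y * cos (2 * pi * dotrV xi y) - f1 y * sin (2 * pi * dotrV xi y))).
Proof.
apply: (@integrable_bound _ _ _ _ _ modf); last exact: integrable_modf.
- by measurability.
move=> y; rewrite -mulrN; apply: (le_trans (abs_rot_le _ _ (_ : _ ^+ 2 + _ ^+ 2 = 1))).
  by rewrite sqrrN cos2Dsin2.
by rewrite /modf addrC.
Qed.

(** With [f = f1 + i f2], [u + i v] below is [f(w.1)] times the conjugate of [f(w.2)], and [A] is
    its modulus. *)
Let A (w : V * V) := modf w.1 * modf w.2.
Let u (w : V * V) := f1 w.1 * f1 w.2 + f2 w.1 * f2 w.2.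
Let v (w : V * V) := f2 w.1 * f1 w.2 - f1 w.1 * f2 w.2.
Let ph (xi : V) (w : V * V) := 2 * pi * dotrV xi (w.1 - w.2).

Let uvA w : Num.sqrt (u w ^+ 2 + v w ^+ 2) = A w.
Proof.
rewrite /A /modf -sqrtrM ?addr_ge0 ?sqr_ge0//; congr Num.sqrt; rewrite /u /v; ring.
Qed.

Let A0 w : 0 <= A w. Proof. by rewrite mulr_ge0 ?sqrtr_ge0. Qed.

Let integrable_A : E.-integrable setT (EFin \o A).
Proof. exact: (integrable_tensor integrable_modf integrable_modf). Qed.

Let mu_ : measurable_fun setT u. 
Proof.
have a1 := measurableT_comp mf1 (@measurable_fst _ _ V V).
have a2 := measurableT_comp mf1 (@measurable_snd _ _ V V).
have a3 := measurableT_comp mf2 (@measurable_fst _ _ V V).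
have a4 := measurableT_comp mf2 (@measurable_snd _ _ V V).
by apply: measurable_addf; exact: measurable_mulf.
Qed.

Let mv_ : measurable_fun setT v.
Proof.
have a1 := measurableT_comp mf1 (@measurable_fst _ _ V V).
have a2 := measurableT_comp mf1 (@measurable_snd _ _ V V).
have a3 := measurableT_comp mf2 (@measurable_fst _ _ V V).
have a4 := measurableT_comp mf2 (@measurable_snd _ _ V V).
by apply: measurable_addf; last apply: measurable_oppf; exact: measurable_mulf.
Qed.

Let mA : measurable_fun setT A.
Proof. by apply/measurable_EFinP; exact: measurable_int integrable_A. Qed.

Let powerE xi : power xi = \int[E]_w (u w * cos (ph xi w) + v w * sin (ph xi w)).
Proof.
rewrite /power !expr2.
rewrite -(Rintegral_tensor (integrable_re xi) (integrable_re xi)).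
rewrite -(Rintegral_tensor (integrable_im xi) (integrable_im xi)).
rewrite -RintegralD//; last 2 first.
- exact: (integrable_tensor (integrable_re xi) (integrable_re xi)).
- exact: (integrable_tensor (integrable_im xi) (integrable_im xi)).
apply: eq_Rintegral => w _; rewrite /ph dotBr (mulrBr (2 * pi)) cosB sinB /u /v; ring.
Qed.

Variable (dl : R).
Hypothesis dl0 : 0 < dl.

Definition gaussw (xi : V) : R := expR (- (dl * dotrV xi xi)).
Definition gausshat (z : V) : R := expR (- (pi ^+ 2 / dl * dotrV z z)) * Num.sqrt (pi / dl) ^+ n.

Let gausshatE z : \int[mu]_xi (gaussw xi * cos (2 * pi * dotrV xi z)) = gausshat z.
Proof.
transitivity (\int[mu]_xi (gaussw xi * cos (dotrV xi ((2 * pi) *: z)))).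
  by apply: eq_Rintegral => xi _; rewrite dotZr.
rewrite gauss_cos// /gausshat; congr (expR _ * _); rewrite dotZl dotZr.
by field; rewrite gt_eqF.
Qed.

Let gausssinE z : \int[mu]_xi (gaussw xi * sin (2 * pi * dotrV xi z)) = 0.
Proof.
transitivity (\int[mu]_xi (gaussw xi * sin (dotrV xi ((2 * pi) *: z)))).
  by apply: eq_Rintegral => xi _; rewrite dotZr.
exact: gauss_sin.
Qed.

Lemma gausshat_ge0 z : 0 <= gausshat z.
Proof. by rewrite mulr_ge0 ?expR_ge0 ?exprn_ge0. Qed.

Lemma measurable_gausshat : measurable_fun setT gausshat.
Proof. by rewrite /gausshat; measurability. Qed.

Lemma gausshat_int : (\int[mu]_z (gausshat z)%:E)%E = 1%E.
Proof.
rewrite /gausshat; under eq_integral do rewrite EFinM.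
have p2 : 0 < (pi : R) ^+ 2 by rewrite exprn_gt0// pi_gt0.
have pd : 0 < pi ^+ 2 / dl by rewrite divr_gt0.
rewrite ge0_integralZr//; last by measurability.
rewrite gauss_rV// -EFinM -exprMn -sqrtrM; last by rewrite divr_ge0 ?pi_ge0 ?(ltW pd).
rewrite (_ : _ * _ = 1); first by rewrite sqrtr1 expr1n.
by move: (pi : R) (pi_gt0 R) => p p0; field; rewrite !gt_eqF.
Qed.

Let igauss (g : R -> R) z : measurable_fun setT g -> (forall t, `|g t| <= 1) ->
  mu.-integrable setT (EFin \o (fun xi => gaussw xi * g (2 * pi * dotrV xi z))).
Proof.
move=> mg g1; apply: (@integrable_bound _ _ _ _ _ gaussw); last exact: gauss_rV_integrable.
- apply: measurable_mulf; first by rewrite /gaussw; measurability.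
  by apply: (measurableT_comp mg); measurability.
- by move=> xi; rewrite normrM ger0_norm ?expR_ge0// ler_piMr ?expR_ge0.
Qed.

Let abs_cos_le (t : R) : `|cos t| <= 1. Proof. by rewrite ler_norml cos_le1 cos_geN1. Qed.
Let abs_sin_le (t : R) : `|sin t| <= 1. Proof. by rewrite ler_norml sin_le1 sin_geN1. Qed.

Let gauss_phase_cos z al : \int[mu]_xi (gaussw xi * cos (al + 2 * pi * dotrV xi z)) = cos al * gausshat z.
Proof.
transitivity (\int[mu]_xi (cos al * (gaussw xi * cos (2 * pi * dotrV xi z)) -
   sin al * (gaussw xi * sin (2 * pi * dotrV xi z)))).
  by apply: eq_Rintegral => xi _; rewrite cosD; ring.
have ic : mu.-integrable setT (EFin \o (fun xi => gaussw xi * cos (2 * pi * dotrV xi z))).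
  by apply: igauss => //; measurability.
have is_ : mu.-integrable setT (EFin \o (fun xi => gaussw xi * sin (2 * pi * dotrV xi z))).
  by apply: igauss => //; measurability.
rewrite RintegralB//; try exact: integrable_mulc.
by rewrite !RintegralZl// gausshatE gausssinE; ring.
Qed.

Let gauss_phase_sin z al : \int[mu]_xi (gaussw xi * sin (al + 2 * pi * dotrV xi z)) = sin al * gausshat z.
Proof.
transitivity (\int[mu]_xi (sin al * (gaussw xi * cos (2 * pi * dotrV xi z)) +
   cos al * (gaussw xi * sin (2 * pi * dotrV xi z)))).
  by apply: eq_Rintegral => xi _; rewrite sinD; ring.
have ic : mu.-integrable setT (EFin \o (fun xi => gaussw xi * cos (2 * pi * dotrV xi z))).
  by apply: igauss => //; measurability.
have is_ : mu.-integrable setT (EFin \o (fun xi => gaussw xi * sin (2 * pi * dotrV xi z))).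
  by apply: igauss => //; measurability.
rewrite RintegralD//; try exact: integrable_mulc.
by rewrite !RintegralZl// gausshatE gausssinE; ring.
Qed.

(** The autocorrelation of [|f|], smoothed by the transform of the Gaussian and symmetrised in [s],
    as a real cosine carries both phases. The smoothing density has mass 1, so the total mass is the
    squared norm of [f]. *)
Definition corr_bound (s : V) : \bar R := (\int[E]_w
  (A w * ((gausshat (w.1 - w.2 - s) + gausshat (w.1 - w.2 + s)) / 2))%R%:E)%E.

Let F (al : R) (s : V) (z : V * (V * V)) := gaussw z.1 * cos (al - 2 * pi * dotrV z.1 s) *
  (u z.2 * cos (ph z.1 z.2) + v z.2 * sin (ph z.1 z.2)).

Let mph : measurable_fun setT (fun z : V * (V * V) => ph z.1 z.2).
Proof. by rewrite /ph; measurability. Qed.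

Let mF al s : measurable_fun setT (F al s).
Proof.
have a1 : measurable_fun setT (fun z : V * (V * V) => u z.2) := measurableT_comp mu_ measurable_snd.
have a2 : measurable_fun setT (fun z : V * (V * V) => v z.2) := measurableT_comp mv_ measurable_snd.
have mp := mph; rewrite /F /gaussw; measurability.
Qed.

Let F_le al s z : `|F al s z| <= gaussw z.1 * A z.2.
Proof.
rewrite /F normrM; apply: ler_pM => //.
  by rewrite normrM ger0_norm ?expR_ge0// ler_piMr ?expR_ge0.
by rewrite -uvA; apply: abs_rot_le; exact: cos2Dsin2.
Qed.

Let gaussw_le1 xi : gaussw xi <= 1.
Proof. by rewrite /gaussw -expR0 ler_expR oppr_le0 mulr_ge0 ?dot_ge0// ltW. Qed.

Let Finner al s w : \int[mu]_xi F al s (xi, w) =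
  (u w * cos al + v w * sin al) * (gausshat (w.1 - w.2 - s) / 2) +
  (u w * cos al + v w * (- sin al)) * (gausshat (w.1 - w.2 + s) / 2).
Proof.
rewrite /F /ph /=; move: (w.1 - w.2) => d.
have ig (g : R -> R) z : measurable_fun setT g -> (forall t, `|g t| <= 1) ->
    mu.-integrable setT (EFin \o (fun xi => gaussw xi * g (al + 2 * pi * dotrV xi z))).
  move=> mg g1; apply: (igauss (g := fun t => g (al + t))) => //.
  by apply: (measurableT_comp mg); measurability.
have mc : measurable_fun setT (@cos R) by measurability.
have msn : measurable_fun setT (@sin R) by measurability.
transitivity (\int[mu]_xi (u w / 2 * (gaussw xi * cos (al + 2 * pi * dotrV xi (d - s))) +
   u w / 2 * (gaussw xi * cos (al + 2 * pi * dotrV xi (- (d + s)))) +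
   (v w / 2 * (gaussw xi * sin (al + 2 * pi * dotrV xi (d - s))) +
   - v w / 2 * (gaussw xi * sin (al + 2 * pi * dotrV xi (- (d + s))))))).
  apply: eq_Rintegral => xi _; rewrite !(dotNr, dotDr).
  move: (dotrV xi d) (dotrV xi s) => p q.
  rewrite (_ : al + 2 * pi * (p - q) = (al - 2 * pi * q) + 2 * pi * p); last by ring.
  rewrite (_ : al + 2 * pi * - (p + q) = (al - 2 * pi * q) - 2 * pi * p); last by ring.
  rewrite [cos (_ - _ + _)]cosD [cos (_ - _ - _)]cosB [sin (_ - _ + _)]sinD [sin (_ - _ - _)]sinB.
  by field.
rewrite Rintegral_add4; try by apply: ig.
rewrite !gauss_phase_cos !gauss_phase_sin.
have -> : gausshat (- (d + s)) = gausshat (d + s) by rewrite /gausshat dotNl dotNr opprK.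
ring.
Qed.

Let gausshat_le z : gausshat z <= Num.sqrt (pi / dl) ^+ n.
Proof.
rewrite /gausshat ler_piMl ?exprn_ge0// -expR0 ler_expR oppr_le0 mulr_ge0 ?dot_ge0//.
by rewrite divr_ge0 ?sqr_ge0// ltW.
Qed.

Let Finner_le al s w : `|\int[mu]_xi F al s (xi, w)| <=
  A w * ((gausshat (w.1 - w.2 - s) + gausshat (w.1 - w.2 + s)) / 2).
Proof.
rewrite Finner (mulrDl (gausshat _)) (mulrDr (A w)); apply: (le_trans (ler_normD _ _)); apply: lerD; rewrite normrM.
  rewrite (ger0_norm (x := _ / 2)) ?divr_ge0 ?gausshat_ge0// ler_wpM2r ?divr_ge0 ?gausshat_ge0//.
  by rewrite -uvA; apply: abs_rot_le; exact: cos2Dsin2.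
rewrite (ger0_norm (x := _ / 2)) ?divr_ge0 ?gausshat_ge0// ler_wpM2r ?divr_ge0 ?gausshat_ge0//.
by rewrite -uvA; apply: abs_rot_le; rewrite sqrrN; exact: cos2Dsin2.
Qed.

Let mFinner al s : measurable_fun setT (fun w => \int[mu]_xi F al s (xi, w)).
Proof.
rewrite (_ : (fun w => _) = fun w => (u w * cos al + v w * sin al) * (gausshat (w.1 - w.2 - s) / 2) +
  (u w * cos al + v w * (- sin al)) * (gausshat (w.1 - w.2 + s) / 2)); last exact/funext/Finner.
by have m1 := mu_; have m2 := mv_; rewrite /gausshat; measurability.
Qed.

(* Expanding [|f^|^2] as a double integral and integrating the Gaussian in [xi] first. *)
Lemma corr_le al s :
  ((`|\int[mu]_xi (power xi * (gaussw xi * cos (al - 2 * pi * dotrV xi s)))|)%:E <= corr_bound s)%E.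
Proof.
have iF : (mu \x E)%E.-integrable setT (EFin \o F al s).
  apply: (integrable_bound (mF al s) (F_le al s)).
  exact: (integrable_tensor (gauss_rV_integrable n dl0) integrable_A).
have iF2 xi : E.-integrable setT (EFin \o (fun w => F al s (xi, w))).
  apply: (@integrable_bound _ _ _ _ _ A); last exact: integrable_A.
    exact: (measurableT_comp (mF al s) (measurable_pair1 xi)).
  move=> w; apply: (le_trans (F_le _ _ _)); by rewrite /= ler_piMl.
have iF1 w : mu.-integrable setT (EFin \o (fun xi => F al s (xi, w))).
  apply: (@integrable_bound _ _ _ _ _ (fun xi => A w * gaussw xi)).
  - exact: (measurableT_comp (mF al s) (measurable_pair2 w)).
  - by move=> xi; rewrite mulrC; exact: F_le.
  - by apply: integrable_mulc; exact: gauss_rV_integrable.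
have -> : \int[mu]_xi (power xi * (gaussw xi * cos (al - 2 * pi * dotrV xi s))) =
    \int[E]_w \int[mu]_xi F al s (xi, w).
  rewrite -(Rfubini iF iF2 iF1); apply: eq_Rintegral => xi _.
  rewrite powerE mulrC -RintegralZl//.
  apply: (@integrable_bound _ _ _ _ _ A); last exact: integrable_A.
    have m1 := mu_; have m2 := mv_; have /= m3 := measurableT_comp mph (measurable_pair1 xi).
    by measurability.
  by move=> w; rewrite -uvA; apply: abs_rot_le; exact: cos2Dsin2.
have iI : E.-integrable setT (EFin \o (fun w => \int[mu]_xi F al s (xi, w))).
  apply: (@integrable_bound _ _ _ _ _ (fun w => Num.sqrt (pi / dl) ^+ n * A w)) => //.
    move=> w; apply: (le_trans (Finner_le _ _ _)); rewrite mulrC ler_wpM2r//.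
    by have := gausshat_le (w.1 - w.2 - s); have := gausshat_le (w.1 - w.2 + s); lra.
  exact: integrable_mulc.
rewrite /Rintegral -abse_EFin fineK; last exact: integrable_fin_num iI.
apply: (le_trans (le_abse_integral E measurableT (measurable_int _ iI))).
apply: ge0_le_integral => //.
- by apply: measurableT_comp => //; exact/measurable_EFinP.
- by apply/measurable_EFinP; have m1 := mA; rewrite /gausshat; measurability.
- by move=> w _; rewrite /= lee_fin; exact: Finner_le.
Qed.

Let gausshat_even z : gausshat (- z) = gausshat z.
Proof. by rewrite /gausshat dotNl dotNr opprK. Qed.

Let gausshat_shift z : (\int[mu]_s (gausshat (s + z))%:E)%E = 1%E.
Proof.
have mg : measurable_fun setT (EFin \o gausshat) by apply/measurable_EFinP; exact: measurable_gausshat.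
rewrite -gausshat_int; apply: (lebesgue_rV_int_shift z mg) => x.
by rewrite lee_fin gausshat_ge0.
Qed.

Let H (z : V * (V * V)) := (A z.2 * ((gausshat (z.2.1 - z.2.2 - z.1) + gausshat (z.2.1 - z.2.2 + z.1)) / 2))%:E.

Let mH : measurable_fun setT H.
Proof.
have a1 : measurable_fun setT (fun z : V * (V * V) => A z.2) := measurableT_comp mA measurable_snd.
by apply/measurable_EFinP; rewrite /gausshat; measurability.
Qed.

Let H0 z : (0 <= H z)%E.
Proof. by rewrite lee_fin mulr_ge0// divr_ge0// addr_ge0 ?gausshat_ge0. Qed.

Lemma measurable_corr_bound : measurable_fun setT corr_bound.
Proof. exact: (@measurable_fun_fubini_tonelli_F _ _ _ _ _ E H mH H0). Qed.

Lemma corr_bound_int : (\int[mu]_s corr_bound s = (\int[mu]_x (modf x)%:E) ^+ 2)%E.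
Proof.
transitivity (\int[E]_w \int[mu]_s H (s, w))%E.
  exact: (@fubini_tonelli _ _ _ _ _ mu E H mH H0).
transitivity (\int[E]_w (A w)%:E)%E.
  apply: eq_integral => w _.
  transitivity (\int[mu]_s ((A w / 2)%:E * ((gausshat (s + (- (w.1 - w.2))))%:E + (gausshat (s + (w.1 - w.2)))%:E)))%E.
    apply: eq_integral => s _; rewrite /H /= -EFinD -EFinM; congr _%:E.
    rewrite (_ : s - (w.1 - w.2) = - (w.1 - w.2 - s)) ?gausshat_even; last by rewrite [RHS]opprB.
    by rewrite (addrC s); field.
  have mg z : measurable_fun setT (fun s : V => (gausshat (s + z))%:E).
    by apply/measurable_EFinP; rewrite /gausshat; measurability.
  have g0 z s : (0 <= (gausshat (s + z))%:E)%E by rewrite lee_fin gausshat_ge0.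
  rewrite ge0_integralZl//; last first.
  - by rewrite lee_fin divr_ge0.
  - by move=> s _; rewrite adde_ge0.
  - by apply: emeasurable_funD.
  rewrite ge0_integralD// !gausshat_shift -EFinD -EFinM; congr _%:E.
  by rewrite mulfVK.
rewrite (@lebE_tonelli _ _ (fun w => (A w)%:E)); last 2 first.
- exact/measurable_EFinP.
- by move=> w; rewrite lee_fin.
have mm : measurable_fun setT (fun y => (modf y)%:E) by apply/measurable_EFinP; exact: measurable_modf.
have m0 x : (0 <= (modf x)%:E)%E by rewrite lee_fin sqrtr_ge0.
transitivity (\int[mu]_x ((modf x)%:E * \int[mu]_y (modf y)%:E))%E.
  apply: eq_integral => x _; rewrite -ge0_integralZl//.
by rewrite ge0_integralZr// ?expe2//; apply: integral_ge0.
Qed.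

End autocorrelation.

Section kernel_bound.
Variables (R : realType) (n : nat) (f1 f2 : 'rV[R]_n -> R).
Notation V := 'rV[R]_n.
Notation mu := (lebesgue_rV R n).
Hypotheses (i1 : mu.-integrable setT (EFin \o f1)) (i2 : mu.-integrable setT (EFin \o f2)).
Variable dl : R.
Hypothesis dl0 : 0 < dl.
Notation power := (power f1 f2).
Notation gaussw := (@gaussw R n dl).

Let mgauss : measurable_fun setT gaussw. Proof. by rewrite /gaussw; measurability. Qed.

(** Measurability is drawn from Fubini, which asks for integrability in both variables; a Gaussian
    in [xi] is inserted for that and divided out again. *)
Let mfour (p q : V -> R) : mu.-integrable setT (EFin \o p) -> mu.-integrable setT (EFin \o q) ->
  measurable_fun setT (fun xi => \int[mu]_y (p y * cos (2 * pi * dotrV xi y) + q y * sin (2 * pi * dotrV xi y))).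
Proof.
move=> ip iq.
have mp : measurable_fun setT p by apply/measurable_EFinP; exact: measurable_int ip.
have mq : measurable_fun setT q by apply/measurable_EFinP; exact: measurable_int iq.
pose F (z : V * V) := gaussw z.1 * (p z.2 * cos (2 * pi * dotrV z.1 z.2) + q z.2 * sin (2 * pi * dotrV z.1 z.2)).
have mF : measurable_fun setT F.
  have a1 := measurableT_comp mp (@measurable_snd _ _ V V).
  have a2 := measurableT_comp mq (@measurable_snd _ _ V V).
  by rewrite /F /gaussw; measurability.
have im := integrable_modf ip iq.
have iF : (mu \x mu)%E.-integrable setT (EFin \o F).
  apply: (integrable_bound mF (g := fun z => gaussw z.1 * modf p q z.2)).
    move=> z; rewrite /F normrM ger0_norm ?expR_ge0// ler_wpM2l ?expR_ge0//.
    by apply: abs_rot_le; exact: cos2Dsin2.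
  exact: (integrable_tensor (gauss_rV_integrable n dl0) im).
have h := measurable_fubini_F iF.
have h2 : measurable_fun setT (fun xi => (gaussw xi)^-1 * fine (fubini_F mu (EFin \o F) xi)).
  apply: measurable_mulf; last exact: measurableT_comp h.
  rewrite (_ : (fun xi => (gaussw xi)^-1) = fun xi => expR (dl * dotrV xi xi)); first by measurability.
  by apply/funext => xi; rewrite /gaussw expRN invrK.
rewrite (_ : (fun xi => _) = fun xi => (gaussw xi)^-1 * fine (fubini_F mu (EFin \o F) xi))//.
apply/funext => xi.
have -> : fine (fubini_F mu (EFin \o F) xi) =
  \int[mu]_y (gaussw xi * (p y * cos (2 * pi * dotrV xi y) + q y * sin (2 * pi * dotrV xi y))) by [].
rewrite RintegralZl//; first by rewrite mulrA mulVf ?mul1r// gt_eqF// expR_gt0.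
apply: (@integrable_bound _ _ _ _ _ (modf p q)) => //.
- by measurability.
- by move=> y; apply: abs_rot_le; exact: cos2Dsin2.
Qed.

Lemma measurable_power : measurable_fun setT power.
Proof.
have iN1 : mu.-integrable setT (EFin \o (fun y => - f1 y)).
  by rewrite (_ : (fun y => - f1 y) = (fun y => -1 * f1 y)); [exact: integrable_mulc|apply/funext => y; rewrite mulN1r].
apply: measurable_addf; apply: measurable_expf; first exact: mfour.
rewrite (_ : four_im f1 f2 = fun xi => \int[mu]_y (f2 y * cos (2 * pi * dotrV xi y) + (- f1 y) * sin (2 * pi * dotrV xi y))).
  exact: mfour.
by apply/funext => xi; apply: eq_Rintegral => y _; rewrite mulNr.
Qed.

Lemma power_ge0 xi : 0 <= power xi.
Proof. by rewrite addr_ge0 ?sqr_ge0. Qed.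

Let B := \int[mu]_y modf f1 f2 y.

Let power_le xi : power xi <= 2 * B ^+ 2.
Proof.
have im := integrable_modf i1 i2.
have mf1 : measurable_fun setT f1 by apply/measurable_EFinP; exact: measurable_int i1.
have mf2 : measurable_fun setT f2 by apply/measurable_EFinP; exact: measurable_int i2.
have H (g : V -> R) : measurable_fun setT g -> (forall y, `|g y| <= modf f1 f2 y) -> (\int[mu]_y g y) ^+ 2 <= B ^+ 2.
  move=> mg gle; have ig := integrable_bound mg gle im.
  rewrite -(real_normK (num_real (\int[mu]_y g y))).
  have h : `|\int[mu]_y g y| <= B.
    apply: (le_trans (le_normr_Rintegral _ _)) => //; apply: le_Rintegral => //.
    exact: integrable_norm.
  by rewrite lerXn2r ?nnegrE//; apply: le_trans h.
rewrite /power mulr_natl mulr2n; apply: lerD; apply: H.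
- by measurability.
- by move=> y; apply: abs_rot_le; exact: cos2Dsin2.
- by measurability.
- move=> y; rewrite -mulrN; apply: (le_trans (abs_rot_le _ _ (_ : _ ^+ 2 + _ ^+ 2 = 1))).
    by rewrite sqrrN cos2Dsin2.
  by rewrite /modf addrC.
Qed.

Variables (w al : V -> R).
Hypotheses (iw : mu.-integrable setT (EFin \o w)) (w1 : forall y, `|w y| <= 1).
Hypothesis mal : measurable_fun setT al.

Let mw : measurable_fun setT w. Proof. by apply/measurable_EFinP; exact: measurable_int iw. Qed.

(** The real part of the Fourier transform of the kernel [w e^(i al)]. *)
Definition osc xi := \int[mu]_y (w y * cos (al y - 2 * pi * dotrV xi y)).

Let F (z : V * V) := (power z.1 * gaussw z.1) * (w z.2 * cos (al z.2 - 2 * pi * dotrV z.1 z.2)).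

Let mF : measurable_fun setT F.
Proof.
have a1 := measurableT_comp measurable_power (@measurable_fst _ _ V V).
have a2 := measurableT_comp mw (@measurable_snd _ _ V V).
have a3 := measurableT_comp mal (@measurable_snd _ _ V V).
by rewrite /F /gaussw; measurability.
Qed.

Let ipg : mu.-integrable setT (EFin \o (fun xi => power xi * gaussw xi)).
Proof.
apply: (@integrable_bound _ _ _ _ _ (fun xi => 2 * B ^+ 2 * gaussw xi)).
- by apply: measurable_mulf; [exact: measurable_power|exact: mgauss].
- by move=> xi; rewrite ger0_norm ?mulr_ge0 ?expR_ge0 ?power_ge0// ler_wpM2r ?expR_ge0.
- by apply: integrable_mulc; exact: gauss_rV_integrable.
Qed.

Let abs_cos_le (t : R) : `|cos t| <= 1. Proof. by rewrite ler_norml cos_le1 cos_geN1. Qed.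

Let iF : (mu \x mu)%E.-integrable setT (EFin \o F).
Proof.
apply: (integrable_bound mF (g := fun z => (power z.1 * gaussw z.1) * `|w z.2|)).
  move=> z; rewrite /F normrM ger0_norm ?mulr_ge0 ?expR_ge0 ?power_ge0//.
  by rewrite ler_wpM2l ?mulr_ge0 ?expR_ge0 ?power_ge0// normrM ler_piMr.
exact: (integrable_tensor ipg (integrable_norm iw)).
Qed.

Let iosc xi : mu.-integrable setT (EFin \o (fun y => w y * cos (al y - 2 * pi * dotrV xi y))).
Proof.
apply: (@integrable_bound _ _ _ _ _ (fun y => `|w y|)); last exact: integrable_norm.
- by have m1 := mw; measurability.
- by move=> y; rewrite normrM ler_piMr.
Qed.

Let oscF xi : power xi * gaussw xi * osc xi = \int[mu]_y F (xi, y).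
Proof. by rewrite /osc -RintegralZl. Qed.

Lemma osc_integrable : mu.-integrable setT (EFin \o (fun xi => power xi * gaussw xi * osc xi)).
Proof.
apply: (@integrable_bound _ _ _ _ _ (fun xi => (\int[mu]_y `|w y|) * (power xi * gaussw xi))); last exact: integrable_mulc.
- rewrite (_ : (fun xi => _) = fun xi => fine (fubini_F mu (EFin \o F) xi)); last exact/funext/oscF.
  by apply: measurableT_comp => //; exact: (measurable_fubini_F iF).
- move=> xi; rewrite normrM ger0_norm ?mulr_ge0 ?expR_ge0 ?power_ge0// mulrC.
  rewrite ler_wpM2r ?mulr_ge0 ?expR_ge0 ?power_ge0//.
  apply: (le_trans (le_normr_Rintegral _ _)) => //; apply: le_Rintegral => //.
  + exact: integrable_norm.
  + exact: integrable_norm.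
  by move=> y _; rewrite normrM ler_piMr.
Qed.

(** Integrating in [xi] first pairs the kernel at [y] with the transform of [power * gaussw],
    bounded by [corr_bound] at [y] through [corr_le]; then [|w| <= 1]. *)
Lemma kernel_bound : ((\int[mu]_xi (power xi * gaussw xi * osc xi))%:E <=
  (\int[mu]_y (modf f1 f2 y)%:E) ^+ 2)%E.
Proof.
rewrite -(corr_bound_int i1 i2 dl0).
have iF2 xi : mu.-integrable setT (EFin \o (fun y => F (xi, y))) by exact: (integrable_mulc (power xi * gaussw xi) (iosc xi)).
have Finner y : (fun xi => F (xi, y)) = (fun xi => w y * (power xi * (gaussw xi * cos (al y - 2 * pi * dotrV xi y)))).
  by apply/funext => xi; rewrite /F /=; ring.
have ic y : mu.-integrable setT (EFin \o (fun xi => power xi * (gaussw xi * cos (al y - 2 * pi * dotrV xi y)))).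
  apply: (@integrable_bound _ _ _ _ _ (fun xi => power xi * gaussw xi)); last exact: ipg.
  - have m1 := measurable_power; have m2 := mgauss; by measurability.
  - move=> xi; rewrite mulrA normrM ger0_norm ?mulr_ge0 ?expR_ge0 ?power_ge0//.
    by rewrite ler_piMr ?mulr_ge0 ?expR_ge0 ?power_ge0.
have iF1 y : mu.-integrable setT (EFin \o (fun xi => F (xi, y))).
  by rewrite Finner; exact: integrable_mulc.
have -> : \int[mu]_xi (power xi * gaussw xi * osc xi) = \int[mu]_y \int[mu]_xi F (xi, y).
  by rewrite -(Rfubini iF iF2 iF1); apply: eq_Rintegral => xi _; exact: oscF.
have mI : measurable_fun setT (fun y => \int[mu]_xi F (xi, y)).
  by apply: measurableT_comp => //; exact: (measurable_fubini_G iF).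
have le y : ((`|\int[mu]_xi F (xi, y)|)%:E <= corr_bound f1 f2 dl y)%E.
  rewrite Finner RintegralZl// normrM; apply: le_trans (corr_le i1 i2 dl0 (al y) y).
  by rewrite lee_fin ler_piMl.
(* A real-valued integral that is not finite is 0 by convention, and then the bound is trivial. *)
have [fin|/negbTE nfin] := boolP ((\int[mu]_y (\int[mu]_xi F (xi, y))%:E)%E \is a fin_num); last first.
  rewrite /Rintegral (_ : fine _ = 0); last first.
    by move: nfin; case: (integral _ _ _).
  apply: integral_ge0 => y _; apply: le_trans (le y); rewrite lee_fin; exact: normr_ge0.
rewrite {1}/Rintegral fineK//.
apply: (le_trans (lee_abs _)).
apply: (le_trans (le_abse_integral mu measurableT (_ : measurable_fun setT (fun y => (\int[mu]_xi F (xi, y))%:E)))).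
  exact/measurable_EFinP.
apply: ge0_le_integral => //.
- by apply: measurableT_comp => //; exact/measurable_EFinP.
- exact: measurable_corr_bound.
- by move=> y _; exact: le.
Qed.

End kernel_bound.

Lemma cos_ge_sub (R : realType) (t : R) : 0 <= t -> 1 - t <= cos t.
Proof.
rewrite le_eqVlt => /predU1P[<-|t0]; first by rewrite cos0 subr0.
have dg x : is_derive x (1 : R) (fun u : R => cos u + u) (- sin x + 1).
  by apply: is_derive_eq; rewrite /GRing.scale/=; ring.
have [|x _] := @MVT R (fun u => cos u + u) (fun x => - sin x + 1) 0 t t0 (fun x _ => dg x).
  apply/continuous_subspaceT => x; apply: contD; [exact: continuous_cos|by move=> ?; exact: cvg_id].
rewrite cos0 addr0 subr0 => h.
have : 0 <= (- sin x + 1) * t by rewrite mulr_ge0 ?(ltW t0)//; have := sin_le1 x; lra.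
lra.
Qed.

Lemma ge0_squeeze_scale (R : realType) (T B : \bar R) : (0 <= T)%E -> B \is a fin_num ->
  (forall t : R, 0 < t -> t < 1 -> ((1 - t)%:E * T <= B)%E) -> (T <= B)%E.
Proof.
case: T => [T T0 Bf H|_ Bf H|//].
- rewrite -(fineK Bf) lee_fin; apply: (@le_limit0 _ _ _ T 2^-1) => // t t0 t1.
  have := H t t0 (le_lt_trans t1 _); rewrite -(fineK Bf) -EFinM lee_fin => /(_ _)/wrap[].
    by rewrite invf_lt1// ltr1n.
  lra.
- have := H 2^-1; rewrite invr_gt0 ltr0n invf_lt1// ltr1n => /(_ isT isT).
  rewrite gt0_muley; last by rewrite lte_fin; lra.
  by rewrite leye_eq => /eqP Bo; rewrite Bo in Bf.
Qed.

(** * The energy estimate from the rotated kernel *)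

Section weighted_energy.
Variables (R : realType) (n : nat) (K : set 'rV[R]_n) (xi0 : 'rV[R]_n) (f1 f2 : 'rV[R]_n -> R).
Notation V := 'rV[R]_n.
Notation nrm v := (Num.sqrt (dotrV v v)).
Notation mu := (lebesgue_rV R n).
Hypotheses (openK : open K) (K0 : K 0).
Hypotheses (i1 : mu.-integrable setT (EFin \o f1)) (i2 : mu.-integrable setT (EFin \o f2)).
Notation power := (power f1 f2).
Hypothesis power0 : {ae mu, forall xi, ~ K (xi - xi0) -> power xi = 0}.
Notation h := (suppfin K).

(** The indicator of the cone on which the support function is finite. *)
Definition dom (y : V) : R := (0 < expsupp K y)%R%:R.

Let mh : measurable_fun setT h. Proof. by apply: measurable_suppfin. Qed.

Lemma measurable_dom : measurable_fun setT dom.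
Proof.
apply: measurable_ltR; first exact: measurable_cst.
by apply: measurable_expsupp.
Qed.
Let mdom := measurable_dom.

Lemma dom01 y : dom y = 0 \/ dom y = 1.
Proof. by rewrite /dom; case: (_ < _); [right|left]. Qed.

Lemma dom1 y : dom y = 1 -> 0 < expsupp K y.
Proof. by rewrite /dom; case: (_ < _) => // /eqP; rewrite eq_sym oner_eq0. Qed.

Lemma domZ r y : 0 < r -> dom (r *: y) = dom y.
Proof. by move=> r0; rewrite /dom (expsupp_gt0Z K0). Qed.

(** When [K] is [Omega] translated by [- xi0] and [lam = 1], this is
    [2 pi (h_Omega(y) - <xi, y>)]. *)
Definition gap (lam : R) (xi y : V) : R := 2 * pi * (lam * h y - dotrV (xi - xi0) y).

Let mgap2 lam : measurable_fun setT (fun z : V * V => gap lam z.1 z.2).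
Proof.
have a1 := measurableT_comp mh (@measurable_snd _ _ V V).
by rewrite /gap; measurability.
Qed.

Let mgap lam xi : measurable_fun setT (gap lam xi).
Proof. by rewrite /gap; measurability. Qed.

Let gapZ lam xi r y : 0 < r -> dom y = 1 -> gap lam xi (r *: y) = r * gap lam xi y.
Proof. by move=> r0 /dom1 y0; rewrite /gap (suppfinZ K0)// dotZr; ring. Qed.

Let p2 : 0 < 2 * (pi : R). Proof. by rewrite mulr_gt0// pi_gt0. Qed.

Definition chi (xi : V) : R := \1_[set x | K (x - xi0)] xi.

Let mchi : measurable_fun setT chi.
Proof.
apply: measurable_indic; rewrite -[X in measurable X]setTI.
have ms : measurable_fun setT (fun x : V => x - xi0) by measurability.
by apply: ms => //; exact: open_measurable_rV.
Qed.

Let chi01 xi : (K (xi - xi0) /\ chi xi = 1) \/ (~ K (xi - xi0) /\ chi xi = 0).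
Proof.
rewrite /chi indicE; have [h|h] := pselect (K (xi - xi0)).
  by left; split => //; rewrite mem_set.
by right; split => //; rewrite memNset.
Qed.

Definition weight (lam : R) (xi y : V) : R := chi xi * power xi * (dom y * expR (- gap lam xi y)).

Lemma measurable_weight lam : measurable_fun setT (fun z : V * V => weight lam z.1 z.2).
Proof.
have a1 := measurableT_comp mchi (@measurable_fst _ _ V V).
have a2 := measurableT_comp (measurable_power i1 i2 ltr01) (@measurable_fst _ _ V V).
have a3 := measurableT_comp mdom (@measurable_snd _ _ V V).
have a4 := mgap2 lam.
by rewrite /weight; measurability.
Qed.

Let mweight := measurable_weight.

Lemma weight_ge0 lam xi y : 0 <= weight lam xi y.
Proof.
have d0 : 0 <= dom y by case: (dom01 y) => ->.
have c0 : 0 <= chi xi by case: (chi01 xi) => -[_ ->].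
by rewrite /weight !mulr_ge0 ?expR_ge0 ?power_ge0.
Qed.

Section fixed_scale.
Variables (lam dl : R).
Hypotheses (lam1 : 1 < lam) (dl0 : 0 < dl).
Notation gaussw := (@gaussw R n dl).

Let gap_ge xi y : K (xi - xi0) -> dom y = 1 -> 2 * pi * (lam - 1) * h y <= gap lam xi y.
Proof.
move=> Kxi /dom1 y0; rewrite /gap -mulrA ler_pM2l//.
by have := suppfin_ge y0 Kxi; lra.
Qed.

Let h0 y : dom y = 1 -> 0 <= h y. Proof. by move=> /dom1; exact: suppfin_ge0. Qed.

Let W xi := \int[mu]_y (dom y * expR (- gap lam xi y)).

Let integrable_W s xi : 0 < s -> K (xi - xi0) ->
  mu.-integrable setT (EFin \o (fun y => dom y * expR (- (s * gap lam xi y)))).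
Proof.
move=> s0 Kxi; have [r r0 hr] := suppfin_nrm openK K0.
have l1 : 0 < lam - 1 by rewrite subr_gt0.
apply: (@integrable_bound _ _ _ _ _ (fun y => expR (- (s * (2 * pi * (lam - 1) * r) * nrm y)))).
- by have m1 := mgap lam xi; have m2 := mdom; measurability.
- move=> y; case: (dom01 y) => dy; rewrite dy ?mul0r ?mul1r ?normr0 ?expR_ge0//.
  rewrite ger0_norm ?expR_ge0// ler_expR lerN2 -!mulrA ler_pM2l//.
  apply: le_trans (gap_ge Kxi dy); rewrite -!mulrA !ler_pM2l//; first exact: hr (dom1 dy).
  exact: pi_gt0.
- by apply: integrable_exp_nrm; rewrite !mulr_gt0// pi_gt0.
Qed.

(** [lam / (lam - 1)] bounds [2 pi lam h] by [gap], and [2 ^+ n] is the cost of halving the exponent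
    [gap]. *)
Let kap := 2 ^+ n * (lam / (lam - 1)).

(** The rotation exchanges decay and phase, leaving [e^(- b) cos a] with [b = gap] and a phase [a]
    of order [eps]. Then [cos a >= 1 - a], [a <= eps lam / (lam - 1) b] and
    [b e^(- b) <= e^(- b / 2)]; the last exponential integrates to [2^n W]. *)
Let osc_lower eps xi : 0 < eps -> K (xi - xi0) ->
  W xi * (1 - eps * kap) <=
  \int[mu]_y (dom y * (expR (- (2 * pi * (eps * lam * h y))) * cos (gap lam xi y - n%:R * (pi / 2)))).
Proof.
move=> e0 Kxi; have [r r0 hr] := suppfin_nrm openK K0.
have l1 : 0 < lam - 1 by rewrite subr_gt0.
have l0 : 0 < lam by apply: lt_trans lam1.
have el : 0 < eps * lam by rewrite mulr_gt0.
pose a y := 2 * pi * (eps * lam * h y).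
pose rho := nrm (xi - xi0).
have aE y : dom y = 1 -> a y <= eps * (lam / (lam - 1)) * gap lam xi y.
  move=> dy; have hg := gap_ge Kxi dy.
  have c0 : 0 <= eps * (lam / (lam - 1)) by rewrite mulr_ge0 ?divr_ge0 ?(ltW e0) ?(ltW l0) ?(ltW l1).
  apply: le_trans (ler_wpM2l c0 hg); rewrite le_eqVlt; apply/orP; left; apply/eqP.
  by rewrite /a; field; rewrite gt_eqF.
have bE y : dom y = 1 -> gap lam xi y <= (lam + rho / r) / (eps * lam) * a y.
  move=> dy; have hy := hr y (dom1 dy).
  have h1 : - dotrV (xi - xi0) y <= rho / r * h y.
    have := dot_CS (- (xi - xi0)) y; rewrite dotNl dotNl dotNr opprK -/rho => /le_trans; apply.
    by rewrite -mulrA ler_wpM2l ?sqrtr_ge0// ler_pdivlMl.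
  rewrite (_ : _ * a y = 2 * pi * ((lam + rho / r) * h y)); last first.
    by rewrite /a; field; rewrite !gt_eqF.
  by rewrite /gap ler_pM2l//; lra.
pose c := Num.min (2 * pi * (eps * lam * r)) (2 * pi * ((lam - 1) * r)).
have c0 : 0 < c by rewrite lt_min !mulr_gt0// pi_gt0.
pose L := eps * (lam / (lam - 1)) + (lam + rho / r) / (eps * lam).
have rho0 : 0 <= rho by rewrite sqrtr_ge0.
have L1 : 0 <= eps * (lam / (lam - 1)) by rewrite mulr_ge0 ?divr_ge0 ?(ltW e0) ?(ltW l0) ?(ltW l1).
have L2 : 0 <= (lam + rho / r) / (eps * lam).
  by rewrite divr_ge0 ?(ltW el)// addr_ge0 ?(ltW l0)// divr_ge0 ?(ltW r0).
have ma : measurable_fun setT a by rewrite /a; measurability.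
have ac y : dom y = 1 -> c * nrm y <= a y.
  move=> dy; have hy := hr y (dom1 dy).
  apply: (@le_trans _ _ (2 * pi * (eps * lam * r) * nrm y)); first by rewrite ler_wpM2r ?sqrtr_ge0// ge_min lexx.
  by rewrite /a; have := ler_wpM2l (ltW (mulr_gt0 p2 el)) hy; lra.
have bc y : dom y = 1 -> c * nrm y <= gap lam xi y.
  move=> dy; have hy := hr y (dom1 dy).
  apply: (@le_trans _ _ (2 * pi * ((lam - 1) * r) * nrm y)); first by rewrite ler_wpM2r ?sqrtr_ge0// ge_min lexx orbT.
  by have := gap_ge Kxi dy; have := ler_wpM2l (ltW (mulr_gt0 p2 l1)) hy; lra.
have ab y : dom y = 1 -> a y <= L * gap lam xi y.
  move=> dy; apply: (le_trans (aE y dy)); rewrite ler_wpM2r ?lerDl//.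
  by apply: le_trans (bc y dy); rewrite mulr_ge0 ?sqrtr_ge0 ?(ltW c0).
have ba y : dom y = 1 -> gap lam xi y <= L * a y.
  move=> dy; apply: (le_trans (bE y dy)); rewrite ler_wpM2r ?lerDr//.
  by apply: le_trans (ac y dy); rewrite mulr_ge0 ?sqrtr_ge0 ?(ltW c0).
have aZ s y : 0 < s -> dom y = 1 -> a (s *: y) = s * a y.
  by move=> s0 /dom1 y0; rewrite /a (suppfinZ K0)//; ring.
have rot := @cone_rotation R n dom a (gap lam xi) c L measurable_dom ma (mgap lam xi) dom01
  domZ aZ (@gapZ lam xi) c0 (addr_ge0 L1 L2) ac bc ab ba.
rewrite -[leRHS]rot.
have iW1 := @integrable_W 1 xi ltr01 Kxi.
have iWh := @integrable_W 2^-1 xi (ltac:(by rewrite invr_gt0)) Kxi.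
have iW : mu.-integrable setT (EFin \o (fun y => dom y * expR (- gap lam xi y))).
  by move: iW1; apply: eq_integrable => // y _; rewrite /= mul1r.
have WhE : \int[mu]_y (dom y * expR (- (2^-1 * gap lam xi y))) = 2 ^+ n * W xi.
  have h2 : 0 < 2^-1 :> R by rewrite invr_gt0.
  have [ms Hs] := scales_rV_scale n h2.
  have e2 : 0 <= (2^-1)^-1 ^+ n :> R by rewrite invrK exprn_ge0.
  have := scaled_measure_Rintegral ms e2 Hs iW; rewrite invrK => <-.
  apply: eq_Rintegral => y _; rewrite domZ//.
  by case: (dom01 y) => dy; rewrite dy ?mul0r// gapZ.
have -> : W xi * (1 - eps * kap) = \int[mu]_y (1 * (dom y * expR (- gap lam xi y)) +
    (- (eps * (lam / (lam - 1)))) * (dom y * expR (- (2^-1 * gap lam xi y)))).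
  have j1 := integrable_mulc 1 iW; have j2 := integrable_mulc (- (eps * (lam / (lam - 1)))) iWh.
  rewrite (RintegralD measurableT j1 j2) !RintegralZl// WhE -/(W xi) /kap; ring.
apply: le_Rintegral => //.
- have j1 := integrable_mulc 1 iW; have j2 := integrable_mulc (- (eps * (lam / (lam - 1)))) iWh.
  by have := integrableD measurableT j1 j2; apply: eq_integrable.
- apply: (integrable_bound _ _ iW).
    by have m1 := mgap lam xi; have m2 := mdom; measurability.
  move=> y; case: (dom01 y) => dy; rewrite dy ?mul0r ?mul1r ?normr0//.
  by rewrite normrM ger0_norm ?expR_ge0// ler_piMr ?expR_ge0// ler_norml cos_le1 cos_geN1.
move=> y _; case: (dom01 y) => dy; rewrite dy ?mul0r ?mulr0 ?addr0// !mul1r.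
set b := gap lam xi y.
have b0 : 0 <= b by apply: le_trans (bc y dy); rewrite mulr_ge0 ?sqrtr_ge0 ?(ltW c0).
have a0 : 0 <= a y by apply: le_trans (ac y dy); rewrite mulr_ge0 ?sqrtr_ge0 ?(ltW c0).
have be : b * expR (- b) <= expR (- (2^-1 * b)).
  have e4 : 1 + 4^-1 * b <= expR (4^-1 * b) by exact: expR_ge1Dx.
  have e2 : b <= expR (2^-1 * b).
    rewrite (_ : 2^-1 * b = 2%:R * (4^-1 * b)); last by field.
    rewrite expRM_natl; apply: (@le_trans _ _ ((1 + 4^-1 * b) ^+ 2)).
      by have := sqr_ge0 (1 - 4^-1 * b); lra.
    by rewrite lerXn2r ?nnegrE ?expR_ge0// addr_ge0// mulr_ge0.
  have := ler_wpM2r (expR_ge0 (- b)) e2.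
  by rewrite -expRD (_ : 2^-1 * b - b = - (2^-1 * b)); last by field.
have ca := ler_wpM2l (expR_ge0 (- b)) (cos_ge_sub a0).
have := ler_wpM2l (expR_ge0 (- b)) (aE y dy).
have := ler_wpM2l L1 be; rewrite -/b; lra.
Qed.

Lemma energy_fixed_scale :
  (\int[mu]_xi \int[mu]_y (gaussw xi * weight lam xi y)%:E <= (\int[mu]_x (modf f1 f2 x)%:E) ^+ 2)%E.
Proof.
set B2 := (_ ^+ 2)%E.
have im := integrable_modf i1 i2.
have B2f : B2 \is a fin_num.
  by rewrite /B2 expe2 fin_numM//; exact: (integrable_fin_num measurableT im).
pose H (z : V * V) := (gaussw z.1 * weight lam z.1 z.2)%:E.
have mH : measurable_fun setT H.
  by have a1 := mweight lam; apply/measurable_EFinP; rewrite /gaussw; measurability.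
have H0 z : (0 <= H z)%E by rewrite lee_fin mulr_ge0 ?expR_ge0 ?weight_ge0.
have mI := @measurable_fun_fubini_tonelli_F _ _ _ _ _ mu H mH H0.
have I0 xi : (0 <= \int[mu]_y (gaussw xi * weight lam xi y)%:E)%E.
  by apply: integral_ge0 => y _; exact: (H0 (xi, y)).
have l1 : 0 < lam - 1 by rewrite subr_gt0.
have l0 : 0 < lam by apply: lt_trans lam1.
have kap0 : 0 < kap by rewrite mulr_gt0 ?exprn_gt0// divr_gt0.
apply: ge0_squeeze_scale => // [|t t0 t1]; first by apply: integral_ge0 => xi _.
pose eps := t / kap; have e0 : 0 < eps by rewrite divr_gt0.
have ek : eps * kap = t by rewrite divfK// gt_eqF.
(* [w e^(i al)] is the kernel [e^(- 2 pi (eps - i) lam h)], modulated so that its transform is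
   centred at [xi0], and multiplied by [i^(- n)], which makes the rotated transform real up to a
   small phase. *)
pose w y := dom y * expR (- (2 * pi * (eps * lam * h y))).
pose al y := 2 * pi * (lam * h y) + 2 * pi * dotrV xi0 y - n%:R * (pi / 2).
have mal : measurable_fun setT al by rewrite /al; measurability.
have mw : measurable_fun setT w by have m2 := mdom; rewrite /w; measurability.
have el : 0 < eps * lam by rewrite mulr_gt0.
have [r r0 hr] := suppfin_nrm openK K0.
have iw : mu.-integrable setT (EFin \o w).
  apply: (@integrable_bound _ _ _ _ _ (fun y => expR (- (2 * pi * (eps * lam) * r * nrm y)))) => //.
    move=> y; rewrite /w; case: (dom01 y) => dy; rewrite dy ?mul0r ?mul1r ?normr0 ?expR_ge0//.
    rewrite ger0_norm ?expR_ge0// ler_expR lerN2.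
    by have := ler_wpM2l (ltW (mulr_gt0 p2 el)) (hr y (dom1 dy)); lra.
  by apply: integrable_exp_nrm; exact: mulr_gt0 (mulr_gt0 p2 el) r0.
have w1 y : `|w y| <= 1.
  rewrite /w; case: (dom01 y) => dy; rewrite dy ?mul0r ?mul1r ?normr0//.
  rewrite ger0_norm ?expR_ge0// -[leRHS]expR0 ler_expR oppr_le0.
  by apply: mulr_ge0 (ltW p2) _; exact: mulr_ge0 (ltW el) (h0 dy).
have oscE xi : osc w al xi = \int[mu]_y (dom y * (expR (- (2 * pi * (eps * lam * h y))) *
    cos (gap lam xi y - n%:R * (pi / 2)))).
  apply: eq_Rintegral => y _; rewrite /w -mulrA; congr (_ * (_ * cos _)).
  by rewrite /al /gap dotBl; ring.
have iosc := osc_integrable i1 i2 dl0 iw mal.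
have mosc : measurable_fun setT (fun xi => power xi * gaussw xi * osc w al xi).
  by apply/measurable_EFinP; exact: measurable_int iosc.
rewrite -ge0_integralZl//; last by rewrite lee_fin subr_ge0 ltW.
apply: (@le_trans _ _ (\int[mu]_xi (chi xi * (power xi * gaussw xi * osc w al xi))%:E)%E).
  apply: ge0_le_integral => //.
  - by move=> xi _; rewrite mule_ge0// lee_fin subr_ge0 ltW.
  - by apply: measurable_funeM.
  - by apply/measurable_EFinP; apply: measurable_mulf.
  move=> xi _; case: (chi01 xi) => -[Kxi cE]; last first.
    rewrite cE mul0r integral0_eq ?mule0// => y _.
    by rewrite /weight cE !mul0r mulr0.
  rewrite cE mul1r.
  have iW1 := integrable_W ltr01 Kxi.
  have iW : mu.-integrable setT (EFin \o (fun y => dom y * expR (- gap lam xi y))).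
    by move: iW1; apply: eq_integrable => // y _; rewrite /= mul1r.
  have -> : (\int[mu]_y (gaussw xi * weight lam xi y)%:E)%E = (power xi * gaussw xi * W xi)%:E.
    have iz := integrable_mulc (power xi * gaussw xi) iW.
    rewrite /W -RintegralZl// /Rintegral fineK; last exact: (integrable_fin_num measurableT iz).
    by apply: eq_integral => y _; rewrite /weight cE; congr _%:E; ring.
  rewrite -EFinM lee_fin mulrCA ler_wpM2l ?mulr_ge0 ?expR_ge0 ?power_ge0//.
  by rewrite mulrC -{1}ek oscE; exact: osc_lower.
(* The lower bound on [osc] holds only on the translated [K]; the integral extends to the whole
   space because [power] vanishes almost everywhere else. *)
rewrite (_ : (\int[mu]_xi _)%E = (\int[mu]_xi (power xi * gaussw xi * osc w al xi)%:E)%E); last first.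
  apply: ae_eq_integral => //.
  - by apply/measurable_EFinP; apply: measurable_mulf.
  - exact/measurable_EFinP.
  apply: filterS power0 => xi p0 _; case: (chi01 xi) => -[Kxi cE]; rewrite cE ?mul1r//.
  by rewrite (p0 Kxi) !mul0r.
have := kernel_bound i1 i2 dl0 iw w1 mal.
by rewrite /Rintegral fineK//; exact: (integrable_fin_num measurableT iosc).
Qed.

End fixed_scale.

(** [lam - 1] and [dl] tend to 0 together. The exponent is linear in this parameter with slope
    [- (|xi|^2 + 2 pi h) <= 0] on [dom], so the integrands increase and monotone convergence
    applies. *)
Lemma weighted_energy :
  (\int[mu]_xi \int[mu]_y (weight 1 xi y)%:E <= (\int[mu]_x (modf f1 f2 x)%:E) ^+ 2)%E.
Proof.
pose H (k : nat) (z : V * V) := (gaussw k.+1%:R^-1 z.1 * weight (1 + k.+1%:R^-1) z.1 z.2)%:E.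
have mH k : measurable_fun setT (H k).
  by have a1 := mweight (1 + k.+1%:R^-1); apply/measurable_EFinP; rewrite /gaussw; measurability.
have H0 k z : (0 <= H k z)%E by rewrite lee_fin mulr_ge0 ?expR_ge0 ?weight_ge0.
pose phi (z : V * V) (t : R) := chi z.1 * power z.1 * dom z.2 *
  expR (- gap 1 z.1 z.2 - t * (dotrV z.1 z.1 + 2 * pi * h z.2)).
have HE k z : H k z = (phi z k.+1%:R^-1)%:E.
  rewrite /H /phi /weight /gaussw; congr _%:E.
  rewrite (_ : _ * (_ * _) = chi z.1 * power z.1 * dom z.2 *
    (expR (- (k.+1%:R^-1 * dotrV z.1 z.1)) * expR (- gap (1 + k.+1%:R^-1) z.1 z.2))); last by ring.
  by rewrite -expRD; congr (_ * expR _); rewrite /gap; ring.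
have phi0 z : phi z 0 = weight 1 z.1 z.2 by rewrite /phi /weight mul0r subr0 -mulrA.
have cphi z : H ^~ z @ \oo --> (weight 1 z.1 z.2)%:E.
  under eq_fun do rewrite HE.
  apply/fine_cvgP; split; first by near=> k.
  rewrite -phi0; have cp : continuous (phi z).
    rewrite /phi; apply: contM; first exact: contC.
    have cf : continuous (fun t : R => - gap 1 z.1 z.2 - t * (dotrV z.1 z.1 + 2 * pi * h z.2)).
      apply: contB; first exact: contC.
      by apply: (contM (f := fun t : R => t)); [move=> u; exact: cvg_id|exact: contC].
    by move=> t; apply: (continuous_comp (cf t)); exact: continuous_expR.
  exact: (continuous_cvg _ (cp 0) (@cvg_harmonic R)).
have ndH z : {homo H ^~ z : a b / (a <= b)%N >-> (a <= b)%E}.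
  move=> a b le_ab; rewrite /= !HE lee_fin /phi.
  case: (dom01 z.2) => dz; rewrite dz ?mulr0 ?mul0r// !mulr1.
  have c0 : 0 <= chi z.1 by case: (chi01 z.1) => -[_ ->].
  apply: ler_wpM2l; first by rewrite mulr_ge0 ?power_ge0.
  rewrite ler_expR lerD2l lerN2 ler_wpM2r ?lef_pV2 ?posrE ?ltr0n ?ler_nat//.
  rewrite addr_ge0 ?dot_ge0// mulr_ge0 ?(ltW p2)//; exact: (suppfin_ge0 K0 (dom1 dz)).
have cv := @cvg_monotone_convergence _ _ _ (lebE R n) setT measurableT H mH (fun k z _ => H0 k z) (fun z _ => ndH z).
have -> : (\int[mu]_xi \int[mu]_y (weight 1 xi y)%:E = \int[lebE R n]_z limn (H ^~ z))%E.
  rewrite (_ : (fun z => limn (H ^~ z)) = fun z => (weight 1 z.1 z.2)%:E); last first.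
    by apply/funext => z; apply/cvg_lim => //; exact: cphi.
  rewrite (@lebE_tonelli _ _ (fun z => (weight 1 z.1 z.2)%:E))//; last by move=> z; rewrite lee_fin weight_ge0.
  by have a1 := mweight 1; exact/measurable_EFinP.
rewrite -(cvg_lim _ cv)//; apply: lime_le; first by apply/cvg_ex; eexists; exact: cv.
near=> k; rewrite /= lebE_tonelli//.
apply: energy_fixed_scale; last by rewrite invr_gt0.
by rewrite ltrDl invr_gt0.
Unshelve. all: by end_near. Qed.

End weighted_energy.

(** * The theorem *)

(** The integral of a nonnegative function is a supremum over the simple functions below it, hence
    monotone for arbitrary functions; so [omega] can be compared pointwise as it is. *)
Lemma le_integral_nonmeasurable d (T : measurableType d) (R : realType)
    (mu : {measure set T -> \bar R}) (f g : T -> \bar R) :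
  (forall x, 0 <= f x)%E -> (forall x, f x <= g x)%E ->
  (\int[mu]_x f x <= \int[mu]_x g x)%E.
Proof.
move=> f0 fg; have g0 x : (0 <= g x)%E by exact: le_trans (fg x).
rewrite !ge0_integralTE//; apply: ereal_sup_le => _ [h hf <-].
by exists h => // x; exact: le_trans (hf x) (fg x).
Qed.

Section translated_domain.
Variables (R : realType) (n : nat) (Omega : set 'rV[R]_n).
Notation V := 'rV[R]_n.
Notation mu := (lebesgue_rV R n).
Hypotheses (openO : open Omega) (convO : convex_set Omega).

Definition centered (xi : V) : set V := [set x | Omega (x + xi)].

Lemma open_centered xi : open (centered xi).
Proof.
rewrite openE => x /= Ox; have /nbhs_ballP[e /= e0 eO] := open_nbhs_nbhs (conj openO Ox).
apply/nbhs_ballP; exists e => //= y; rewrite -ball_normE /= => xy.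
by apply: eO; rewrite -ball_normE /= opprD addrACA subrr addr0.
Qed.

Lemma centered0 xi : Omega xi -> centered xi 0.
Proof. by rewrite /centered /= add0r. Qed.

Lemma convex_centered xi x y t : 0 <= t -> t <= 1 -> centered xi x -> centered xi y ->
  centered xi (t *: x + (1 - t) *: y).
Proof.
rewrite /centered /= => t0 t1 Kx Ky.
have := convO (Itv01 t0 t1) (mem_set Kx) (mem_set Ky); rewrite inE.
congr (Omega _).
transitivity (t *: (x + xi) + (1 - t) *: (y + xi)); first by [].
by rewrite !scalerDr addrACA -scalerDl addrCA subrr addr0 scale1r.
Qed.

Lemma omegaE xi : omega Omega xi = mu [set x | centered xi x /\ centered xi (- x)].
Proof.
have mC : measurable (Omega `&` [set 2 *: xi - y | y in Omega]).
  rewrite (_ : [set _ | _ in _] = (fun y => 2 *: xi - y) @^-1` Omega).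
    apply: measurableI; first exact: open_measurable_rV.
    rewrite -[X in measurable X]setTI.
    have ms : measurable_fun setT (fun y : V => 2 *: xi - y) by measurability.
    by apply: ms => //; exact: open_measurable_rV.
  apply/seteqP; split => y /=; first by move=> [z Oz <-]; rewrite subKr.
  by move=> Oy; exists (2 *: xi - y) => //; rewrite subKr.
have [_ Hs] := scales_rV_shift xi.
rewrite /omega -[LHS]mul1e -(Hs _ mC); congr (mu _).
rewrite /centered; apply/seteqP; split => x /= [Ox].
  move=> [z Oz zE]; split => //.
  by rewrite (_ : - x + xi = z)// -[z](subKr (2 *: xi)) zE scaler_nat mulr2n opprD addrACA subrr addr0 addrC.
move=> Ox'; split => //; exists (- x + xi) => //.
by rewrite scaler_nat mulr2n opprD opprK addrACA subrr addr0 addrC.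
Qed.

(** Translation adds a linear term to the support function. This identifies the weight built at the
    fixed centre [xi0] with the integrand of [mahler] at a varying [xi]. *)
Lemma expsupp_centered (xi0 xi v : V) : Omega xi0 -> Omega xi ->
  expsupp (centered xi) v = expR (dotrV (xi - xi0) v) * expsupp (centered xi0) v.
Proof.
move=> O0 O1.
have H (a b : V) : Omega a -> Omega b ->
    expR (dotrV (a - b) v) * expsupp (centered b) v <= expsupp (centered a) v.
  move=> Oa Ob; apply: (le_expsupp (centered0 Oa)) => t Ct.
  have Cb : centered b (t + (a - b)) by rewrite /centered /= addrA subrK.
  apply: (le_trans (ler_wpM2l (expR_ge0 _) (expsupp_le v Cb))).
  by rewrite -expRD (dotDl t) opprD addrCA subrr addr0.
apply/eqP; rewrite eq_le H// andbT.
have := ler_wpM2l (expR_ge0 (dotrV (xi - xi0) v)) (H _ _ O0 O1).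
by rewrite mulrA -expRD -dotDl addrA subrK subrr dot0l expR0 mul1r.
Qed.

End translated_domain.

Theorem theorem1p1 (R : realType) (n : nat) (Omega : set 'rV[R]_n)
    (openOmega : open Omega) (convexOmega : convex_set Omega)
    (noline : ~ contains_affine_line Omega)
    (f : 'rV[R]_n -> R[i]) (PWf : PW1 Omega f) :
  (\int[lebesgue_rV R n]_(x in Omega)
      ((Normc.normc (fourier f x) ^+ 2)%:E / omega Omega x)
   <= (2 ^+ n * (2 * n)`!%:R * Gamma (n%:R / 2 + 1) ^+ 2 / n`!%:R ^+ 3)%:E
      * L1norm f ^+ 2)%E.
Proof.
set mu := lebesgue_rV R n; set C := (2 ^+ n * _ * _ / _)%R.
have C0 : 0 <= C.
  by rewrite /C divr_ge0 ?exprn_ge0// mulr_ge0 ?sqr_ge0// mulr_ge0 ?exprn_ge0.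
have L0 : (0 <= L1norm f)%E.
  by apply: integral_ge0 => x _; rewrite lee_fin; case: (f x) => a b; exact: sqrtr_ge0.
have [em|/set0P[xi0 Oxi0]] := eqVneq Omega set0.
  by rewrite em integral_set0; apply: mule_ge0; [rewrite lee_fin|rewrite expe2 mule_ge0].
have [[i1 i2] fae] := PWf.
pose f1 y := complex.Re (f y); pose f2 y := complex.Im (f y).
have fE y : f y = (f1 y +i* f2 y)%C by rewrite /f1 /f2; case: (f y).
have powE xi : Normc.normc (fourier f xi) ^+ 2 = power f1 f2 xi.
  rewrite /fourier /cintegral /Normc.normc sqr_sqrtr ?addr_ge0 ?sqr_ge0//.
  rewrite /power; congr (_ ^+ 2 + _ ^+ 2); apply: eq_Rintegral => y _.
    by rewrite fE /expi /= cosN sinN mulrN opprK.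
  by rewrite fE /expi /= cosN sinN mulrN addrC.
have L1E : L1norm f = (\int[mu]_x (modf f1 f2 x)%:E)%E.
  by apply: eq_integral => x _; rewrite fE.
have oK := @open_centered R n Omega openOmega xi0.
have K0 := centered0 Oxi0.
have cE xi : centered Omega xi0 (xi - xi0) = Omega xi by rewrite /centered /= subrK.
have pw0 : {ae mu, forall xi, ~ centered Omega xi0 (xi - xi0) -> power f1 f2 xi = 0}.
  apply: filterS fae => xi h; rewrite cE => /h f0.
  by rewrite -powE f0 /Normc.normc /= expr0n /= addr0 sqrtr0 expr0n.
have energy := weighted_energy oK K0 i1 i2 pw0.
rewrite L1E; apply: (@le_trans _ _ (C%:E * \int[mu]_xi \int[mu]_y (weight (centered Omega xi0) xi0 f1 f2 1 xi y)%:E)%E); last first.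
  by apply: lee_wpmul2l; rewrite ?lee_fin.
have wt0 xi y : (0 <= (weight (centered Omega xi0) xi0 f1 f2 1 xi y)%:E)%E.
  by rewrite lee_fin weight_ge0.
have mw : measurable_fun setT (fun z : 'rV[R]_n * 'rV[R]_n =>
    (weight (centered Omega xi0) xi0 f1 f2 1 z.1 z.2)%:E).
  by apply/measurable_EFinP; apply: measurable_weight.
rewrite integral_mkcond -ge0_integralZl//; last 2 first.
- exact: (@measurable_fun_fubini_tonelli_F _ _ _ _ _ mu _ mw (fun z => wt0 z.1 z.2)).
- by move=> xi _; apply: integral_ge0.
have om0 xi : (0 <= omega Omega xi)%E by exact: measure_ge0.
apply: le_integral_nonmeasurable => xi.
  by rewrite patchE; case: ifP => // _; rewrite mule_ge0 ?inve_ge0// lee_fin exprn_ge0// sqrtr_ge0.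
rewrite patchE; case: ifPn => [|_]; last by rewrite mule_ge0 ?lee_fin//; apply: integral_ge0.
rewrite inE => Oxi; rewrite powE.
(* The inverse of [+oo] is 0, so the left side vanishes. *)
have [->|om_fin] := eqVneq (omega Omega xi) +oo%E.
  by rewrite invey mule0 mule_ge0 ?lee_fin//; apply: integral_ge0.
have {om_fin} : (omega Omega xi < +oo)%E by rewrite lt_neqAle om_fin leey.
rewrite (omegaE openOmega) => om_fin.
have Kx0 := centered0 Oxi.
have := mahler (@open_centered R n Omega openOmega xi) Kx0 (@convex_centered R n Omega convexOmega xi) om_fin.
have : lebesgue_rV R n [set x | centered Omega xi x /\ centered Omega xi (- x)] \is a fin_num.
  by rewrite ge0_fin_numE.
move=> /fineK <-; set r := fine _; set N := (\int[_]_v _)%E => mah.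
have pi0 := pi_gt0 R.
have tpi : 0 < 2 * (pi : R) by rewrite mulr_gt0.
have a0 : 0 < n`!%:R ^+ 3 * (2 * pi) ^+ n :> R by rewrite mulr_gt0 ?exprn_gt0// ltr0n fact_gt0.
(* Read off from [mah] itself: for [r = 0] its right side would be 0, below a positive constant. *)
have r0 : 0 < r.
  have : 0 <= r by apply: fine_ge0; exact: measure_ge0.
  rewrite le_eqVlt => /predU1P[r0|//]; move: mah; rewrite -r0 mul0e mule0 lee_fin.
  by rewrite leNgt a0.
have N0 : (0 <= N)%E by apply: integral_ge0 => v _; rewrite lee_fin expsupp_ge0.
set p := power f1 f2 xi; have p0 : 0 <= p := power_ge0 _ _ _.
have mes := measurable_expsupp Kx0.
(* The substitution [v = 2 pi y] brings the weight to the normalisation [e^(- h)] of [mahler]. *)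
have -> : (\int[mu]_y (weight (centered Omega xi0) xi0 f1 f2 1 xi y)%:E = (p * (2 * pi)^-1 ^+ n)%:E * N)%E.
  rewrite EFinM -muleA /N.
  rewrite -(@lebesgue_rV_int_scale _ _ (fun v => (expsupp (centered Omega xi) v)%:E) _ tpi); last 2 first.
  - exact/measurable_EFinP.
  - by move=> v; rewrite lee_fin expsupp_ge0.
  rewrite -ge0_integralZl//; last 2 first.
  - by apply/measurable_EFinP; apply: (measurableT_comp mes); measurability.
  - by move=> y _; rewrite lee_fin expsupp_ge0.
  apply: eq_integral => y _; rewrite -EFinM; congr _%:E.
  have -> : weight (centered Omega xi0) xi0 f1 f2 1 xi y =
      p * (dom (centered Omega xi0) y * expR (- gap (centered Omega xi0) xi0 1 xi y)).
    by rewrite /weight /chi indicE mem_set ?mul1r//= cE.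
  congr (_ * _).
  rewrite (expsupp_centered _ Oxi0 Oxi) /dom /gap dotZr mul1r.
  have yy := expsupp_gt0Z K0 y tpi.
  have [y0|y0] := ltP 0 (expsupp (centered Omega xi0) y).
    rewrite y0 in yy; have ee := expsuppE yy; rewrite (suppfinZ K0 tpi y0) in ee.
    rewrite ee -expRD mul1r; apply: f_equal; ring.
  rewrite mul0r; have e0 : expsupp (centered Omega xi0) ((2 * pi) *: y) <= 0 by rewrite leNgt yy -leNgt.
  by rewrite (le_anti (introT andP (conj e0 (expsupp_ge0 K0 _)))) mulr0.
rewrite inver gt_eqF// -EFinM.
set a := (n`!%:R ^+ 3 * _)%R in mah a0; set c := (_`!%:R * _ * _)%R in mah.
(* Multiplied by [p / (r a)], [mah] reads [p / r <= (p c / a) N], and the factor [(2 pi)^n] of [a]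
   matches the one from the substitution, leaving [C]. *)
have k0 : (0 <= (p / (r * a))%:E)%E by rewrite lee_fin divr_ge0// mulr_ge0 ?ltW.
have := lee_wpmul2l k0 mah; rewrite -EFinM !muleA -!EFinM.
have fn : n`!%:R != 0 :> R by rewrite pnatr_eq0 -lt0n fact_gt0.
rewrite (_ : p / (r * a) * a = p / r); last by field; rewrite !gt_eqF.
rewrite (_ : p / (r * a) * c * r = C * (p * (2 * pi)^-1 ^+ n))//.
rewrite /C /c /a exprVn.
by field; rewrite fn !gt_eqF// exprn_gt0.
Qed.
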